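(* Let $p$ be a prime and $n\ge 2$ an integer. There is an isomorphism of rings $$\bigl(\pi_*\,tE(n)\bigr)^{\wedge}_{I_{n-1}}\;\cong\;\bigl(E(n-1)_*(\!(x)\!)\bigr)^{\wedge}_{I_{n-1}}.$$
   Context: $E(m)$ is the Johnson--Wilson spectrum at $p$, with $E(m)_*=\mathbf{Z}_{(p)}[v_1,\dots,v_{m-1},v_m^{\pm1}]$, where $v_i$ is the $i$-th Araki generator, $|v_i|=2(p^i-1)$, $v_0=p$; it is complex oriented via $BP$. For a spectrum $E$, $tE$ denotes the Mahowald inverse limit $tE=\varprojlim_k (P_{-k}\wedge\Sigma E)$, where $P_{-k}$ is the stunted projective spectrum $\mathbf{R}P^\infty_{-k}$ for $p=2$ or its analogue for $B\mathbf{Z}/(p)$ for $p$ odd; equivalently $tE$ is the fixed point spectrum of the Greenlees--May $\mathbf{Z}/(p)$-Tate spectrum of $E$ with trivial action. If $E$ is a ring spectrum so is $tE$. For $E=E(n)$ one has $\pi_*tE(n)=E(n)_*(\!(x)\!)/([p](x))$ with $|x|=-2$, where $[p](x)$ is the $p$-series of the formal group law of $E(n)$. For a graded ring $R$, $R(\!(x)\!)$ is the graded ring of formal Laurent series over $R$, infinite in positive powers of $x$ but finite in $x^{-1}$, with $|x|=-2$. $I_{n-1}=(p,v_1,\dots,v_{n-2})$, and $(-)^\wedge_{I_{n-1}}$ denotes (graded) completion with respect to this ideal. *)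

(* Defs.v *)
From HB Require Import structures.
From mathcomp Require Import all_boot all_order all_algebra.
From mathcomp Require Import generic_quotient.
From mathcomp Require Import mpoly.
From mathcomp Require Import boolp classical_sets fsbigop.
From mathcomp Require Import zify ring.

Set Implicit Arguments.
Unset Strict Implicit.
Unset Printing Implicit Defensive.

Import Order.TTheory GRing.Theory Num.Theory.
Local Open Scope quotient_scope.
Local Open Scope ring_scope.

(******************************************************************************)
(* Graded commutative rings, in internal form: a ring with additive subgroups *)
(* of_degree d (d : int) such that of_degree d * of_degree e lies in of_degree (d + e) and    *)
(* every element is a finite sum of homogeneous ones.  So the underlying ring *)
(* of a graded ring is the direct sum of its homogeneous parts.  Directness   *)
(* of the sum is not recorded; it holds for all the rings built below.        *)
(* No Koszul sign is needed as all these rings live in even degrees.          *)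
(******************************************************************************)

Record grading (T : comPzRingType) := Grading {
  of_degree : int -> T -> Prop;
  homog0 : forall d, of_degree d 0;
  homogB : forall d x y, of_degree d x -> of_degree d y -> of_degree d (x - y);
  homog1 : of_degree 0 1;
  homogM : forall d e x y, of_degree d x -> of_degree e y -> of_degree (d + e) (x * y)
}.

Definition homog_sum (T : comPzRingType) (H : grading T) (x : T) : Prop :=
  exists2 s : seq T, (forall y, y \in s -> exists d, of_degree H d y)
                   & x = \sum_(y <- s) y.

Record gring := Gring {
  gsort :> comPzRingType;
  gr : grading gsort;
  gspan : forall x : gsort, homog_sum gr x
}.

Section HomogSums.
Variables (T : comPzRingType) (H : grading T).

Lemma homogN d x : of_degree H d x -> of_degree H d (- x).
Proof. by move=> hx; rewrite -sub0r; apply: homogB => //; apply: homog0. Qed.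

Lemma homogD d x y : of_degree H d x -> of_degree H d y -> of_degree H d (x + y).
Proof. by move=> hx hy; rewrite -[y]opprK; apply/homogB/homogN. Qed.

Lemma homog_sum_homog d x : of_degree H d x -> homog_sum H x.
Proof.
move=> hx; exists [:: x]; last by rewrite big_seq1.
by move=> y; rewrite inE => /eqP ->; exists d.
Qed.

Lemma homog_sum0 : homog_sum H 0.
Proof. exact: homog_sum_homog (homog0 H 0). Qed.

Lemma homog_sumD x y : homog_sum H x -> homog_sum H y -> homog_sum H (x + y).
Proof.
move=> [s hs ->] [t ht ->]; exists (s ++ t); last by rewrite big_cat.
by move=> z; rewrite mem_cat => /orP[/hs|/ht].
Qed.

Lemma homog_sumN x : homog_sum H x -> homog_sum H (- x).
Proof.
move=> [s hs ->]; exists [seq - y | y <- s]; last first.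
  by rewrite big_map sumrN.
by move=> _ /mapP[z /hs [d hz] ->]; exists d; apply: homogN.
Qed.

Lemma homog_sum_sum (I : eqType) (r : seq I) (F : I -> T) :
  (forall i, i \in r -> homog_sum H (F i)) -> homog_sum H (\sum_(i <- r) F i).
Proof.
move=> hF; rewrite big_seq; elim/big_ind: _ => //; first exact: homog_sum0.
exact: homog_sumD.
Qed.

Lemma homog_sumM x y : homog_sum H x -> homog_sum H y -> homog_sum H (x * y).
Proof.
move=> [s hs ->] [t ht ->]; rewrite big_distrl /=.
apply: homog_sum_sum => a /hs[d ha]; rewrite big_distrr /=.
apply: homog_sum_sum => b /ht[e hb].
by apply: homog_sum_homog (homogM ha hb).
Qed.

Definition gpart_pred : {pred T} := fun x => `[< homog_sum H x >].

Lemma gpart_subring : subring_closed gpart_pred.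
Proof.
split.
- by apply/asboolP; apply: homog_sum_homog (homog1 H).
- move=> x y /asboolP hx /asboolP hy; apply/asboolP.
  by apply: homog_sumD => //; apply: homog_sumN.
- by move=> x y /asboolP hx /asboolP hy; apply/asboolP; apply: homog_sumM.
Qed.

(* The subring of finite sums of homogeneous elements. *)
Record gpart_sort := GpartSort {
  gpart_val : T;
  gpart_valP : gpart_val \in gpart_pred
}.
HB.instance Definition _ := [isSub for gpart_val].
HB.instance Definition _ := [Choice of gpart_sort by <:].
HB.instance Definition _ :=
  GRing.SubChoice_isSubComPzRing.Build T gpart_pred gpart_sort gpart_subring.

Definition gpart_homog (d : int) (x : gpart_sort) := of_degree H d (val x).

Fact gpart_homog0 d : gpart_homog d 0.
Proof. by rewrite /gpart_homog rmorph0; apply: homog0. Qed.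
Fact gpart_homogB d x y :
  gpart_homog d x -> gpart_homog d y -> gpart_homog d (x - y).
Proof. by rewrite /gpart_homog rmorphB; apply: homogB. Qed.
Fact gpart_homog1 : gpart_homog 0 1.
Proof. by rewrite /gpart_homog rmorph1; apply: homog1. Qed.
Fact gpart_homogM d e x y :
  gpart_homog d x -> gpart_homog e y -> gpart_homog (d + e) (x * y).
Proof. by rewrite /gpart_homog rmorphM; apply: homogM. Qed.

Definition gpart_grading : grading gpart_sort :=
  Grading gpart_homog0 gpart_homogB gpart_homog1 gpart_homogM.

Fact gpart_span x : homog_sum gpart_grading x.
Proof.
have /asboolP[s hs defx] := gpart_valP x.
have hs' y : y \in s -> y \in gpart_pred.
  by move=> /hs[d hy]; apply/asboolP; apply: homog_sum_homog hy.
exists (pmap insub s).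
  move=> y; rewrite mem_pmap_sub => ys.
  by have [d hy] := hs _ ys; exists d.
apply: val_inj; rewrite rmorph_sum /= [LHS]defx.
elim: s hs' {hs defx} => [|a s IHs] hs; first by rewrite !big_nil.
rewrite /= insubT; first by apply: hs; rewrite mem_head.
move=> ha; rewrite /= !big_cons IHs // => y ys.
by apply: hs; rewrite inE ys orbT.
Qed.

Definition gpart : gring := Gring gpart_span.

End HomogSums.

Record ideal (A : comPzRingType) := Ideal {
  mem_ideal :> A -> Prop;
  ideal0 : mem_ideal 0;
  idealD : forall x y, mem_ideal x -> mem_ideal y -> mem_ideal (x + y);
  idealMl : forall a x, mem_ideal x -> mem_ideal (a * x)
}.

Section IdealGen.
Variables (A : comPzRingType) (S : A -> Prop).

Definition in_ideal_gen (x : A) : Prop :=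
  exists2 s : seq (A * A), (forall u, u \in s -> S u.2)
                         & x = \sum_(u <- s) u.1 * u.2.

Fact ideal_gen0 : in_ideal_gen 0.
Proof. by exists [::] => //; rewrite big_nil. Qed.
Fact ideal_genD x y : in_ideal_gen x -> in_ideal_gen y -> in_ideal_gen (x + y).
Proof.
move=> [s hs ->] [t ht ->]; exists (s ++ t); last by rewrite big_cat.
by move=> z; rewrite mem_cat => /orP[/hs|/ht].
Qed.
Fact ideal_genM a x : in_ideal_gen x -> in_ideal_gen (a * x).
Proof.
move=> [s hs ->]; exists [seq (a * u.1, u.2) | u <- s].
  by move=> _ /mapP[u /hs su ->].
by rewrite big_map big_distrr; apply: eq_bigr => u _; rewrite /= mulrA.
Qed.

Definition ideal_gen : ideal A := Ideal ideal_gen0 ideal_genD ideal_genM.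

End IdealGen.

Section Ideals.
Variable A : comPzRingType.

Definition ideal_mul (I J : ideal A) : ideal A :=
  ideal_gen (fun x => exists a b, [/\ I a, J b & x = a * b]).

Definition ideal_unit : ideal A := ideal_gen (fun=> True).

Fixpoint ideal_exp (I : ideal A) (k : nat) : ideal A :=
  if k is k'.+1 then ideal_mul I (ideal_exp I k') else ideal_unit.

Variable I : ideal A.

Definition ideal_pred : {pred A} := fun x => `[< I x >].

Fact ideal_zmod_closed : zmod_closed ideal_pred.
Proof.
split; first by apply/asboolP/ideal0.
move=> x y /asboolP hx /asboolP hy; apply/asboolP/idealD => //.
by rewrite -mulN1r; apply: idealMl.
Qed.
HB.instance Definition _ :=
  GRing.isZmodClosed.Build A ideal_pred ideal_zmod_closed.

(* The quotient ring A / I, which may be the zero ring. *)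
Definition quotring : Type := Quotient.quot ideal_pred.
HB.instance Definition _ := GRing.Zmodule.copy quotring (Quotient.quot ideal_pred).

Definition qclass (x : A) : quotring := \pi_(Quotient.quot ideal_pred) x.

Lemma qclassE x y : qclass x = qclass y <-> I (x - y).
Proof.
rewrite /qclass; split=> [/eqP|] h.
  by move: h; rewrite -Quotient.idealrBE => /asboolP.
by apply/eqP; rewrite -Quotient.idealrBE; apply/asboolP.
Qed.

Lemma qclass_repr (u : quotring) : exists x, u = qclass x.
Proof. by exists (repr (u : Quotient.quot ideal_pred)); rewrite /qclass reprK. Qed.

Fact qclass_is_zmod_morphism : zmod_morphism qclass.
Proof. by move=> x y; rewrite /qclass raddfB. Qed.
HB.instance Definition _ :=
  GRing.isZmodMorphism.Build A quotring qclass qclass_is_zmod_morphism.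

Definition qone : quotring := qclass 1.
Definition qmul (u v : quotring) : quotring :=
  qclass (repr (u : Quotient.quot ideal_pred) * repr (v : Quotient.quot ideal_pred)).

Lemma qmulE x y : qmul (qclass x) (qclass y) = qclass (x * y).
Proof.
apply/qclassE.
set a := repr _; set b := repr _.
have ha : I (a - x) by apply/qclassE; rewrite /qclass reprK.
have hb : I (b - y) by apply/qclassE; rewrite /qclass reprK.
have -> : a * b - x * y = b * (a - x) + x * (b - y).
  by rewrite !mulrBr addrA [b * x]mulrC subrK [b * a]mulrC.
by apply: idealD; apply: idealMl.
Qed.

Fact qmulA : associative qmul.
Proof.
move=> u v w; have [x ->] := qclass_repr u; have [y ->] := qclass_repr v.
by have [z ->] := qclass_repr w; rewrite !qmulE mulrA.
Qed.
Fact qmulC : commutative qmul.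
Proof. by move=> u v; rewrite /qmul mulrC. Qed.
Fact qmul1 : left_id qone qmul.
Proof. by move=> u; have [x ->] := qclass_repr u; rewrite qmulE mul1r. Qed.
Fact qmulD : left_distributive qmul +%R.
Proof.
move=> u v w; have [x ->] := qclass_repr u; have [y ->] := qclass_repr v.
by have [z ->] := qclass_repr w; rewrite -raddfD !qmulE mulrDl raddfD.
Qed.
HB.instance Definition _ :=
  GRing.Zmodule_isComPzRing.Build quotring qmulA qmulC qmul1 qmulD.

Fact qclass_is_monoid_morphism : monoid_morphism qclass.
Proof. by split=> // x y; rewrite -qmulE. Qed.
HB.instance Definition _ :=
  GRing.isMonoidMorphism.Build A quotring qclass qclass_is_monoid_morphism.

End Ideals.

Section GradedQuotient.
Variables (A : gring) (J : ideal A).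

Definition quot_homog (d : int) (u : quotring J) : Prop :=
  exists2 x : A, of_degree (gr A) d x & u = qclass J x.

Fact quot_homog0 d : quot_homog d 0.
Proof. by exists 0; [apply: homog0 | rewrite rmorph0]. Qed.
Fact quot_homogB d x y : quot_homog d x -> quot_homog d y -> quot_homog d (x - y).
Proof.
move=> [a ha ->] [b hb ->].
by exists (a - b); [apply: homogB | rewrite rmorphB].
Qed.
Fact quot_homog1 : quot_homog 0 1.
Proof. by exists 1; [apply: homog1 | rewrite rmorph1]. Qed.
Fact quot_homogM d e x y :
  quot_homog d x -> quot_homog e y -> quot_homog (d + e) (x * y).
Proof.
move=> [a ha ->] [b hb ->].
by exists (a * b); [apply: homogM | rewrite rmorphM].
Qed.

Definition quot_grading : grading (quotring J) :=
  Grading quot_homog0 quot_homogB quot_homog1 quot_homogM.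

Fact quot_span u : homog_sum quot_grading u.
Proof.
have [x ->] := qclass_repr u; have [s hs ->] := gspan x.
rewrite rmorph_sum; apply: homog_sum_sum => y /hs[d hy].
by apply: (@homog_sum_homog _ _ d); exists y.
Qed.

Definition gquot : gring := Gring quot_span.

End GradedQuotient.

Section Completion.
Variables (A : gring) (I : ideal A).

(* The inverse limit of the rings A / I^k along the projections
   A / I^(k+1) -> A / I^k. *)
Record adic := Adic {
  adic_seq :> forall k, quotring (ideal_exp I k);
  adicP : forall k, exists a : A,
    adic_seq k = qclass _ a /\ adic_seq k.+1 = qclass _ a
}.

HB.instance Definition _ := gen_eqMixin adic.
HB.instance Definition _ := gen_choiceMixin adic.

Lemma adic_ext (x y : adic) : (forall k, x k = y k) -> x = y.
Proof.
case: x y => [x hx] [y hy] /= e.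
have {}e : x = y by apply: functional_extensionality_dep.
by subst y; congr Adic; apply: Prop_irrelevance.
Qed.

Program Definition adic0 : adic := @Adic (fun k => 0) _.
Next Obligation. by exists 0; rewrite !rmorph0. Qed.
Program Definition adic1 : adic := @Adic (fun k => 1) _.
Next Obligation. by exists 1; rewrite !rmorph1. Qed.
Program Definition adicN (x : adic) : adic := @Adic (fun k => - x k) _.
Next Obligation.
by have [a [-> ->]] := adicP x k; exists (- a); rewrite !rmorphN.
Qed.
Program Definition adicD (x y : adic) : adic := @Adic (fun k => x k + y k) _.
Next Obligation.
have [a [-> ->]] := adicP x k; have [b [-> ->]] := adicP y k.
by exists (a + b); rewrite !rmorphD.
Qed.
Program Definition adicM (x y : adic) : adic := @Adic (fun k => x k * y k) _.
Next Obligation.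
have [a [-> ->]] := adicP x k; have [b [-> ->]] := adicP y k.
by exists (a * b); rewrite !rmorphM.
Qed.

Fact adicDA : associative adicD.
Proof. by move=> x y z; apply: adic_ext => k /=; rewrite addrA. Qed.
Fact adicDC : commutative adicD.
Proof. by move=> x y; apply: adic_ext => k /=; rewrite addrC. Qed.
Fact adicD0 : left_id adic0 adicD.
Proof. by move=> x; apply: adic_ext => k /=; rewrite add0r. Qed.
Fact adicDN : left_inverse adic0 adicN adicD.
Proof. by move=> x; apply: adic_ext => k /=; rewrite addNr. Qed.
HB.instance Definition _ :=
  GRing.isZmodule.Build adic adicDA adicDC adicD0 adicDN.
Fact adicMA : associative adicM.
Proof. by move=> x y z; apply: adic_ext => k /=; rewrite mulrA. Qed.
Fact adicMC : commutative adicM.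
Proof. by move=> x y; apply: adic_ext => k /=; rewrite mulrC. Qed.
Fact adicM1 : left_id adic1 adicM.
Proof. by move=> x; apply: adic_ext => k /=; rewrite mul1r. Qed.
Fact adicMD : left_distributive adicM +%R.
Proof. by move=> x y z; apply: adic_ext => k /=; rewrite mulrDl. Qed.
HB.instance Definition _ :=
  GRing.Zmodule_isComPzRing.Build adic adicMA adicMC adicM1 adicMD.

Definition adic_homog (d : int) (x : adic) : Prop :=
  forall k, quot_homog d (x k).

Fact adic_homog0 d : adic_homog d 0.
Proof. by move=> k; apply: quot_homog0. Qed.
Fact adic_homogB d x y : adic_homog d x -> adic_homog d y -> adic_homog d (x - y).
Proof. by move=> hx hy k; apply: quot_homogB (hx k) (hy k). Qed.
Fact adic_homog1 : adic_homog 0 1.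
Proof. by move=> k; apply: quot_homog1. Qed.
Fact adic_homogM d e x y :
  adic_homog d x -> adic_homog e y -> adic_homog (d + e) (x * y).
Proof. by move=> hx hy k; apply: quot_homogM (hx k) (hy k). Qed.

Definition adic_grading : grading adic :=
  Grading adic_homog0 adic_homogB adic_homog1 adic_homogM.

(* The graded completion: in degree d it is the inverse limit of the degree d
   parts of the A / I^k. *)
Definition gcompletion : gring := gpart adic_grading.

End Completion.

Section Laurent.
Variable R : comPzRingType.

Definition vanishes_below (N : int) (f : int -> R) : Prop :=
  forall k, k < N -> f k = 0.

Record laurent := Laurent {
  lcoef :> int -> R;
  laurentP : exists N, vanishes_below N lcoef
}.

HB.instance Definition _ := gen_eqMixin laurent.
HB.instance Definition _ := gen_choiceMixin laurent.

Lemma laurent_ext (f g : laurent) : (forall k, f k = g k) -> f = g.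
Proof.
case: f g => [f hf] [g hg] /= e.
have {}e : f = g by apply: functional_extensionality_dep.
by subst g; congr Laurent; apply: Prop_irrelevance.
Qed.

Lemma vanishes_belowW N M f : M <= N -> vanishes_below N f -> vanishes_below M f.
Proof. by move=> MN hf k kM; apply: hf; apply: lt_le_trans MN. Qed.

Program Definition lzero : laurent := @Laurent (fun=> 0) _.
Next Obligation. by exists 0 => k. Qed.
Program Definition lopp (f : laurent) : laurent := @Laurent (fun k => - f k) _.
Next Obligation.
by have [N hN] := laurentP f; exists N => k kN; rewrite hN ?oppr0.
Qed.
Program Definition ladd (f g : laurent) : laurent :=
  @Laurent (fun k => f k + g k) _.
Next Obligation.
have [N hN] := laurentP f; have [M hM] := laurentP g.
exists (Num.min N M) => k; rewrite lt_min => /andP[kN kM].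
by rewrite hN // hM // addr0.
Qed.

(* The sum is finite, i.e. all but finitely many of its terms are 0. *)
Definition lmul_fun (f g : int -> R) (k : int) : R :=
  \sum_(i \in [set: int]) f i * g (k - i).

Lemma lmul_funE N M f g (j : nat) :
  vanishes_below N f -> vanishes_below M g ->
  lmul_fun f g (N + M + j%:Z) =
    \sum_(i < j.+1) f (N + i%:Z) * g (M + (j - i)%N%:Z).
Proof.
move=> hf hg; rewrite /lmul_fun.
rewrite (fsbigE [seq N + i%:Z | i <- iota 0 j.+1]) //.
- under eq_bigl do rewrite in_setT.
  rewrite big_map -[iota 0 _]/(index_iota 0 j.+1) big_mkord.
  apply: eq_bigr => i _; congr (_ * g _).
  by have := ltn_ord i; lia.
- by rewrite map_inj_uniq ?iota_uniq // => a b /addrI [].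
- move=> i _ iNr; have [iN|Ni] := ltP i N; first by rewrite hf ?mul0r.
  rewrite hg ?mulr0 // ltNge; apply: contra iNr => h.
  apply/mapP; exists `|i - N|%N; last by lia.
  by rewrite mem_iota; lia.
Qed.

Lemma lmul_fun_below N M f g :
  vanishes_below N f -> vanishes_below M g ->
  vanishes_below (N + M) (lmul_fun f g).
Proof.
move=> hf hg k kNM; rewrite /lmul_fun (fsbigE [::]) ?big_nil //.
move=> i _ _; have [iN|Ni] := ltP i N; first by rewrite hf ?mul0r.
by rewrite hg ?mulr0 //; lia.
Qed.

Program Definition lmul (f g : laurent) : laurent := @Laurent (lmul_fun f g) _.
Next Obligation.
have [N hN] := laurentP f; have [M hM] := laurentP g.
by exists (N + M); apply: lmul_fun_below.
Qed.

Program Definition lmonom (r : R) (n : int) : laurent :=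
  @Laurent (fun k => if k == n then r else 0) _.
Next Obligation. by exists n => k kn; rewrite lt_eqF. Qed.

Definition lone : laurent := lmonom 1 0.

Fact laddA : associative ladd.
Proof. by move=> x y z; apply: laurent_ext => k /=; rewrite addrA. Qed.
Fact laddC : commutative ladd.
Proof. by move=> x y; apply: laurent_ext => k /=; rewrite addrC. Qed.
Fact ladd0 : left_id lzero ladd.
Proof. by move=> x; apply: laurent_ext => k /=; rewrite add0r. Qed.
Fact laddN : left_inverse lzero lopp ladd.
Proof. by move=> x; apply: laurent_ext => k /=; rewrite addNr. Qed.
HB.instance Definition _ :=
  GRing.isZmodule.Build laurent laddA laddC ladd0 laddN.

Lemma int_split (N k : int) : k < N \/ exists j : nat, k = N + j%:Z.
Proof.
have [|Nk] := ltP k N; [by left | right; exists `|k - N|%N].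
by lia.
Qed.

Fact lmulC : commutative lmul.
Proof.
move=> f g; have [N hN] := laurentP f; have [M hM] := laurentP g.
apply: laurent_ext => k /=; case: (int_split (N + M) k) => [kNM|[j ->]].
  by rewrite (lmul_fun_below hN hM) // (lmul_fun_below hM hN) // addrC.
rewrite (lmul_funE _ hN hM) [N + M]addrC (lmul_funE _ hM hN).
rewrite (reindex_inj rev_ord_inj) /=; apply: eq_bigr => i _.
by rewrite subSS mulrC subKn // -ltnS.
Qed.

Fact lmul1 : left_id lone lmul.
Proof.
move=> g; have [M hM] := laurentP g.
have h1 : vanishes_below 0 lone by move=> k k0 /=; rewrite lt_eqF.
apply: laurent_ext => k /=; case: (int_split (0 + M) k) => [kM|[j ->]].
  by rewrite (lmul_fun_below h1 hM) // hM // -[M]add0r.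
rewrite (lmul_funE _ h1 hM) big_ord_recl /= !add0r subn0 mul1r big1 ?addr0 //.
by move=> i _; rewrite mul0r.
Qed.

Fact lmulD : left_distributive lmul ladd.
Proof.
move=> f g h; have [N0 hN0] := laurentP f; have [N1 hN1] := laurentP g.
pose N := Num.min N0 N1.
have hN : vanishes_below N f by apply: vanishes_belowW hN0; rewrite ge_min lexx.
have hN' : vanishes_below N g.
  by apply: vanishes_belowW hN1; rewrite ge_min lexx orbT.
have hN'' : vanishes_below N (ladd f g).
  by move=> k kN /=; rewrite hN // hN' // addr0.
have [M hM] := laurentP h.
apply: laurent_ext => k; rewrite /= -/(lcoef (ladd f g)).
case: (int_split (N + M) k) => [kNM|[j ->]].
  by rewrite !(@lmul_fun_below N M) ?addr0.
rewrite !(@lmul_funE N M) // -big_split.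
by apply: eq_bigr => i _; rewrite mulrDl.
Qed.

Fact lmulA : associative lmul.
Proof.
move=> f g h; have [N hN] := laurentP f; have [M hM] := laurentP g.
have [P hP] := laurentP h.
have hNM := lmul_fun_below hN hM; have hMP := lmul_fun_below hM hP.
apply: laurent_ext => k /=; case: (int_split (N + (M + P)) k) => [kNMP|[i ->]].
  rewrite (lmul_fun_below hN hMP) // (lmul_fun_below hNM hP) //.
  by rewrite -addrA.
rewrite (lmul_funE _ hN hMP) addrA (lmul_funE _ hNM hP).
rewrite [RHS](reindex_inj rev_ord_inj) /=.
pose coef3 (j k : nat) :=
  f (N + j%:Z) * (g (M + (i - j - k)%N%:Z) * h (P + k%:Z)).
transitivity (\sum_(j < i.+1) \sum_(k < i.+1 | (k <= i - j)%N) coef3 j k).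
  apply: eq_bigr => /= j _; rewrite (lmul_funE _ hM hP) big_distrr /=.
  rewrite (reindex_inj rev_ord_inj) /=.
  rewrite (big_ord_narrow_leq (leq_subr _ _)).
  apply: eq_bigr => l _; rewrite /coef3 /= subSS subKn // -ltnS //.
rewrite (exchange_big_dep predT) //=; apply: eq_bigr => l _.
transitivity (\sum_(j < i.+1 | (j <= i - l)%N) coef3 j l).
  apply: eq_bigl => j; rewrite -ltnS -(ltnS j) -!subSn ?leq_ord //.
  by rewrite -subn_gt0 -(subn_gt0 j) -!subnDA addnC.
rewrite (big_ord_narrow_leq (leq_subr _ _)) subSS (lmul_funE _ hN hM).
rewrite big_distrl /= subKn -1?ltnS //.
by apply: eq_bigr => j _; rewrite /coef3 -!subnDA addnC mulrA.
Qed.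

HB.instance Definition _ :=
  GRing.Zmodule_isComPzRing.Build laurent lmulA lmulC lmul1 lmulD.

End Laurent.

Arguments vanishes_below {R}.

Program Definition lmap (R S : comPzRingType) (phi : {rmorphism R -> S})
    (f : laurent R) : laurent S := @Laurent S (fun k => phi (f k)) _.
Next Obligation.
by have [N hN] := laurentP f; exists N => k kN; rewrite hN ?rmorph0.
Qed.

Section LMap.
Variables (R S : comPzRingType) (phi : {rmorphism R -> S}).

Fact lmap_is_zmod_morphism : zmod_morphism (lmap phi).
Proof. by move=> f g; apply: laurent_ext => k; rewrite /= rmorphB. Qed.
HB.instance Definition _ :=
  GRing.isZmodMorphism.Build _ _ (lmap phi) lmap_is_zmod_morphism.

Fact lmap_is_monoid_morphism : monoid_morphism (lmap phi).
Proof.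
split; first by apply: laurent_ext => k /=; case: eqP; rewrite ?rmorph1 ?rmorph0.
move=> f g; have [N hN] := laurentP f; have [M hM] := laurentP g.
have hN' : vanishes_below N (lmap phi f) by move=> k kN /=; rewrite hN ?rmorph0.
have hM' : vanishes_below M (lmap phi g) by move=> k kN /=; rewrite hM ?rmorph0.
apply: laurent_ext => k; rewrite /= -/(lcoef (lmap phi f)) -/(lcoef (lmap phi g)).
case: (int_split (N + M) k) => [kNM|[j ->]].
  by rewrite !(@lmul_fun_below _ N M) ?rmorph0.
rewrite !(@lmul_funE _ N M) // rmorph_sum.
by apply: eq_bigr => i _; rewrite rmorphM.
Qed.
HB.instance Definition _ :=
  GRing.isMonoidMorphism.Build _ _ (lmap phi) lmap_is_monoid_morphism.
End LMap.

Section GradedLaurent.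
Variable R : gring.

(* |x| = -2, so the coefficient of x^k in a series of degree d has degree
   d + 2k. *)
Definition laurent_homog (d : int) (f : laurent R) : Prop :=
  forall k : int, of_degree (gr R) (d + 2 * k) (f k).

Fact laurent_homog0 d : laurent_homog d 0.
Proof. by move=> k; apply: homog0. Qed.
Fact laurent_homogB d f g :
  laurent_homog d f -> laurent_homog d g -> laurent_homog d (f - g).
Proof. by move=> hf hg k; apply: homogB. Qed.
Fact laurent_homog_monom d e r n :
  of_degree (gr R) e r -> e = d + 2 * n -> laurent_homog d (lmonom r n).
Proof.
by move=> hr de k /=; case: eqP => [->|_]; [rewrite -de | apply: homog0].
Qed.
Fact laurent_homog1 : laurent_homog 0 1.
Proof.
by apply: (@laurent_homog_monom 0 0 1 0); [apply: homog1 | rewrite mulr0].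
Qed.
Fact laurent_homogM d e f g :
  laurent_homog d f -> laurent_homog e g -> laurent_homog (d + e) (f * g).
Proof.
move=> hf hg; have [N hN] := laurentP f; have [M hM] := laurentP g.
move=> k; have -> : (f * g : laurent R) k = lmul_fun f g k by [].
case: (int_split (N + M) k) => [kNM|[j ->]].
  by rewrite (lmul_fun_below hN hM) //; apply: homog0.
rewrite (lmul_funE _ hN hM).
elim/big_ind: _ => [|x y|i _]; [exact: homog0 | exact: homogD |].
have -> : d + e + 2 * (N + M + j%:Z) =
    (d + 2 * (N + i%:Z)) + (e + 2 * (M + (j - i)%N%:Z)).
  by have := ltn_ord i; lia.
exact: homogM.
Qed.

Definition laurent_grading : grading (laurent R) :=
  Grading laurent_homog0 laurent_homogB laurent_homog1 laurent_homogM.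

(* R((x)): finite sums of homogeneous Laurent series. *)
Definition glaurent : gring := gpart laurent_grading.

Fact glaurent_constP (r : R) :
  lmonom r 0 \in gpart_pred laurent_grading.
Proof.
apply/asboolP; have [s hs ->] := gspan r.
have -> : lmonom (\sum_(y <- s) y) 0 = \sum_(y <- s) lmonom y 0 :> laurent R.
  elim: s {hs} => [|a s IHs].
    by rewrite !big_nil; apply: laurent_ext => k /=; case: eqP.
  rewrite !big_cons -IHs; apply: laurent_ext => k /=.
  by case: eqP; rewrite ?addr0.
apply: homog_sum_sum => y /hs[d hy]; apply: (@homog_sum_homog _ _ d).
by apply: laurent_homog_monom hy _; rewrite mulr0 addr0.
Qed.

Definition glaurent_const (r : R) : glaurent := GpartSort (glaurent_constP r).

End GradedLaurent.

(******************************************************************************)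
(* E(m)_* = Z_(p)[v_1, ..., v_(m-1), v_m, v_m^-1].                            *)
(******************************************************************************)

(* Z_(p) as a subring of the rational numbers. *)
Definition Zloc_pred (p : nat) : {pred rat} := fun q => coprime p `|denq q|.
Arguments Zloc_pred : simpl never.

Fact Zloc_subring p : subring_closed (Zloc_pred p).
Proof.
have fracP (a b : int) : b != 0 -> coprime p `|b| ->
    (a%:~R / b%:~R : rat) \in Zloc_pred p.
  rewrite unfold_in /Zloc_pred; case: divqP => [_|k x _ _]; first by rewrite eqxx.
  by rewrite abszM coprimeMr => /andP[].
split.
- by rewrite unfold_in /Zloc_pred (denq_int 1) coprimen1.
- move=> x y hx hy; rewrite -[x]divq_num_den -[y]divq_num_den.
  rewrite -mulNr -rmorphN addf_div ?intr_eq0 ?denq_eq0 //.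
  rewrite -!rmorphM -rmorphD fracP ?mulf_neq0 ?denq_eq0 // abszM coprimeMr.
  exact/andP.
- move=> x y hx hy; rewrite -[x]divq_num_den -[y]divq_num_den.
  rewrite mulf_div -!rmorphM fracP ?mulf_neq0 ?denq_eq0 // abszM coprimeMr.
  exact/andP.
Qed.
HB.instance Definition _ p :=
  GRing.isSubringClosed.Build rat (Zloc_pred p) (Zloc_subring p).

Section JohnsonWilson.
Variables p m : nat.

(* v_0 = p and v_i = 0 for i > m. *)
Definition vpoly (i : nat) : {mpoly rat[m]} :=
  if i is j.+1 then oapp (fun k : 'I_m => 'X_k) 0 (insub j) else p%:R.

Definition vfrac (i : nat) : {fraction {mpoly rat[m]}} := tofrac (vpoly i).

Definition vdeg (i : nat) : nat := (2 * (p ^ i - 1))%N.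

Definition mnm_deg (e : 'X_{1..m}) : nat := (\sum_(i < m) vdeg i.+1 * e i)%N.

Definition mpoly_homog (d : int) (f : {mpoly rat[m]}) : Prop :=
  forall e, e \in msupp f -> (mnm_deg e)%:Z = d.

Definition JW_pred : {pred {fraction {mpoly rat[m]}}} :=
  fun z => `[< exists k, exists2 f : {mpoly rat[m]},
                 f \is a mpolyOver m (Zloc_pred p) & z * vfrac m ^+ k = tofrac f >].

Definition JW_frac_homog (d : int) (z : {fraction {mpoly rat[m]}}) : Prop :=
  exists k, exists f : {mpoly rat[m]},
    [/\ f \is a mpolyOver m (Zloc_pred p), mpoly_homog (d + (k * vdeg m)%N%:Z) f
      & z * vfrac m ^+ k = tofrac f].

Lemma mpoly_homog0 d : mpoly_homog d 0.
Proof. by move=> e; rewrite msupp0. Qed.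

Lemma mpoly_homogB d f g :
  mpoly_homog d f -> mpoly_homog d g -> mpoly_homog d (f - g).
Proof.
by move=> hf hg e /msuppB_le; rewrite mem_cat => /orP[/hf|/hg].
Qed.

Lemma mpoly_homog1 : mpoly_homog 0 1.
Proof.
move=> e; rewrite msupp1 inE => /eqP ->.
by rewrite /mnm_deg big1 // => i _; rewrite mnm0E muln0.
Qed.

Lemma mpoly_homogM d e f g :
  mpoly_homog d f -> mpoly_homog e g -> mpoly_homog (d + e) (f * g).
Proof.
move=> hf hg a /msuppM_le /allpairsP[[b c] /= [/hf <- /hg <- ->]].
rewrite -PoszD /mnm_deg -big_split /=; congr Posz; apply: eq_bigr => i _.
by rewrite mnmDE mulnDr.
Qed.

Lemma mpoly_homogX d f k : mpoly_homog d f -> mpoly_homog (d * k%:Z) (f ^+ k).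
Proof.
move=> hf; elim: k => [|k IHk]; first by rewrite mulr0 expr0; apply: mpoly_homog1.
have -> : d * k.+1%:Z = d + d * k%:Z by lia.
by rewrite exprS; apply: mpoly_homogM.
Qed.

Lemma mpoly_homog_v i : mpoly_homog (vdeg i)%:Z (vpoly i).
Proof.
case: i => [|j] /=.
  have -> : (vdeg 0)%:Z = 0 * p%:Z by rewrite /vdeg expn0 mul0r.
  move=> e; rewrite -mpolyC_nat msuppC; case: ifP => // _.
  rewrite inE => /eqP -> ; rewrite mul0r.
  by rewrite /mnm_deg big1 // => i _; rewrite mnm0E muln0.
case: insubP => [k _ <-|_] /=; last exact: mpoly_homog0.
move=> e; rewrite msuppX inE => /eqP ->; rewrite /mnm_deg (bigD1 k) //=.
rewrite mnm1E eqxx muln1 big1 ?addn0 // => i.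
by rewrite mnm1E eq_sym => /negbTE ->; rewrite muln0.
Qed.

Lemma mpolyOver_v i : vpoly i \is a mpolyOver m (Zloc_pred p).
Proof.
case: i => [|j] /=; first by rewrite rpred_nat.
by case: insubP => [k _ _|_] /=; rewrite ?rpred0 ?mpolyOverX.
Qed.

Fact JW_frac_homog0 d : JW_frac_homog d 0.
Proof.
exists 0, 0; split; [exact: rpred0 | exact: mpoly_homog0 |].
by rewrite mul0r tofrac0.
Qed.

Fact JW_frac_homogB d x y :
  JW_frac_homog d x -> JW_frac_homog d y -> JW_frac_homog d (x - y).
Proof.
move=> [k [f [fZ hf ef]]] [l [g [gZ hg eg]]].
exists (k + l)%N, (f * vpoly m ^+ l - g * vpoly m ^+ k); split.
- by rewrite rpredB // rpredM // rpredX // mpolyOver_v.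
- have -> : d + ((k + l) * vdeg m)%N%:Z =
      d + (k * vdeg m)%N%:Z + (vdeg m)%:Z * l%:Z by lia.
  apply: mpoly_homogB; first exact/mpoly_homogM/mpoly_homogX/mpoly_homog_v.
  have -> : d + (k * vdeg m)%N%:Z + (vdeg m)%:Z * l%:Z =
      d + (l * vdeg m)%N%:Z + (vdeg m)%:Z * k%:Z by lia.
  exact/mpoly_homogM/mpoly_homogX/mpoly_homog_v.
- by rewrite tofracB !tofracM !tofracXn -ef -eg /vfrac exprD; ring.
Qed.

Fact JW_frac_homog1 : JW_frac_homog 0 1.
Proof.
exists 0, 1; split; [exact: rpred1 | exact: mpoly_homog1 |].
by rewrite mul1r expr0 tofrac1.
Qed.

Fact JW_frac_homogM d e x y :
  JW_frac_homog d x -> JW_frac_homog e y -> JW_frac_homog (d + e) (x * y).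
Proof.
move=> [k [f [fZ hf ef]]] [l [g [gZ hg eg]]].
exists (k + l)%N, (f * g); split; first by rewrite rpredM.
- have -> : d + e + ((k + l) * vdeg m)%N%:Z =
      (d + (k * vdeg m)%N%:Z) + (e + (l * vdeg m)%N%:Z) by lia.
  exact: mpoly_homogM.
- by rewrite tofracM -ef -eg exprD; ring.
Qed.

Fact JW_subring : subring_closed JW_pred.
Proof.
split.
- apply/asboolP; exists 0, 1; first exact: rpred1.
  by rewrite mul1r expr0 tofrac1.
- move=> x y /asboolP[k [f fZ ef]] /asboolP[l [g gZ eg]]; apply/asboolP.
  exists (k + l)%N, (f * vpoly m ^+ l - g * vpoly m ^+ k).
    by rewrite rpredB // rpredM // rpredX // mpolyOver_v.
  by rewrite tofracB !tofracM !tofracXn -ef -eg /vfrac exprD; ring.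
- move=> x y /asboolP[k [f fZ ef]] /asboolP[l [g gZ eg]]; apply/asboolP.
  exists (k + l)%N, (f * g); first by rewrite rpredM.
  by rewrite tofracM -ef -eg exprD; ring.
Qed.

(* The fractions f / v_m^k with f in Z_(p)[v_1, ..., v_m]. *)
Record JW_sort := JWSort {
  JW_val : {fraction {mpoly rat[m]}};
  JW_valP : JW_val \in JW_pred
}.
HB.instance Definition _ := [isSub for JW_val].
HB.instance Definition _ := [Choice of JW_sort by <:].
HB.instance Definition _ :=
  GRing.SubChoice_isSubComPzRing.Build _ JW_pred JW_sort JW_subring.

Definition JW_homog (d : int) (z : JW_sort) : Prop := JW_frac_homog d (val z).

Fact JW_homog0 d : JW_homog d 0.
Proof. by rewrite /JW_homog rmorph0; apply: JW_frac_homog0. Qed.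
Fact JW_homogB d x y : JW_homog d x -> JW_homog d y -> JW_homog d (x - y).
Proof. by rewrite /JW_homog rmorphB; apply: JW_frac_homogB. Qed.
Fact JW_homog1 : JW_homog 0 1.
Proof. by rewrite /JW_homog rmorph1; apply: JW_frac_homog1. Qed.
Fact JW_homogM d e x y :
  JW_homog d x -> JW_homog e y -> JW_homog (d + e) (x * y).
Proof. by rewrite /JW_homog rmorphM; apply: JW_frac_homogM. Qed.

Definition JW_grading : grading JW_sort :=
  Grading JW_homog0 JW_homogB JW_homog1 JW_homogM.

Fact JW_span z : homog_sum JW_grading z.
Proof.
have [v0|v0] := eqVneq (vfrac m) 0.
  apply: (@homog_sum_homog _ _ 0); exists 1, 0.
  split; [exact: rpred0 | exact: mpoly_homog0 |].
  by rewrite expr1 v0 mulr0 tofrac0.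
have /asboolP[k [f fZ ef]] := JW_valP z.
pose t (e : 'X_{1..m}) := tofrac (f@_e *: 'X_[e]) / vfrac m ^+ k.
have tE e : t e * vfrac m ^+ k = tofrac (f@_e *: 'X_[e]).
  by apply: divfK; apply: expf_neq0.
have tZ e : f@_e *: 'X_[e] \is a mpolyOver m (Zloc_pred p).
  by apply: mpolyOverZ; [apply: (mpolyOverP _ fZ) | apply: mpolyOverX].
have tJ e : t e \in JW_pred.
  by apply/asboolP; exists k, (f@_e *: 'X_[e]); [apply: tZ | apply: tE].
have -> : z = \sum_(e <- msupp f) JWSort (tJ e).
  apply: val_inj; rewrite rmorph_sum /=.
  apply: (mulIf (expf_neq0 k v0)); rewrite ef big_distrl /=.
  by under eq_bigr do rewrite tE; rewrite -rmorph_sum -mpolyE.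
apply: homog_sum_sum => e _.
apply: (@homog_sum_homog _ _ ((mnm_deg e)%:Z - (k * vdeg m)%N%:Z)).
exists k, (f@_e *: 'X_[e]); split; [exact: tZ | move=> e' | exact: tE].
have [->|fe] := eqVneq f@_e 0; first by rewrite scale0r msupp0.
by rewrite msuppMCX // inE => /eqP ->; rewrite subrK.
Qed.

Definition JW : gring := Gring JW_span.

Fact vJW_subproof i : vfrac i \in JW_pred.
Proof.
apply/asboolP; exists 0, (vpoly i); first exact: mpolyOver_v.
by rewrite expr0 mulr1.
Qed.

Definition vJW (i : nat) : JW := JWSort (vJW_subproof i).

End JohnsonWilson.

(******************************************************************************)
(* The p-series of the formal group law of E(n), i.e. of the p-typical formal *)
(* group law whose logarithm sum_k l_k x^(p^k) satisfies Araki's relation     *)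
(*   p l_k = sum_(0 <= i <= k) l_i v_(k-i)^(p^i),   l_0 = 1, v_0 = p.         *)
(* Its logarithm only exists rationally, so one works over the fraction field *)
(* of Q[v_1, ..., v_n].                                                       *)
(******************************************************************************)

Section PSeries.
Variables p n : nat.
Local Notation K := {fraction {mpoly rat[n]}}.

(* The sequence l_0, ..., l_k. *)
Fixpoint araki_logs (k : nat) : seq K :=
  if k is k'.+1 then
    let s := araki_logs k' in
    rcons s ((\sum_(i < k) s`_i * vfrac p n (k - i) ^+ (p ^ i))
               / (p%:R - p%:R ^+ (p ^ k)))
  else [:: 1].

Definition araki_log (k : nat) : K := (araki_logs k)`_k.

Lemma size_araki_logs k : size (araki_logs k) = k.+1.
Proof. by elim: k => //= k IHk; rewrite size_rcons IHk. Qed.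

Lemma nth_araki_logs k i : (i <= k)%N -> (araki_logs k)`_i = araki_log i.
Proof.
elim: k => [|k IHk]; first by rewrite leqn0 => /eqP ->.
rewrite leq_eqVlt => /orP[/eqP -> //|ik].
by rewrite /= nth_rcons size_araki_logs ik IHk.
Qed.

Lemma araki_logE k : (1 < p)%N ->
  p%:R * araki_log k =
    \sum_(i < k.+1) araki_log i * vfrac p n (k - i) ^+ (p ^ i).
Proof.
move=> p1; have v0 : vfrac p n 0 = p%:R by rewrite /vfrac /= rmorph_nat.
case: k => [|k]; first by rewrite big_ord1 v0 expn0 expr1 mulrC.
rewrite big_ord_recr /= subnn v0.
have -> : araki_log k.+1 =
    (\sum_(i < k.+1) araki_log i * vfrac p n (k.+1 - i) ^+ (p ^ i))
      / (p%:R - p%:R ^+ (p ^ k.+1)).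
  rewrite /araki_log /= nth_rcons size_araki_logs ltnn eqxx; congr (_ / _).
  by apply: eq_bigr => i _; rewrite nth_araki_logs // -ltnS.
set S := \sum_(i < _) _; set q := p%:R ^+ _.
suff pq : p%:R - q != 0 :> K.
  have gen (F : fieldType) (a b c : F) : a - b != 0 ->
    a * (c / (a - b)) = c + c / (a - b) * b by move=> ab; field.
  exact: gen.
rewrite subr_eq0 /q -natrX.
have inj a b : (a%:R == b%:R :> K) = (a == b).
  rewrite -!(rmorph_nat (@tofrac {mpoly rat[n]})) tofrac_eq -!mpolyC_nat.
  by rewrite mpolyC_eq eqr_nat.
rewrite inj -[X in X == _]expn1 eqn_exp2l // neq_ltn.
by rewrite -[X in (X < _)%N](expn0 p) ltn_exp2l.
Qed.

(* Power series without constant term. *)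
Definition pointed (f : laurent K) : Prop := vanishes_below 1 f.

(* sum_k l_k f^(p^k), for f without constant term: then f^(p^k) does not
   contribute to the coefficient of x^j if k > j. *)
Program Definition fgl_log (f : laurent K) : laurent K := @Laurent K
  (fun j => if 0 < j then \sum_(k < `|j|.+1) araki_log k * (f ^+ (p ^ k)) j
            else 0) _.
Next Obligation. by exists 0 => j j0; rewrite ltNge ltW. Qed.

(* The compositional inverse of the logarithm, evaluated at f. *)
Definition fgl_exp (f : laurent K) : laurent K :=
  xget 0 [set e | pointed e /\ fgl_log e = f].

Section LogExp.
Hypothesis p_gt1 : (1 < p)%N.
Implicit Types f g e : laurent K.

Let logtail f : laurent K := fgl_log f - f.

Lemma vanishes_belowB N f g :
  vanishes_below N f -> vanishes_below N g -> vanishes_below N (f - g).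
Proof. by move=> hf hg k kN; rewrite /= hf // hg // oppr0 addr0. Qed.

Lemma vanishes_below_sym N f g :
  vanishes_below N (f - g) -> vanishes_below N (g - f).
Proof.
move=> h k /h /eqP; rewrite [X in X == _]/= subr_eq0 => /eqP e.
by rewrite /= e subrr.
Qed.

Lemma pointedX f m : (0 < m)%N -> pointed f -> vanishes_below m%:Z (f ^+ m).
Proof.
move=> m0 hf; case: m m0 => // m _; elim: m => [|m IHm]; first by rewrite expr1.
rewrite exprS; have -> : m.+2%:Z = 1 + m.+1%:Z by lia.
exact: lmul_fun_below.
Qed.

Lemma pointed_exprB N f g m : (1 < m)%N -> pointed f -> pointed g ->
  vanishes_below N (f - g) -> vanishes_below (N + 1) (f ^+ m - g ^+ m).
Proof.
move=> m1 hf hg hfg; rewrite subrXX; apply: lmul_fun_below => //.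
elim/big_ind: _ => [|a b ha hb k k1|i _].
- by [].
- by rewrite /= ha // hb // addr0.
have [->|i0] := posnP i.
  rewrite expr0 mulr1 subn0; apply: vanishes_belowW (pointedX _ hf); lia.
have [im|mi] := ltnP i m.-1; last first.
  have -> : (m.-1 - i = 0)%N by lia.
  by rewrite expr0 mul1r; apply: vanishes_belowW (pointedX _ hg); lia.
apply: (@vanishes_belowW _ ((m.-1 - i)%N%:Z + i%:Z)); first lia.
by apply: lmul_fun_below; apply: pointedX => //; lia.
Qed.

Lemma logtailE f (j : int) : 0 < j ->
  logtail f j = \sum_(k < `|j|) araki_log k.+1 * (f ^+ (p ^ k.+1)) j.
Proof.
move=> j0; rewrite /= j0 big_ord_recl /= expn0 expr1 /araki_log /= mul1r.
by rewrite addrAC subrr add0r.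
Qed.

Lemma logtail_pointed f : pointed f -> pointed (logtail f).
Proof.
move=> hf j j1; rewrite /= hf // oppr0 addr0.
by have -> : (0 < j) = false by lia.
Qed.

Lemma logtailB N f g : pointed f -> pointed g ->
  vanishes_below N (f - g) -> vanishes_below (N + 1) (logtail f - logtail g).
Proof.
move=> hf hg hfg j jN; have [j0|j0] := ltP 0 j; last first.
  by apply: vanishes_belowB (j) _; [exact: logtail_pointed.. | lia].
change (logtail f j - logtail g j = 0).
rewrite !logtailE // -sumrB big1 // => k _; rewrite -mulrBr.
have pk : (1 < p ^ k.+1)%N by rewrite -[X in (X < _)%N](expn0 p) ltn_exp2l.
have h := pointed_exprB pk hf hg hfg jN.
by rewrite -[X in _ * X]/((f ^+ (p ^ k.+1) - g ^+ (p ^ k.+1)) j) h mulr0.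
Qed.

Lemma fgl_log_inj f g : pointed f -> pointed g -> fgl_log f = fgl_log g -> f = g.
Proof.
move=> hf hg efg.
have e : f - g = logtail g - logtail f by rewrite /logtail efg; ring.
have h N : vanishes_below N%:Z (f - g).
  elim: N => [|N IHN].
    by apply: (@vanishes_belowW _ 1) => //; apply: vanishes_belowB.
  have -> : N.+1%:Z = N%:Z + 1 by lia.
  by rewrite e; apply: logtailB => //; apply: vanishes_below_sym.
apply/eqP; rewrite -subr_eq0; apply/eqP/laurent_ext => j.
by apply: (h `|j|.+1); lia.
Qed.

Lemma fgl_log_surj f : pointed f -> exists2 e, pointed e & fgl_log e = f.
Proof.
move=> hf; pose E N := iter N (fun e => f - logtail e) 0.
have hE N : pointed (E N).
  elim: N => [|N IHN] //=.
  by apply: vanishes_belowB => //; apply: logtail_pointed.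
have dE N : vanishes_below N.+1%:Z (E N.+1 - E N).
  elim: N => [|N IHN]; first exact: vanishes_belowB (hE 1%N) (hE 0%N).
  have -> : E N.+2 - E N.+1 = logtail (E N) - logtail (E N.+1).
    by rewrite /=; ring.
  have -> : N.+2%:Z = N.+1%:Z + 1 by lia.
  by apply: logtailB => //; apply: vanishes_below_sym.
have cE N M (j : int) : (M <= N)%N -> j <= M%:Z -> E N j = E M j.
  move=> MN jM; rewrite -(subnK MN); elim: (N - M)%N => [|d IHd] //.
  rewrite addSn -{}IHd; apply/eqP; rewrite -subr_eq0; apply/eqP.
  by apply: (dE (d + M)%N); lia.
have he : exists N, vanishes_below N (fun j => E `|j|%N j).
  by exists 1 => j j1; apply: hE.
pose e := Laurent he; have pe : pointed e by move=> j j1; apply: hE.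
exists e => //; apply: laurent_ext => j.
have [j0|j0] := ltP 0 j; last by rewrite hf ?[LHS]/= ?ifF //; lia.
have -> : fgl_log e j = e j + logtail e j by rewrite /logtail /=; ring.
have -> : e j = f j - logtail (E `|j|%N) j.
  by symmetry; apply: (cE `|j|.+1 `|j|%N); lia.
suff -> : logtail e j = logtail (E `|j|%N) j by rewrite subrK.
apply/eqP; rewrite -subr_eq0; apply/eqP.
apply: (@logtailB `|j|%:Z e (E `|j|%N) pe (hE _) _ j); last by lia.
move=> i ij; apply/eqP; rewrite subr_eq0; apply/eqP.
have [i1|i1] := ltP i 1; first by rewrite pe // hE.
by symmetry; apply: (cE `|j|%N `|i|%N); lia.
Qed.

Lemma fgl_expP f : pointed f -> pointed (fgl_exp f) /\ fgl_log (fgl_exp f) = f.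
Proof.
move=> /fgl_log_surj[e pe he]; rewrite /fgl_exp; case: xgetP => //.
by move=> /(_ e) []; split.
Qed.

End LogExp.

Definition fgl_add (f g : laurent K) : laurent K :=
  fgl_exp (fgl_log f + fgl_log g).

(* [p](x) = x +_F ... +_F x, with p summands. *)
Definition pseries : laurent K := iter p (fgl_add (lmonom 1 1)) 0.

End PSeries.

Section Tate.
Variables p n : nat.

Definition JW_laurent : gring := glaurent (JW p n).

(* The inclusion of E(n)_*((x)) into the Laurent series over the fraction
   field of Q[v_1, ..., v_n]. *)
Definition JW_laurent_val (f : JW_laurent) : laurent {fraction {mpoly rat[n]}} :=
  lmap (val : JW_sort p n -> _) (val f).

(* The ideal generated by [p](x), whose coefficients lie in E(n)_*. *)
Definition in_pseries_ideal (f : JW_laurent) : Prop :=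
  exists g : JW_laurent, JW_laurent_val f = JW_laurent_val g * pseries p n.

Fact pseries_ideal0 : in_pseries_ideal 0.
Proof. by exists 0; rewrite /JW_laurent_val !rmorph0 mul0r. Qed.
Fact pseries_idealD f g :
  in_pseries_ideal f -> in_pseries_ideal g -> in_pseries_ideal (f + g).
Proof.
move=> [a ha] [b hb]; exists (a + b).
by rewrite /JW_laurent_val !rmorphD mulrDl; congr (_ + _).
Qed.
Fact pseries_idealM a f : in_pseries_ideal f -> in_pseries_ideal (a * f).
Proof.
move=> [b hb]; exists (a * b).
by rewrite /JW_laurent_val !rmorphM -mulrA; congr (_ * _).
Qed.

Definition pseries_ideal : ideal JW_laurent :=
  Ideal pseries_ideal0 pseries_idealD pseries_idealM.

(* pi_* tE(n), taken through its computation as E(n)_*((x)) / ([p](x)). *)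
Definition pi_tE : gring := gquot pseries_ideal.

Definition v_laurent (i : nat) : JW_laurent := glaurent_const (vJW p n i).
Definition v_tE (i : nat) : pi_tE := qclass pseries_ideal (v_laurent i).

End Tate.

(* The ideal (v_0, ..., v_(k-1)); with v_0 = p, I_(n-1) is the case k = n - 1. *)
Definition v_ideal (A : comPzRingType) (v : nat -> A) (k : nat) : ideal A :=
  ideal_gen (fun y => exists2 i, (i < k)%N & y = v i).

Definition gring_iso (A B : gring) : Prop :=
  exists phi : {rmorphism A -> B},
    bijective phi /\
    forall d (a : A), of_degree (gr A) d a <-> of_degree (gr B) d (phi a).

(* Main.v *)
(* Put w_i = v_i x^(p^i - 1), of degree 0.  Modulo I_(n-1), the series [p](x) is
   v_(n-1) x^(p^(n-1)) plus terms of higher order in x, so dividing by it eliminates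
   v_(n-1): modulo I_(n-1)^k, both E(n)_*((x)) / [p](x) and E(n-1)_*((x)) consist of
   the Laurent series in one variable w over
   Z_(p)[w_1, ..., w_(n-2)] / (p, w_1, ..., w_(n-2))^k, with x^+-1 adjoined, where
   w = w_n in the first case and w = w_(n-1) in the second.  The isomorphism sends
   w_n to w_(n-1) and fixes x and w_1, ..., w_(n-2); as it is not defined before
   completion, it is given as a relation between the two rings.
   That [p](x) has integral coefficients is Hazewinkel's functional equation lemma;
   its coefficients up to x^(p^(n-1)) modulo I_(n-1) follow from Araki's relation,
   since l_k lies in (v_1, ..., v_(n-2)) for 0 < k < n - 1. *)
From HB Require Import structures.
From mathcomp Require Import all_boot all_order all_algebra.
From mathcomp Require Import mpoly boolp classical_sets fsbigop.
From mathcomp Require Import zify ring.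
Require Import Defs.

Set Implicit Arguments.
Unset Strict Implicit.
Unset Printing Implicit Defensive.

Import Order.TTheory GRing.Theory Num.Theory.
Local Open Scope ring_scope.

(** * Relations inducing isomorphisms of completions *)

(** A relation suffices because it has two properties: related elements lie in the same powers of
    the two ideals, and the relation is dense on both sides. Density over E(n) is the existence of
    Weierstrass division by [p](x). It is needed only modulo the first power of the ideal, since the
    error is a combination of the v_i with homogeneous coefficients, which can be divided again.
    Detecting powers in the quotient is the uniqueness of that division: an element of I^k is only
    known up to a multiple g [p](x), and g must be shown to lie in I^k. Both need a test for powers
    of I that looks at one coefficient at a time. It comes from embedding E(m)_* in Laurent series
    in v_m over a polynomial ring, where the ideal is monomial; one polynomial ring serves E(n) and
    E(n-1), so that their coefficients can be compared. Returning from coefficients to a combination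
    of generators requires homogeneity, hence the degrees carried throughout. After division, a
    remainder of degree d has integer multiples of powers of v_n as coefficients, so it is x^(-d/2)
    times a Laurent series in w_n over the integers. *)

Section IdealLemmas.
Variables (A : comPzRingType) (I : ideal A).

Lemma idealN x : I x -> I (- x).
Proof. by rewrite -mulN1r; apply: idealMl. Qed.

Lemma idealB x y : I x -> I y -> I (x - y).
Proof. by move=> hx hy; apply/idealD/idealN. Qed.

Lemma ideal_sum (T : Type) (r : seq T) (P : pred T) (F : T -> A) :
  (forall i, P i -> I (F i)) -> I (\sum_(i <- r | P i) F i).
Proof.
move=> hF; elim/big_ind: _ => //; [exact: ideal0 | exact: idealD].
Qed.

Lemma ideal_gen_min (S : A -> Prop) :
  (forall x, S x -> I x) -> forall x, ideal_gen S x -> I x.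
Proof.
move=> SI x [s hs ->]; rewrite big_seq; apply: ideal_sum => u us.
exact/idealMl/SI/hs.
Qed.

End IdealLemmas.

Section IdealPowers.
Variables (A : comPzRingType) (I : ideal A).

Lemma mem_ideal_gen (S : A -> Prop) x : S x -> ideal_gen S x.
Proof.
move=> Sx; exists [:: (1, x)]; last by rewrite big_seq1 mul1r.
by move=> u; rewrite inE => /eqP ->.
Qed.

Lemma ideal_exp0 x : ideal_exp I 0 x.
Proof. exact: mem_ideal_gen. Qed.

Lemma ideal_expM k x y : I x -> ideal_exp I k y -> ideal_exp I k.+1 (x * y).
Proof. by move=> hx hy; apply: mem_ideal_gen; exists x, y. Qed.

Lemma ideal_expSW k x : ideal_exp I k.+1 x -> ideal_exp I k x.
Proof.
move=> h; apply: (ideal_gen_min (I := ideal_exp I k)) h => _ [a [b [_ hb ->]]].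
exact: idealMl.
Qed.

End IdealPowers.

(** Choice extracts a map in each direction; uniqueness turns every closure property of [R] into an
    identity for the chosen map. *)
Lemma gring_iso_of_rel (A B : gring) (R : A -> B -> Prop) :
  (forall x, exists y, R x y) -> (forall y, exists x, R x y) ->
  (forall x y y', R x y -> R x y' -> y = y') ->
  (forall x x' y, R x y -> R x' y -> x = x') ->
  R 1 1 ->
  (forall x y x' y', R x y -> R x' y' -> R (x - x') (y - y')) ->
  (forall x y x' y', R x y -> R x' y' -> R (x * x') (y * y')) ->
  (forall d x y, R x y -> of_degree (gr A) d x <-> of_degree (gr B) d y) ->
  gring_iso A B.
Proof.
move=> /choice[f hf] /choice[g hg] uB uA R1 RB RM Rd.
have fB : zmod_morphism f by move=> x y; apply: (uB (x - y)) => //; apply: RB.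
have fM : monoid_morphism f.
  by split=> [|x y]; [apply: (uB 1) | apply: (uB (x * y)) => //; apply: RM].
pose phi : {rmorphism A -> B} := HB.pack f
  (GRing.isZmodMorphism.Build A B f fB) (GRing.isMonoidMorphism.Build A B f fM).
exists phi; split; last by move=> d a; apply: Rd; apply: hf.
exists g => [x|y]; first by apply: (uA _ _ (f x)).
by apply: (uB (g y)).
Qed.

Section AdicRel.
Variables (A B : gring) (I : ideal A) (J : ideal B) (rho : A -> B -> Prop).

(** The representatives may change with [k] and need not be compatible with each other; [rho_exp]
    makes up for this. *)
Definition adic_rel (x : adic I) (y : adic J) : Prop :=
  forall k, exists a b, [/\ rho a b, x k = qclass _ a & y k = qclass _ b].

Hypothesis rhoB :
  forall a b a' b', rho a b -> rho a' b' -> rho (a - a') (b - b').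
Hypothesis rho_exp :
  forall k a b, rho a b -> ideal_exp I k a -> ideal_exp J k b.
Hypothesis rho_homog : forall k d a, of_degree (gr A) d a ->
  exists a' b', [/\ rho a' b', of_degree (gr B) d b' & ideal_exp I k (a - a')].
Hypothesis rho1 : rho 1 1.

Lemma rho0 : rho 0 0.
Proof. by have := rhoB rho1 rho1; rewrite !subrr. Qed.

Lemma rho_approx k a : exists a' b', rho a' b' /\ ideal_exp I k (a - a').
Proof.
have [s hs ->] := gspan a.
elim: s hs => [|c s IHs] hs.
  exists 0, 0; rewrite big_nil subr0; split; last exact: ideal0.
  by rewrite -(subrr 1) -[X in rho _ X](subrr 1); apply: rhoB.
have [d hc] := hs c (mem_head _ _).
have [c' [d' [hcd _ hI]]] := rho_homog k hc.
have [y ys|s' [t' [hst hI']]] := IHs; first by apply: hs; rewrite inE ys orbT.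
have rhoN x y : rho x y -> rho (- x) (- y).
  by move=> h; rewrite -[- x]sub0r -[- y]sub0r; apply/rhoB/h/rho0.
exists (c' + s'), (d' + t'); rewrite big_cons; split.
  by rewrite -[s']opprK -[t']opprK; apply/rhoB/rhoN.
by rewrite opprD addrACA; apply: idealD.
Qed.

Lemma adic_rel_fun x y y' : adic_rel x y -> adic_rel x y' -> y = y'.
Proof.
move=> h h'; apply: adic_ext => k.
have [a [b [hab xa ->]]] := h k; have [a' [b' [hab' xa' ->]]] := h' k.
apply/qclassE; apply: (rho_exp (rhoB hab hab')).
by apply/qclassE; rewrite -xa -xa'.
Qed.

Lemma adic_rel_total x : exists y, adic_rel x y.
Proof.
have /choice[ab hab] k : exists u : A * B, rho u.1 u.2 /\ x k = qclass _ u.1.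
  have [a xa] := qclass_repr (x k); have [a' [b' [h hI]]] := rho_approx k a.
  by exists (a', b'); split => //; rewrite xa; apply/qclassE.
pose ys k : quotring (ideal_exp J k) := qclass _ (ab k).2.
have ysP k : exists b : B, ys k = qclass _ b /\ ys k.+1 = qclass _ b.
  (* The representative of level k+1 also serves level k: the two first components differ by an
     element of I^k, and [rho_exp] carries this over to J^k. *)
  exists (ab k.+1).2; split=> //; apply/qclassE.
  have [h e] := hab k; have [h' e'] := hab k.+1.
  apply: (rho_exp (rhoB h h')); apply/qclassE; rewrite -e.
  have [a [-> ea]] := adicP x k; apply/qclassE/ideal_expSW/qclassE.
  by rewrite -ea.
exists (Adic ysP) => k; exists (ab k).1, (ab k).2.
by have [h e] := hab k.
Qed.

Lemma adic_rel_homog d x y : adic_rel x y ->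
  of_degree (adic_grading I) d x -> of_degree (adic_grading J) d y.
Proof.
move=> h hx k; have [a [b [hab xa ->]]] := h k.
have [c hc xc] := hx k; have [a' [b' [hab' hb' hI]]] := rho_homog k hc.
exists b' => //; apply/qclassE; apply: (rho_exp (rhoB hab hab')).
have -> : a - a' = (a - c) + (c - a') by ring.
by apply: idealD => //; apply/qclassE; rewrite -xa -xc.
Qed.

Lemma adic_relB x y x' y' :
  adic_rel x y -> adic_rel x' y' -> adic_rel (x - x') (y - y').
Proof.
move=> h h' k; have [a [b [hab xa yb]]] := h k.
have [a' [b' [hab' xa' yb']]] := h' k.
exists (a - a'), (b - b'); split; first exact: rhoB.
  by rewrite /= xa xa' rmorphB.
by rewrite /= yb yb' rmorphB.
Qed.

Lemma adic_rel1 : adic_rel 1 1.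
Proof. by move=> k; exists 1, 1; split. Qed.

Lemma adic_relM x y x' y' :
  (forall a b a' b', rho a b -> rho a' b' -> rho (a * a') (b * b')) ->
  adic_rel x y -> adic_rel x' y' -> adic_rel (x * x') (y * y').
Proof.
move=> rhoM h h' k; have [a [b [hab xa yb]]] := h k.
have [a' [b' [hab' xa' yb']]] := h' k.
exists (a * a'), (b * b'); split; first exact: rhoM.
  by rewrite /= xa xa' rmorphM.
by rewrite /= yb yb' rmorphM.
Qed.

(** A partner in the full inverse limit is not enough, as it must be a finite sum of homogeneous
    elements. Partners of the homogeneous summands of x are subtracted one by one; what is left is a
    partner of 0, which is 0 by uniqueness. *)
Lemma adic_rel_gpart (x : gcompletion I) :
  exists y : gcompletion J, adic_rel (val x) (val y).
Proof.
have [y hy] := adic_rel_total (val x).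
suff yP : y \in gpart_pred (adic_grading J) by exists (GpartSort yP).
apply/asboolP; have /asboolP[s hs ex] := gpart_valP x.
have {hy} : adic_rel (\sum_(z <- s) z) y by rewrite -ex.
elim: s hs y {x ex} => [|c s IHs] hs y.
  rewrite big_nil => h; suff -> : y = 0 by apply: homog_sum0.
  apply: (adic_rel_fun h).
  by have := adic_relB adic_rel1 adic_rel1; rewrite !subrr.
rewrite big_cons => h; have [y' hy'] := adic_rel_total c.
have h' := adic_relB h hy'; rewrite addrAC subrr add0r in h'.
rewrite -[y](subrK y'); apply: homog_sumD.
  by apply: IHs h' => z zs; apply: hs; rewrite inE zs orbT.
have [d hc] := hs c (mem_head _ _).
exact: homog_sum_homog (adic_rel_homog hy' hc).
Qed.

End AdicRel.

Lemma adic_relC (A B : gring) (I : ideal A) (J : ideal B) (rho : A -> B -> Prop)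
    (x : adic I) (y : adic J) :
  adic_rel rho x y -> adic_rel (fun b a => rho a b) y x.
Proof. by move=> h k; have [a [b [? ? ?]]] := h k; exists b, a. Qed.

(* [rho] plays the role of a graded ring mapping to both [A] and [B] and dense
   in both of them. *)
Lemma gcompletion_iso (A B : gring) (I : ideal A) (J : ideal B)
    (rho : A -> B -> Prop) :
  rho 1 1 ->
  (forall a b a' b', rho a b -> rho a' b' -> rho (a - a') (b - b')) ->
  (forall a b a' b', rho a b -> rho a' b' -> rho (a * a') (b * b')) ->
  (forall k a b, rho a b -> ideal_exp I k a <-> ideal_exp J k b) ->
  (forall k d a, of_degree (gr A) d a -> exists a' b',
    [/\ rho a' b', of_degree (gr B) d b' & ideal_exp I k (a - a')]) ->
  (forall k d b, of_degree (gr B) d b -> exists a' b',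
    [/\ rho a' b', of_degree (gr A) d a' & ideal_exp J k (b - b')]) ->
  gring_iso (gcompletion I) (gcompletion J).
Proof.
move=> rho1 rhoB rhoM rho_exp hA hB.
have rho_exp1 k a b : rho a b -> ideal_exp I k a -> ideal_exp J k b.
  by move=> /(rho_exp k)[].
have rho_exp2 k b a : rho a b -> ideal_exp J k b -> ideal_exp I k a.
  by move=> /(rho_exp k)[].
pose ohr b a := rho a b.
have rhoB' b a b' a' : ohr b a -> ohr b' a' -> ohr (b - b') (a - a').
  by move=> *; apply: rhoB.
have hB' k d b : of_degree (gr B) d b -> exists b' a',
    [/\ ohr b' a', of_degree (gr A) d a' & ideal_exp J k (b - b')].
  by move=> /(hB k)[a [b' ?]]; exists b', a.
pose R (x : gcompletion I) (y : gcompletion J) :=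
  adic_rel rho (val x) (val y).
apply: (@gring_iso_of_rel _ _ R).
- by move=> x; apply: adic_rel_gpart.
- move=> y; have [x hx] := adic_rel_gpart rhoB' rho_exp2 hB' rho1 y.
  by exists x; apply: adic_relC hx.
- move=> x y y' h h'; apply: val_inj; exact: adic_rel_fun h h'.
- move=> x x' y h h'; apply: val_inj.
  exact: (adic_rel_fun rhoB' rho_exp2 (adic_relC h) (adic_relC h')).
- exact: adic_rel1.
- by move=> x y x' y' h h'; apply: adic_relB.
- by move=> x y x' y' h h'; apply: adic_relM.
- move=> d x y h; split; first exact: adic_rel_homog h.
  exact: (adic_rel_homog rhoB' rho_exp2 hB' (adic_relC h)).
Qed.

(** * Laurent series *)

(** Course-of-values recursion; it produces both Hazewinkel's coefficients h_j and the quotient in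
    the Weierstrass division. *)
Lemma strong_recursion (T : Type) (F : seq T -> T) :
  exists f : nat -> T, forall k, f k = F (mkseq f k).
Proof.
pose fix s k := if k is k'.+1 then rcons (s k') (F (s k')) else [::].
exists (fun k => F (s k)) => k; congr F.
by elim: k => //= k {1}->; rewrite mkseqS.
Qed.

Section LaurentLemmas.
Variable R : comPzRingType.
Implicit Types f g : laurent R.

Lemma lcoefD f g k : (f + g) k = f k + g k. Proof. by []. Qed.
Lemma lcoefB f g k : (f - g) k = f k - g k. Proof. by []. Qed.
Lemma lcoef0 k : (0 : laurent R) k = 0. Proof. by []. Qed.
Lemma lcoef_monom (c : R) i k : lmonom c i k = if k == i then c else 0.
Proof. by []. Qed.

Lemma lcoef_sum (I : Type) (r : seq I) (P : pred I) (F : I -> laurent R) k :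
  (\sum_(i <- r | P i) F i) k = \sum_(i <- r | P i) F i k.
Proof. by elim/big_rec2: _ => // i y x _ <-. Qed.

Lemma lmul_supp f g k : exists2 s : seq int, uniq s &
  forall i, i \notin s -> f i * g (k - i) = 0.
Proof.
have [N hN] := laurentP f; have [M hM] := laurentP g.
exists [seq N + (j : nat)%:Z | j <- iota 0 (`|(k - M - N)%R|.+1)%N].
  by rewrite map_inj_uniq ?iota_uniq // => a b /addrI [].
move=> i iNr; have [iN|Ni] := ltP i N; first by rewrite hN ?mul0r.
rewrite hM ?mulr0 // ltNge; apply: contra iNr => h.
by apply/mapP; exists `|(i - N)%R|%N; [rewrite mem_iota|]; lia.
Qed.

Lemma lcoefM_seq f g k (s : seq int) : uniq s ->
  (forall i, i \notin s -> f i * g (k - i) = 0) ->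
  (f * g) k = \sum_(i <- s) f i * g (k - i).
Proof.
move=> us hs; rewrite [LHS]/(lmul_fun f g k) /lmul_fun (fsbigE s) //.
  by apply: eq_bigl => i; rewrite in_setT.
by move=> i _; apply: hs.
Qed.

Lemma lcoefM_ind (P : R -> Prop) f g k : P 0 ->
  (forall x y, P x -> P y -> P (x + y)) ->
  (forall i, P (f i * g (k - i))) -> P ((f * g) k).
Proof.
move=> P0 PD Pi; have [s us hs] := lmul_supp f g k.
by rewrite (lcoefM_seq us hs); elim/big_ind: _.
Qed.

Lemma lcoef_monomM (c : R) i f k : (lmonom c i * f) k = c * f (k - i).
Proof.
rewrite (@lcoefM_seq _ _ _ [:: i]) // => [|j]; first by rewrite big_seq1 /= eqxx.
by rewrite inE lcoef_monom => /negbTE ->; rewrite mul0r.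
Qed.

Lemma lmonomM (c d : R) i j : lmonom c i * lmonom d j = lmonom (c * d) (i + j).
Proof.
apply: laurent_ext => k; rewrite lcoef_monomM !lcoef_monom.
rewrite subr_eq [j + i]addrC.
by case: eqP; rewrite ?mulr0.
Qed.

Lemma lmonom0 i : lmonom (0 : R) i = 0.
Proof. by apply: laurent_ext => k; rewrite lcoef_monom if_same. Qed.

Lemma lmonom1 : lmonom (1 : R) 0 = 1. Proof. by []. Qed.

Lemma lmonomX (c : R) i k : lmonom c i ^+ k = lmonom (c ^+ k) (i * k%:Z).
Proof.
elim: k => [|k IHk]; first by rewrite !expr0 mulr0.
by rewrite !exprS IHk lmonomM; congr lmonom; lia.
Qed.

Lemma lmonom_sum (I : Type) (r : seq I) (P : pred I) (F : I -> R) i :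
  lmonom (\sum_(j <- r | P j) F j) i = \sum_(j <- r | P j) lmonom (F j) i.
Proof.
apply: (big_morph (fun c => lmonom c i)); last exact: lmonom0.
by move=> c d; apply: laurent_ext => k /=; case: eqP; rewrite ?addr0.
Qed.

Lemma lmul_below N M f g : vanishes_below N f -> vanishes_below M g ->
  vanishes_below (N + M) (f * g).
Proof. exact: lmul_fun_below. Qed.

Lemma lmul_lead N M f g : vanishes_below N f -> vanishes_below M g ->
  (f * g) (N + M) = f N * g M.
Proof.
move=> hf hg; rewrite (@lcoefM_seq _ _ _ [:: N]) //.
  by rewrite big_seq1; congr (_ * g _); lia.
move=> i; rewrite inE => iN; have [/hf ->|Ni] := ltP i N; first by rewrite mul0r.
by rewrite hg ?mulr0 //; lia.
Qed.

Lemma vanishesD N f g :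
  vanishes_below N f -> vanishes_below N g -> vanishes_below N (f + g).
Proof. by move=> hf hg k kN; rewrite lcoefD hf // hg // addr0. Qed.

Lemma lexp_below f m : vanishes_below 1 f -> vanishes_below m%:Z (f ^+ m).
Proof.
move=> hf; elim: m => [|m IHm].
  by rewrite expr0 -lmonom1 => k; rewrite lcoef_monom => /lt_eqF ->.
by rewrite exprS; have := lmul_below hf IHm; rewrite -PoszD.
Qed.

Lemma lexp_lead f m : vanishes_below 1 f -> (f ^+ m) m%:Z = f 1 ^+ m.
Proof.
move=> hf; elim: m => [|m IHm]; first by rewrite !expr0.
by rewrite !exprS -IHm -(lmul_lead hf (lexp_below (m := m) hf)).
Qed.

Lemma ltrunc_subproof (f : int -> R) (N : int) :
  (exists M, vanishes_below M f) ->
  exists M, vanishes_below M (fun k => if k < N then f k else 0).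
Proof. by move=> [M hM]; exists M => k /hM ->; rewrite if_same. Qed.

Definition ltrunc f N : laurent R := Laurent (ltrunc_subproof N (laurentP f)).

Lemma ltrunc_below f N : vanishes_below N (f - ltrunc f N).
Proof. by move=> k kN; rewrite lcoefB /= kN subrr. Qed.

(** Brings series within reach of statements about finite sums, such as [cong_frobenius_sum]. The
    second alternative covers N < M. *)
Lemma ltrunc_sum f N M : vanishes_below M f ->
  ltrunc f N = \sum_(i < `|N - M|) lmonom (f (M + i%:Z)) (M + i%:Z)
            \/ ltrunc f N = 0.
Proof.
move=> hM; have [MN|NM] := leP M N; last first.
  right; apply: laurent_ext => k /=; case: ltP => // kN.
  by rewrite hM // (lt_trans kN).
left; apply: laurent_ext => k; rewrite lcoef_sum [LHS]/=.
case: ltP => [kN|Nk].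
  have [kM|Mk] := ltP k M.
    rewrite hM // big1 // => i _; rewrite lcoef_monom.
    by case: eqP => // e; exfalso; lia.
  have hk : (`|(k - M)%R| < `|(N - M)%R|)%N by lia.
  rewrite (bigD1 (Ordinal hk)) // lcoef_monom [nat_of_ord _]/=.
  have -> : M + `|(k - M)%R|%N%:Z = k by lia.
  rewrite eqxx big1 => [|i /eqP iN]; first exact: (esym (addr0 _)).
  rewrite lcoef_monom.
  case: eqP => // e; case: iN; apply: val_inj => /=.
  by rewrite e [M + _]addrC addrK.
rewrite big1 // => i _; rewrite lcoef_monom.
by case: eqP => // e; have := ltn_ord i; lia.
Qed.

End LaurentLemmas.

Lemma vanishes_lmap (R S : comPzRingType) (phi : {rmorphism R -> S}) N f :
  injective phi -> vanishes_below N (lmap phi f) <-> vanishes_below N f.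
Proof.
move=> inj; split=> h k kN; last by rewrite /= h ?rmorph0.
by apply: inj; rewrite rmorph0; apply: h.
Qed.

Lemma lmap_inj (R S : comPzRingType) (phi : {rmorphism R -> S}) :
  injective phi -> injective (lmap phi).
Proof.
move=> inj f g e; apply: laurent_ext => k; apply: inj.
by have := congr1 (fun h : laurent S => h k) e.
Qed.

(* The substitution x |-> c x^beta, with c k standing for the k-th power of a
   unit c. *)
Section LaurentSubst.
Variables (R S : comPzRingType) (phi : {rmorphism R -> S}).
Variables (c : int -> S) (beta : nat).
Hypotheses (beta_gt0 : (0 < beta)%N) (c0 : c 0 = 1).
Hypothesis cD : forall i j, c (i + j) = c i * c j.
Implicit Types f g : laurent R.

Definition lsubst_fun f (k : int) : S :=
  if (beta %| k)%Z then phi (f (k %/ beta)%Z) * c (k %/ beta)%Z else 0.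

Fact lsubst_subproof f : exists N, vanishes_below N (lsubst_fun f).
Proof.
have [N hN] := laurentP f; exists (N * beta%:Z) => k kN.
rewrite /lsubst_fun; case: ifP => // /dvdzP[q kq].
rewrite kq mulzK ?lt0n_neq0 // hN ?rmorph0 ?mul0r //.
by move: kN; rewrite kq ltr_pM2r.
Qed.

Definition lsubst f : laurent S := Laurent (lsubst_subproof f).

Lemma lsubstE f i : lsubst f (i * beta%:Z) = phi (f i) * c i.
Proof. by rewrite /= /lsubst_fun dvdz_mull // mulzK // lt0n_neq0. Qed.

Lemma lsubst_ndvd f k : ~~ (beta %| k)%Z -> lsubst f k = 0.
Proof. by rewrite /= /lsubst_fun => /negbTE ->. Qed.

Lemma lsubstP (P : int -> S -> Prop) f : (forall k, P k 0) ->
  (forall i, P (i * beta%:Z) (phi (f i) * c i)) -> forall k, P k (lsubst f k).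
Proof.
move=> P0 Pi k; have [/dvdzP[i ->]|nk] := boolP (beta %| k)%Z.
  by rewrite lsubstE.
by rewrite lsubst_ndvd.
Qed.

Lemma lsubst_is_zmod_morphism : zmod_morphism lsubst.
Proof.
move=> f g; apply: laurent_ext => k; rewrite /= /lsubst_fun.
by case: ifP; rewrite ?subr0 // rmorphB mulrBl.
Qed.

Lemma lsubst_is_monoid_morphism : monoid_morphism lsubst.
Proof.
have beta0 : beta%:Z != 0 by rewrite lt0n_neq0.
split=> [|f g].
  apply: laurent_ext => k; have [/dvdzP[i ->]|nk] := boolP (beta %| k)%Z.
    rewrite lsubstE -!lmonom1 !lcoef_monom mulf_eq0 (negbTE beta0) orbF.
    by case: eqP => [->|_]; rewrite ?rmorph1 ?rmorph0 ?mul0r // mul1r.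
  rewrite lsubst_ndvd // -lmonom1 lcoef_monom; case: eqP nk => // ->.
  by rewrite dvdz0.
apply: laurent_ext => k; have [/dvdzP[q ->]|nk] := boolP (beta %| k)%Z.
  have [s us hs] := lmul_supp f g q.
  rewrite lsubstE (lcoefM_seq us hs).
  rewrite (@lcoefM_seq _ _ _ _ [seq i * beta%:Z | i <- s]).
  - rewrite rmorph_sum mulr_suml big_map; apply: eq_bigr => i _.
    have -> : c q = c i * c (q - i) by rewrite -cD addrC subrK.
    by rewrite -mulrBl !lsubstE rmorphM; ring.
  - by rewrite map_inj_uniq // => i j; apply: mulIf.
  move=> j; have [/dvdzP[i ->]|nj] := boolP (beta %| j)%Z; last first.
    by rewrite lsubst_ndvd ?mul0r.
  move=> nj; have /hs e : i \notin s.
    by apply: contra nj => /(map_f (fun i => i * beta%:Z)).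
  rewrite -mulrBl !lsubstE mulrACA -rmorphM e.
  by rewrite rmorph0 mul0r.
rewrite lsubst_ndvd //; symmetry; apply: (lcoefM_ind (P := fun z => z = 0)) => //.
  by move=> x y -> ->; rewrite addr0.
move=> i; have [di|ni] := boolP (beta %| i)%Z; last first.
  by rewrite lsubst_ndvd ?mul0r.
rewrite [X in _ * X]lsubst_ndvd ?mulr0 //; apply: contra nk => dk.
by rewrite -[k](subrK i); apply: rpredD.
Qed.

End LaurentSubst.
(** * Congruences modulo powers of p *)

Section Congruences.
Variables (T : comPzRingType) (S : subringClosed T) (p : nat).
Hypothesis p_prime : prime p.

(** Only the difference is required to lie in p^r S, so that non-integral elements such as
    logarithms can be congruent modulo p. *)
Definition cong (r : nat) (x y : T) : Prop :=
  exists2 z, z \in S & x - y = p%:R ^+ r * z.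

Lemma cong_refl r x : cong r x x.
Proof. by exists 0; [exact: rpred0 | rewrite subrr mulr0]. Qed.

Lemma cong_sym r x y : cong r x y -> cong r y x.
Proof. by move=> [z Sz e]; exists (- z); rewrite ?rpredN // mulrN -e opprB. Qed.

Lemma cong_trans r y x z : cong r x y -> cong r y z -> cong r x z.
Proof.
move=> [a Sa ea] [b Sb eb]; exists (a + b); first exact: rpredD.
by rewrite mulrDr -ea -eb addrA subrK.
Qed.

Lemma congD r x y x' y' : cong r x y -> cong r x' y' -> cong r (x + x') (y + y').
Proof.
move=> [a Sa ea] [b Sb eb]; exists (a + b); first exact: rpredD.
by rewrite mulrDr -ea -eb; ring.
Qed.

Lemma congM r x y x' y' : x \in S -> y' \in S ->
  cong r x y -> cong r x' y' -> cong r (x * x') (y * y').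
Proof.
move=> Sx Sy [a Sa ea] [b Sb eb]; exists (a * y' + x * b).
  by rewrite rpredD // rpredM.
by rewrite mulrDr mulrA -ea mulrCA -eb; ring.
Qed.

Lemma congX r x y k : x \in S -> y \in S -> cong r x y -> cong r (x ^+ k) (y ^+ k).
Proof.
move=> Sx Sy h; elim: k => [|k IHk]; first exact: cong_refl.
by rewrite !exprS; apply: congM => //; apply: rpredX.
Qed.

(** The cofactor of x - y in x^p - y^p is congruent to p y^(p-1) modulo p, hence divisible by p.
    This uses x = y modulo p, so r must be positive. *)
Lemma cong_expp r x y : (0 < r)%N -> x \in S -> y \in S ->
  cong r x y -> cong r.+1 (x ^+ p) (y ^+ p).
Proof.
move=> r0 Sx Sy h; rewrite /cong subrXX; have [z Sz ->] := h.
suff [w Sw ->] : exists2 w, w \in S &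
    \sum_(i < p) x ^+ (p.-1 - i) * y ^+ i = p%:R * w.
  by exists (z * w); [apply: rpredM | rewrite exprSr; ring].
have [w Sw e] : cong 1 (\sum_(i < p) x ^+ (p.-1 - i) * y ^+ i)
    (\sum_(i < p) y ^+ (p.-1 - i) * y ^+ i).
  elim/big_ind2: _ => [|a b c d|i _]; first exact: cong_refl.
    exact: congD.
  apply: congM; rewrite ?rpredX //; last exact: cong_refl.
  apply: congX => //; case: r r0 h {z Sz} => // r _ [z Sz e].
  exists (p%:R ^+ r * z); first by rewrite rpredM // rpredX // rpred_nat.
  by rewrite e exprS mulrA expr1.
exists (w + y ^+ p.-1); first by rewrite rpredD // rpredX.
move/eqP: e; rewrite subr_eq => /eqP ->; rewrite expr1 mulrDr; congr (_ + _).
rewrite (eq_bigr (fun=> y ^+ p.-1)) => [|i _].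
  by rewrite sumr_const card_ord mulr_natl.
by rewrite -exprD subnK // -ltnS prednK ?prime_gt0.
Qed.

Lemma cong_exp r x y k : (0 < r)%N -> x \in S -> y \in S ->
  cong r x y -> cong (r + k) (x ^+ (p ^ k)) (y ^+ (p ^ k)).
Proof.
move=> r0 Sx Sy h; elim: k => [|k IHk]; first by rewrite addn0 expn0.
rewrite addnS expnSr !exprM; apply: cong_expp; rewrite ?rpredX //.
by rewrite addn_gt0 r0.
Qed.

Lemma cong_freshman x y : x \in S -> y \in S ->
  cong 1 ((x + y) ^+ p) (x ^+ p + y ^+ p).
Proof.
move=> Sx Sy; rewrite /cong exprDn.
case: p p_prime => // q q_prime; rewrite big_ord_recl big_ord_recr /=.
rewrite subn0 expr0 mulr1 bin0 mulr1n subnn expr0 mul1r binn mulr1n.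
exists (\sum_(i < q) x ^+ (q.+1 - bump 0 i) * y ^+ bump 0 i
          *+ ('C(q.+1, bump 0 i) %/ q.+1)).
  by apply: rpred_sum => i _; rewrite rpredMn // rpredM // rpredX.
have -> (a b c : T) : a + (b + c) - (a + c) = b by ring.
rewrite expr1 mulr_sumr; apply: eq_bigr => i _.
rewrite mulr_natl -mulrnA divnK // prime_dvd_bin //.
by have := ltn_ord i; rewrite /bump; lia.
Qed.

(** An additive map lifts the Frobenius as soon as it does so on additive generators: sums of ones
    in Z_(p), monomials of a polynomial, monomials of a truncated series. *)
Lemma cong_frobenius_sum (I : Type) (r : seq I) (F : I -> T)
    (phi : {additive T -> T}) :
  (forall i, F i \in S) -> (forall i, cong 1 (phi (F i)) (F i ^+ p)) ->
  cong 1 (phi (\sum_(i <- r) F i)) ((\sum_(i <- r) F i) ^+ p).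
Proof.
move=> SF cF; elim: r => [|i r IHr].
  by rewrite big_nil raddf0 expr0n gtn_eqF ?prime_gt0 //; apply: cong_refl.
rewrite big_cons raddfD /=; apply: cong_trans (congD (cF i) IHr) _.
by apply/cong_sym/cong_freshman => //; apply: rpred_sum.
Qed.

End Congruences.

(** * Fermat's little theorem in Z_(p) *)

Section LocalIntegers.
Variable p : nat.
Hypothesis p_prime : prime p.

Lemma Zloc_natV b : coprime p b -> (b%:R)^-1 \in Zloc_pred p.
Proof.
move=> cpb; have b0 : b != 0%N.
  by apply: contraTneq cpb => ->; rewrite /coprime gcdn0 gtn_eqF ?prime_gt1.
rewrite -[_^-1]mul1r -[1]/(1%:~R) -[b%:R]/(b%:Z%:~R) unfold_in /Zloc_pred.
move: cpb; rewrite -[b]/(`|b%:Z|%N); have : b%:Z != 0 by [].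
case: divqP => [_|k x _ _]; first by rewrite eqxx.
by rewrite abszM coprimeMr => /andP[].
Qed.

Lemma Zloc_divq q : q \in Zloc_pred p ->
  exists a : int, exists2 b : nat, coprime p b & q = a%:~R / b%:R.
Proof.
move=> hq; exists (numq q), `|denq q|%N => //.
by rewrite -[X in _ / X]/(`|denq q|%N%:Z%:~R) gez0_abs ?denq_ge0 // divq_num_den.
Qed.

Lemma Zloc_modp q : q \in Zloc_pred p ->
  exists a : int, cong (Zloc_pred p) p 1 q a%:~R.
Proof.
move=> /Zloc_divq[a [b cpb ->]].
have [u [v uv]] := Bezoutz p%:Z b%:Z.
rewrite /gcdz !absz_nat (eqP cpb) in uv.
exists (a * v); exists (a%:~R * u%:~R / b%:R).
  by rewrite rpredM ?Zloc_natV // -rmorphM rpred_int.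
have b0 : b%:R != 0 :> rat.
  rewrite pnatr_eq0; apply: contraTneq cpb => ->.
  by rewrite /coprime gcdn0 gtn_eqF ?prime_gt1.
have /(congr1 (intr : int -> rat)) := uv.
rewrite intrD !intrM => uv'.
have -> : p%:R = p%:Z%:~R :> rat by [].
rewrite expr1.
have e : a%:~R = a%:~R * (u%:~R * p%:~R + v%:~R * b%:~R) :> rat.
  by rewrite uv' mulr1.
by rewrite {1}e; field.
Qed.

Lemma Zloc_frobenius q : q \in Zloc_pred p -> cong (Zloc_pred p) p 1 q (q ^+ p).
Proof.
have nat_case b : cong (Zloc_pred p) p 1 b%:R (b%:R ^+ p).
  have := @cong_frobenius_sum _ (Zloc_pred p) p p_prime _ (index_iota 0 b) (fun=> 1) idfun.
  rewrite /= sumr_const_nat subn0; apply=> [_|_]; first exact: rpred1.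
  by rewrite expr1n; apply: cong_refl.
move=> qZ; have [a [u uZ e]] := Zloc_modp qZ.
have int_case : cong (Zloc_pred p) p 1 a%:~R (a%:~R ^+ p).
  case: a {e} => b; first exact: nat_case.
  have -> : (Negz b)%:~R = - b.+1%:R :> rat by rewrite NegzE rmorphN.
  (* The two arguments add up to 0, which gives (-b)^p = -b^p modulo p without treating p = 2
     separately. *)
  have hf := @cong_freshman _ (Zloc_pred p) p p_prime b.+1%:R (- b.+1%:R).
  rewrite subrr expr0n gtn_eqF ?prime_gt0 // mulr0n in hf.
  have {hf}[||w wZ ew] := hf; rewrite ?rpredN ?rpred_nat //.
  have [w' w'Z ew'] := nat_case b.+1.
  exists (w - w'); first by rewrite rpredB.
  rewrite mulrBr -ew -ew'.
  by move: (b.+1%:R ^+ p) ((- b.+1%:R) ^+ p) => s t; ring.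
have aZ : a%:~R \in Zloc_pred p by exact: rpred_int.
have h : cong (Zloc_pred p) p 1 q a%:~R by exists u.
apply: (cong_trans h); apply: (cong_trans int_case).
by apply/cong_sym/congX.
Qed.

End LocalIntegers.
(** * Integrality of the p-series *)

Lemma tofrac_inj (R : idomainType) : injective (@tofrac R).
Proof. by move=> a b /eqP; rewrite tofrac_eq => /eqP. Qed.

Lemma triangular_sum (V : nmodType) (F : nat -> nat -> V) N :
  \sum_(1 <= k < N) \sum_(1 <= j < k.+1) F j (k - j)%N =
  \sum_(1 <= j < N) \sum_(0 <= i < N - j) F j i.
Proof.
transitivity (\sum_(1 <= k < N) \sum_(1 <= j < N | (j <= k)%N) F j (k - j)%N).
  apply: eq_big_nat => k /andP[k1 kN].
  by rewrite (big_nat_widen _ _ N).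
rewrite (exchange_big_dep_nat xpredT) //=; apply: eq_big_nat => j /andP[j1 jN].
transitivity (\sum_(j <= k < N) F j (k - j)%N).
  by rewrite [RHS](big_nat_widenl j 1).
by rewrite -{1}[j]add0n big_addn; apply: eq_bigr => i _; rewrite addnK.
Qed.

Section FunctionalEquation.
Variables p n : nat.
Hypothesis p_prime : prime p.
Local Notation A := {mpoly rat[n]}.
Local Notation v := (@vpoly p n).

Definition Zpoly : {pred A} := fun f => f \is a mpolyOver n (Zloc_pred p).

Fact Zpoly_subring : subring_closed Zpoly.
Proof.
split=> [|x y hx hy|x y hx hy]; rewrite unfold_in.
- exact: rpred1.
- exact: rpredB.
- exact: rpredM.
Qed.
HB.instance Definition _ :=
  GRing.isSubringClosed.Build A Zpoly Zpoly_subring.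

Lemma Zpoly_v i : v i \in Zpoly.
Proof. exact: mpolyOver_v. Qed.

Lemma ZpolyP f : reflect (forall m, f@_m \in Zloc_pred p) (f \in Zpoly).
Proof. exact: mpolyOverP. Qed.

Lemma mpoly_natf_eq0 m : (m%:R == 0 :> A) = (m == 0%N).
Proof. by rewrite -mpolyC_nat mpolyC_eq0 pnatr_eq0. Qed.

Lemma pX_neq0 r : p%:R ^+ r != 0 :> A.
Proof. by rewrite -natrX mpoly_natf_eq0 -lt0n expn_gt0 prime_gt0. Qed.

(** The denominators p - p^(p^k) are rational constants, so the l_k are polynomials over Q. Each
    step of the recursion costs a single factor p, because 1 - p^(p^k - 1) is a unit of Z_(p). *)
Lemma araki_log_mpoly : exists l : nat -> A,
  [/\ l 0%N = 1, forall k, araki_log p n k = tofrac (l k),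
   forall k, p%:R * l k = \sum_(0 <= i < k.+1) l i * v (k - i) ^+ (p ^ i),
   forall k, p%:R ^+ k * l k \in Zpoly &
   forall k, mpoly_homog p (vdeg p k)%:Z (l k)].
Proof.
have p1 := prime_gt1 p_prime.
have frac_inj : injective (@tofrac A) by exact: tofrac_inj.
have rec_sol k (l : nat -> A) : (0 < k)%N ->
    (forall i, (i < k)%N -> araki_log p n i = tofrac (l i)) ->
    araki_log p n k = tofrac (((p%:R - p%:R ^+ (p ^ k)) ^-1 : rat)%:MP *
        \sum_(0 <= i < k) l i * v (k - i) ^+ (p ^ i)).
  move=> k0 hl; have := araki_logE n k p1.
  rewrite big_ord_recr /= subnn {2}/vfrac /= => e.
  set c := p%:R - _; have c0 : c != 0.
    rewrite subr_eq0 -natrX eqr_nat neq_ltn -{1}[p]expn1 ltn_exp2l //.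
    by rewrite -{1}(expn0 p) ltn_exp2l // k0.
  have c0' : tofrac (c%:MP : A) != 0 by rewrite tofrac_eq0 mpolyC_eq0.
  apply: (mulfI c0'); rewrite -rmorphM mulrA -mpolyCM divff // mpolyC1 mul1r.
  rewrite big_mkord rmorph_sum /= /c.
  rewrite !(rmorphB, rmorphXn, rmorph_nat) /=.
  rewrite mulrBl e.
  rewrite ?rmorph_nat [araki_log p n k * _]mulrC addrK; apply: eq_bigr => i _.
  by rewrite hl // rmorphM rmorphXn.
have /choice[l hl] k : exists f : A, araki_log p n k = tofrac f.
  elim/ltn_ind: k => k IHk; have [->|k0] := posnP k.
    by exists 1; rewrite rmorph1 /araki_log.
  have /choice[l hl] i : exists f : A, (i < k)%N -> araki_log p n i = tofrac f.
    by have [/IHk[f hf]|_] := ltnP i k; [exists f | exists 0].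
  by exists (((p%:R - p%:R ^+ (p ^ k)) ^-1 : rat)%:MP *
        \sum_(0 <= i < k) l i * v (k - i) ^+ (p ^ i)); apply: rec_sol.
have l0 : l 0%N = 1 by apply: frac_inj; rewrite -hl rmorph1 /araki_log.
have lE k : (0 < k)%N -> l k = ((p%:R - p%:R ^+ (p ^ k)) ^-1 : rat)%:MP *
        \sum_(0 <= i < k) l i * v (k - i) ^+ (p ^ i).
  by move=> k0; apply: frac_inj; rewrite -hl; apply: rec_sol.
exists l; split=> // k.
- apply: frac_inj; rewrite rmorphM rmorph_nat /= -hl araki_logE // big_mkord.
  rewrite rmorph_sum; apply: eq_bigr => i _.
  by rewrite rmorphM rmorphXn /= hl.
- elim/ltn_ind: k => k IHk; have [->|k0] := posnP k.
    by rewrite l0 mulr1 rpred1.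
  rewrite lE //; have pk : (1 < p ^ k)%N by rewrite -{1}(expn0 p) ltn_exp2l.
  have -> : p%:R - p%:R ^+ (p ^ k) = p%:R * (1 - p%:R ^+ (p ^ k).-1) :> rat.
    by rewrite mulrBr mulr1 -exprS prednK // ltnW.
  rewrite invfM mpolyCM.
  case: k k0 IHk {pk} => // k _ IHk.
  set u := (1 - _)^-1; have uZ : u \in Zloc_pred p.
    have pgt0 : (0 < p)%N by apply: prime_gt0.
    rewrite /u -opprB invrN rpredN -natrX -[1]/(1%:R) -natrB ?expn_gt0 ?pgt0 //.
    apply: Zloc_natV => //; rewrite -(@coprime_pexpl (p ^ k.+1).-1) ?subn1.
      by rewrite coprimenP // expn_gt0 pgt0.
    by rewrite -subn1 subn_gt0 -{1}(expn0 p) ltn_exp2l.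
  have -> : p%:R ^+ k.+1 * ((p%:R^-1)%:MP * u%:MP *
      \sum_(0 <= i < k.+1) l i * v (k.+1 - i) ^+ (p ^ i)) =
      u%:MP * \sum_(0 <= i < k.+1)
        (p%:R ^+ (k - i) * (p%:R ^+ i * l i) * v (k.+1 - i) ^+ (p ^ i)) :> A.
    set s := \sum_(0 <= i < _) _.
    have -> : \sum_(0 <= i < k.+1)
        (p%:R ^+ (k - i) * (p%:R ^+ i * l i) * v (k.+1 - i) ^+ (p ^ i)) =
        p%:R ^+ k * s.
      rewrite /s mulr_sumr; apply: eq_big_nat => i ik.
      by rewrite !mulrA -exprD subnK.
    have pV : p%:R * (p%:R^-1)%:MP = 1 :> A.
      by rewrite -mpolyC_nat -mpolyCM divff // pnatr_eq0 -lt0n prime_gt0.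
    have gen (a b c d e : A) : a * b = 1 -> a * c * (b * d * e) = d * (c * e).
      by move=> h; rewrite -[RHS]mul1r -h; ring.
    by rewrite exprS gen.
  rewrite rpredM //; first by rewrite unfold_in /Zpoly mpolyOverC.
  rewrite big_nat; apply: rpred_sum => i /andP[_ ik].
  apply: rpredM; last by rewrite rpredX ?Zpoly_v.
  by apply: rpredM; [rewrite rpredX ?rpred_nat | apply: IHk].
- elim/ltn_ind: k => k IHk; have [->|k0] := posnP k.
    by rewrite l0 /vdeg expn0 subnn muln0; apply: mpoly_homog1.
  rewrite lE //.
  have hD d (f g : A) : mpoly_homog p d f -> mpoly_homog p d g ->
      mpoly_homog p d (f + g).
    move=> hf hg; rewrite -[g]opprK; apply: mpoly_homogB => //.
    by rewrite -[- g]add0r; apply: mpoly_homogB => //; apply: mpoly_homog0.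
  rewrite -[_%:Z]add0r; apply: mpoly_homogM.
    move=> e; rewrite msuppC; case: ifP => // _; rewrite inE => /eqP ->.
    by rewrite /mnm_deg big1 // => i _; rewrite mnm0E muln0.
  rewrite big_nat; elim/big_ind: _ => [|f g|i ik]; first exact: mpoly_homog0.
    exact: hD.
  have -> : (vdeg p k)%:Z = (vdeg p i)%:Z + (vdeg p (k - i))%:Z * (p ^ i)%N%:Z.
    rewrite -PoszM -PoszD; congr Posz; rewrite /vdeg.
    have ik' := ltnW (proj2 (andP ik)).
    have -> : (p ^ k = p ^ (k - i) * p ^ i)%N by rewrite -expnD subnK.
    have h1 : (0 < p ^ (k - i))%N by rewrite expn_gt0 prime_gt0.
    have h2 : (0 < p ^ i)%N by rewrite expn_gt0 prime_gt0.
    by nia.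
  by apply: mpoly_homogM; [apply: IHk | apply/mpoly_homogX/mpoly_homog_v].
Qed.

End FunctionalEquation.

(** * The Frobenius lift on polynomials and on Laurent series *)

Section FrobeniusLift.
Variables p n : nat.
Hypothesis p_prime : prime p.
Local Notation A := {mpoly rat[n]}.
Local Notation v := (@vpoly p n).
Local Notation Zpoly := (@Zpoly p n).

(** Being Q-linear, it fixes v_0 = p instead of raising it to the power p. For this reason the term
    with v_0 is split off from Araki's relation before [sigma] is applied to powers of the v_i. *)
Definition sigma : A -> A := comp_mpoly [tuple 'X_i ^+ p | i < n].
HB.instance Definition _ := GRing.RMorphism.on sigma.

Lemma sigma_v i : (0 < i)%N -> sigma (v i) = v i ^+ p.
Proof.
case: i => // i _ /=; case: insubP => [k _ _|_] /=.
  by rewrite /sigma comp_mpolyXU -tnth_nth tnth_mktuple.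
by rewrite rmorph0 expr0n gtn_eqF ?prime_gt0.
Qed.

Lemma sigma_monomial c (m : 'X_{1..n}) :
  sigma (c *: 'X_[m]) = c *: 'X_[m] ^+ p.
Proof.
rewrite /sigma comp_mpolyZ comp_mpolyX; congr (_ *: _).
rewrite [in RHS]mpolyXE_id -prodrXl; apply: eq_bigr => i _.
by rewrite tnth_mktuple exprAC.
Qed.

Lemma sigma_Zpoly f : f \in Zpoly -> sigma f \in Zpoly.
Proof.
move=> /ZpolyP fZ; rewrite [f]mpolyE raddf_sum; apply: rpred_sum => m _ /=.
rewrite sigma_monomial; apply: mpolyOverZ => //.
by rewrite rpredX // mpolyOverX.
Qed.

Lemma sigma_cong f : f \in Zpoly -> cong Zpoly p 1 (sigma f) (f ^+ p).
Proof.
move=> /ZpolyP fZ; rewrite [f]mpolyE.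
apply: (cong_frobenius_sum p_prime) => m.
  by apply: mpolyOverZ => //; apply: mpolyOverX.
have [z zZ e] := Zloc_frobenius p_prime (fZ m).
exists (z *: 'X_[m] ^+ p).
  by apply: mpolyOverZ => //; rewrite rpredX // mpolyOverX.
rewrite /= sigma_monomial exprZn -scalerBl e !expr1.
by rewrite -!mul_mpolyC mpolyCM mpolyC_nat mulrA.
Qed.

Lemma iter_sigma_v j i : (0 < i)%N -> iter j sigma (v i) = v i ^+ (p ^ j).
Proof.
move=> i0; elim: j => //= j ->.
by rewrite rmorphXn /= sigma_v // -exprM expnS.
Qed.

Lemma iter_sigmaM j f g : iter j sigma (f * g) = iter j sigma f * iter j sigma g.
Proof. by elim: j => //= j ->; rewrite rmorphM. Qed.

Lemma iter_sigmaX j f k : iter j sigma (f ^+ k) = iter j sigma f ^+ k.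
Proof. by elim: j => //= j ->; rewrite rmorphXn. Qed.

Lemma iter_sigma_nat j k : iter j sigma k%:R = k%:R.
Proof. by elim: j => //= j ->; rewrite rmorph_nat. Qed.

Lemma iter_sigma_sum j (I : Type) (r : seq I) (P : pred I) (F : I -> A) :
  iter j sigma (\sum_(i <- r | P i) F i) = \sum_(i <- r | P i) iter j sigma (F i).
Proof. by elim: j => //= j ->; rewrite rmorph_sum. Qed.

Lemma iter_sigma_Zpoly j f : f \in Zpoly -> iter j sigma f \in Zpoly.
Proof. by move=> fZ; elim: j => //= j; apply: sigma_Zpoly. Qed.

Definition Zseries : {pred laurent A} := fun f => `[< forall k, f k \in Zpoly >].

Fact Zseries_subring : subring_closed Zseries.
Proof.
split=> [|x y /asboolP hx /asboolP hy|x y /asboolP hx /asboolP hy];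
  apply/asboolP => k.
- by rewrite -lmonom1 lcoef_monom; case: eqP => _; rewrite ?rpred1 ?rpred0.
- by rewrite lcoefB rpredB.
- apply: (lcoefM_ind (P := fun z => z \in Zpoly)) => [|a b|i].
  + exact: rpred0.
  + exact: rpredD.
  + exact: rpredM.
Qed.
HB.instance Definition _ :=
  GRing.isSubringClosed.Build (laurent A) Zseries Zseries_subring.

Lemma ZseriesP (f : laurent A) : reflect (forall k, f k \in Zpoly) (f \in Zseries).
Proof. exact: asboolP. Qed.

Lemma Zseries_monom c i : c \in Zpoly -> lmonom c i \in Zseries.
Proof.
move=> cZ; apply/ZseriesP => k; rewrite lcoef_monom.
by case: eqP => // _; apply: rpred0.
Qed.

Lemma lmonom_nat (k : nat) : lmonom k%:R 0 = k%:R :> laurent A.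
Proof.
elim: k => [|k IHk]; first by rewrite lmonom0.
by rewrite !mulrS -IHk; apply: laurent_ext => i /=; case: eqP; rewrite ?addr0.
Qed.

Lemma lcoef_natM (k : nat) (f : laurent A) i : (k%:R * f) i = k%:R * f i.
Proof. by rewrite -lmonom_nat lcoef_monomM subr0. Qed.

Lemma lcoef_pXM r (f : laurent A) i : (p%:R ^+ r * f) i = p%:R ^+ r * f i.
Proof. by rewrite -!natrX lcoef_natM. Qed.

(** The witness is the difference divided by p^r as a whole; this is a Laurent series at once, which
    witnesses chosen coefficient by coefficient need not form. *)
Lemma Zseries_cong r (f g : laurent A) :
  (forall k, cong Zpoly p r (f k) (g k)) -> cong Zseries p r f g.
Proof.
move=> h; pose q : A := (p%:R ^- r)%:MP.
have qp : p%:R ^+ r * q = 1.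
  rewrite /q -natrX -mpolyC_nat -mpolyCM natrX divff ?mpolyC1 //.
  by rewrite expf_neq0 // pnatr_eq0 -lt0n prime_gt0.
exists (lmonom q 0 * (f - g)).
  apply/ZseriesP => k; rewrite lcoef_monomM subr0 lcoefB.
  by have [z zZ ->] := h k; rewrite mulrA [q * _]mulrC qp mul1r.
apply: laurent_ext => k.
by rewrite lcoef_pXM lcoef_monomM subr0 mulrA qp mul1r.
Qed.

Definition phi : laurent A -> laurent A :=
  lsubst sigma (fun=> 1) (prime_gt0 p_prime).

Fact phi_is_zmod_morphism : zmod_morphism phi.
Proof. exact: lsubst_is_zmod_morphism. Qed.
Fact phi_is_monoid_morphism : monoid_morphism phi.
Proof. by apply: lsubst_is_monoid_morphism => // *; rewrite mulr1. Qed.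
HB.instance Definition _ :=
  GRing.isZmodMorphism.Build _ _ phi phi_is_zmod_morphism.
HB.instance Definition _ :=
  GRing.isMonoidMorphism.Build _ _ phi phi_is_monoid_morphism.

Lemma phi_lcoef (f : laurent A) i : phi f (i * p%:Z) = sigma (f i).
Proof. by rewrite [LHS]lsubstE mulr1. Qed.

Lemma phiP (P : int -> A -> Prop) (f : laurent A) : (forall k, P k 0) ->
  (forall i, P (i * p%:Z) (sigma (f i))) -> forall k, P k (phi f k).
Proof. by move=> P0 Pi; apply: lsubstP => // i; rewrite mulr1. Qed.

Lemma phi_monom c i : phi (lmonom c i) = lmonom (sigma c) (i * p%:Z).
Proof.
have p0 : p%:Z != 0 by rewrite lt0n_neq0 ?prime_gt0.
apply: laurent_ext => k; have [/dvdzP[j ->]|nk] := boolP (p %| k)%Z.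
  rewrite phi_lcoef !lcoef_monom (inj_eq (mulIf p0)).
  by case: eqP; rewrite ?rmorph0.
rewrite [LHS]lsubst_ndvd // lcoef_monom; case: eqP nk => // ->.
by rewrite dvdz_mull.
Qed.

(** As f has no constant term, a given coefficient of either side depends on finitely many
    coefficients of f. So f may be truncated, and the congruence is checked on monomials. *)
Lemma phi_cong f : f \in Zseries -> vanishes_below 1 f ->
  cong Zseries p 1 (phi f) (f ^+ p).
Proof.
move=> fZ f1; have /ZseriesP fZ' := fZ.
have trunc_case N : cong Zseries p 1 (phi (ltrunc f N)) (ltrunc f N ^+ p).
  have [->|->] := ltrunc_sum N f1; last first.
    by rewrite rmorph0 expr0n gtn_eqF ?prime_gt0 //; apply: cong_refl.
  apply: (cong_frobenius_sum p_prime) => i; first exact: Zseries_monom.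
  rewrite /= phi_monom lmonomX; apply: Zseries_cong => k.
  rewrite !lcoef_monom; case: eqP => _; last exact: cong_refl.
  exact: sigma_cong.
apply: Zseries_cong => k; pose t := ltrunc f (`|k|%N%:Z + 1).
have t1 : vanishes_below 1 t by move=> i i1; rewrite /= f1 // if_same.
have ft : vanishes_below (`|k|%N%:Z + 1) (f - t) by apply: ltrunc_below.
have -> : phi f k = phi t k.
  apply/eqP; rewrite -subr_eq0 -lcoefB -rmorphB; apply/eqP.
  have [/dvdzP[j kj]|nk] := boolP (p %| k)%Z; last by rewrite [LHS]lsubst_ndvd.
  rewrite kj phi_lcoef ft ?rmorph0 //.
  have [j0|j0] := lerP j 0; first by lia.
  have : j <= j * p%:Z by apply: ler_peMr; [exact: ltW | have := prime_gt0 p_prime; lia].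
  by rewrite -kj; lia.
have -> : (f ^+ p) k = (t ^+ p) k.
  apply/eqP; rewrite -subr_eq0 -lcoefB subrXX; apply/eqP.
  apply: (@lmul_below _ _ 0 _ _ ft); last by rewrite addr0; lia.
  elim/big_ind: _ => // [a b|i _]; first exact: vanishesD.
  rewrite -[0]addr0; apply: lmul_below.
    by apply: vanishes_belowW (lexp_below f1); lia.
  by apply: vanishes_belowW (lexp_below t1); lia.
have [z /ZseriesP zZ e] := trunc_case (`|k|%N%:Z + 1).
by exists (z k) => //; rewrite -lcoefB e lcoef_pXM.
Qed.

Lemma phi_Zseries f : f \in Zseries -> phi f \in Zseries.
Proof.
move=> /ZseriesP fZ; apply/ZseriesP.
apply: (phiP (P := fun k z => z \in Zpoly)) => [k|i]; first exact: rpred0.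
exact: sigma_Zpoly.
Qed.

End FrobeniusLift.

(** * Hazewinkel's functional equation for the logarithm *)

Section Integrality.
Variables p n : nat.
Hypothesis p_prime : prime p.
Local Notation A := {mpoly rat[n]}.
Local Notation v := (@vpoly p n).
Local Notation Zpoly := (@Zpoly p n).
Local Notation Zseries := (@Zseries p n).
Local Notation sigma := (@sigma p n).
Local Notation phi := (@phi p n p_prime).

Variable l : nat -> A.
Hypothesis l0 : l 0%N = 1.
Hypothesis l_rec :
  forall k, p%:R * l k = \sum_(0 <= i < k.+1) l i * v (k - i) ^+ (p ^ i).
Hypothesis l_Z : forall k, p%:R ^+ k * l k \in Zpoly.

Lemma l_ppX k : p%:R ^+ (p ^ k).-1 * l k \in Zpoly.
Proof.
have kp : (k <= (p ^ k).-1)%N.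
  by rewrite -ltnS prednK ?expn_gt0 ?prime_gt0 // ltn_expl // prime_gt1.
rewrite -(subnK kp) exprD -mulrA.
by apply: rpredM; [apply/rpredX/rpred_nat | apply: l_Z].
Qed.

(* The h_j of Hazewinkel's functional equation
   log x = x + sum_(j >= 1) (h_j / p) phi^j (log x), where phi is the Frobenius
   lift v_i |-> v_i^p, x |-> x^p. *)
Lemma functional_equation_coef : exists h : nat -> A,
  (forall k, (0 < k)%N ->
     p%:R * l k = \sum_(1 <= j < k.+1) h j * iter j sigma (l (k - j))) /\
  (forall k, (0 < k)%N -> h k \in Zpoly).
Proof.
have [h hE] := strong_recursion (fun s : seq A => p%:R * l (size s) -
  \sum_(1 <= j < size s) s`_j * iter j sigma (l (size s - j))).
have {}hE k : h k = p%:R * l k - \sum_(1 <= j < k) h j * iter j sigma (l (k - j)).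
  rewrite hE size_mkseq; congr (_ - _); apply: eq_big_nat => j /andP[_ jk].
  by rewrite nth_mkseq.
exists h; have hl k : (0 < k)%N ->
    p%:R * l k = \sum_(1 <= j < k.+1) h j * iter j sigma (l (k - j)).
  move=> k0; rewrite big_nat_recr //= subnn l0 [h k]hE.
  by rewrite -[1](mulr1n 1) iter_sigma_nat mulr1 addrC subrK.
split=> //; elim/ltn_ind => k IHk k0.
(* Multiply the definition of h_k by p and expand both p l_k and p l_(k-j) by Araki's relation. [T]
   is the double sum common to the two expansions and cancels; [D] collects the terms with v_0 = p,
   where the large power of p makes l_(k-j) integral. *)
pose T := \sum_(1 <= j < k) \sum_(0 <= i < k - j)
  h j * iter j sigma (l i) * v (k - j - i) ^+ (p ^ (i + j)).
pose D := \sum_(1 <= j < k) h j *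
  iter j sigma (p%:R ^+ (p ^ (k - j)).-1 * l (k - j)).
have pX m x : p%:R ^+ (p ^ m) * x = p%:R * (p%:R ^+ (p ^ m).-1 * x) :> A.
  by rewrite mulrA -exprS prednK // expn_gt0 prime_gt0.
have e1 : p%:R * (p%:R * l k) =
    p%:R * (v k + p%:R * (p%:R ^+ (p ^ k).-1 * l k)) + T.
  rewrite l_rec big_nat_recr //= subnn big_ltn // l0 subn0 expn0 expr1 mul1r.
  suff -> : T = p%:R * \sum_(1 <= i < k) l i * v (k - i) ^+ (p ^ i).
    rewrite -[v 0]/(p%:R) -pX; ring.
  rewrite /T -(triangular_sum (fun j i =>
    h j * iter j sigma (l i) * v (k - j - i) ^+ (p ^ (i + j)))) mulr_sumr.
  apply: eq_big_nat => i /andP[i1 ik]; rewrite mulrA hl // mulr_suml.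
  apply: eq_big_nat => j /andP[j1 ji].
  by rewrite subnK // -subnDA subnKC.
have e2 : p%:R * \sum_(1 <= j < k) h j * iter j sigma (l (k - j)) = T + p%:R * D.
  rewrite /T /D !mulr_sumr -big_split; apply: eq_big_nat => j /andP[j1 jk].
  rewrite mulrCA -(iter_sigma_nat p n j p) -iter_sigmaM l_rec iter_sigma_sum.
  rewrite big_nat_recr //= mulrDr mulr_sumr; congr (_ + _).
    apply: eq_big_nat => i /andP[_ ik].
    rewrite iter_sigmaM iter_sigmaX iter_sigma_v ?subn_gt0 // mulrA.
    by rewrite -exprM -expnD addnC.
  rewrite subnn -[v 0]/(p%:R) !(iter_sigmaM, iter_sigmaX, iter_sigma_nat).
  by rewrite [_ * _ ^+ (p ^ _)]mulrC pX; ring.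
have -> : h k = v k + p%:R * (p%:R ^+ (p ^ k).-1 * l k) - D.
  apply: (mulfI (pX_neq0 n p_prime 1)); rewrite !expr1.
  by rewrite hE mulrBr e1 e2; ring.
apply: rpredB.
  apply: rpredD; first exact: Zpoly_v.
  by apply: rpredM; [apply: rpred_nat | apply: l_ppX].
rewrite /D big_nat; apply: rpred_sum => j /andP[j0 jk].
by apply: rpredM; [apply: IHk | apply/iter_sigma_Zpoly/l_ppX].
Qed.

Definition log_trunc N (a : laurent A) : laurent A :=
  \sum_(0 <= k < N.+1) lmonom (l k) 0 * a ^+ (p ^ k).

Lemma iter_phi_log_trunc N j a :
  iter j phi (log_trunc N a) =
  \sum_(0 <= k < N.+1) lmonom (iter j sigma (l k)) 0 * iter j phi a ^+ (p ^ k).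
Proof.
elim: j => //= j ->; rewrite rmorph_sum; apply: eq_bigr => k _.
by rewrite rmorphM rmorphXn /= phi_monom mul0r.
Qed.

Lemma iter_phiP j a : a \in Zseries -> vanishes_below 1 a ->
  [/\ iter j phi a \in Zseries, vanishes_below 1 (iter j phi a) &
      cong Zseries p 1 (a ^+ (p ^ j)) (iter j phi a)].
Proof.
move=> aZ a1; elim: j => [|j [Z1 V1 C1]]; last rewrite iterS.
  by split=> //; rewrite expn0 expr1; apply: cong_refl.
split; first exact: phi_Zseries.
  move=> k k1; have [/dvdzP[i ki]|nk] := boolP (p %| k)%Z.
    rewrite ki phi_lcoef V1 ?rmorph0 //.
    by have := prime_gt0 p_prime; nia.
  by rewrite [LHS]lsubst_ndvd.
apply: (cong_trans _ (cong_sym (phi_cong p_prime Z1 V1))).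
rewrite expnSr exprM; by apply: congX => //; apply: rpredX.
Qed.

(** Write a^(p^k) as the p^(k-j)-th power of a^(p^j), which agrees with phi^j a modulo p. The powers
    then agree modulo p^(k-j+1), and since p^(k-j) l_(k-j) is integral one factor p is left. Cutting
    at N - j on the right matches k <= N on the left, so the finite sums correspond term by term. *)
Lemma log_trunc_functional_equation (h : nat -> A) N a :
  (forall k, (0 < k)%N ->
     p%:R * l k = \sum_(1 <= j < k.+1) h j * iter j sigma (l (k - j))) ->
  (forall k, (0 < k)%N -> h k \in Zpoly) ->
  a \in Zseries -> vanishes_below 1 a ->
  cong Zseries p 1 (p%:R * log_trunc N a)
    (\sum_(1 <= j < N.+1) lmonom (h j) 0 * iter j phi (log_trunc (N - j) a)).
Proof.
move=> hl hZ aZ a1.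
pose c j i := lmonom (h j * iter j sigma (l i)) 0 : laurent A.
have -> : p%:R * log_trunc N a = p%:R * a +
    \sum_(1 <= k < N.+1) \sum_(1 <= j < k.+1) c j (k - j)%N * a ^+ (p ^ k).
  rewrite /log_trunc big_nat_recl // l0 expn0 expr1 lmonom1 mul1r mulrDr.
  congr (_ + _); rewrite mulr_sumr [RHS]big_add1; apply: eq_bigr => k _.
  rewrite -lmonom_nat mulrA lmonomM hl // -mulr_suml.
  by congr (_ * _); rewrite add0r lmonom_sum.
have -> : \sum_(1 <= j < N.+1) lmonom (h j) 0 * iter j phi (log_trunc (N - j) a) =
    \sum_(1 <= k < N.+1) \sum_(1 <= j < k.+1)
      c j (k - j)%N * iter j phi a ^+ (p ^ (k - j)).
  rewrite (triangular_sum (fun j i => c j i * iter j phi a ^+ (p ^ i))).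
  apply: eq_big_nat => j /andP[j1 jN].
  rewrite iter_phi_log_trunc mulr_sumr subSn //; apply: eq_bigr => i _.
  by rewrite mulrA lmonomM.
rewrite -[X in cong _ _ _ _ X]add0r; apply: congD.
  by exists a => //; rewrite subr0 expr1.
rewrite big_nat [X in cong _ _ _ _ X]big_nat.
elim/big_ind2: _ => [|x y z t|k /andP[k1 _]]; [exact: cong_refl | exact: congD |].
rewrite big_nat [X in cong _ _ _ _ X]big_nat.
elim/big_ind2: _ => [|x y z t|j /andP[j1 jk]]; [exact: cong_refl | exact: congD |].
have [Z1 V1 C1] := iter_phiP j aZ a1.
have [z zZ] := cong_exp p_prime (k - j)%N (ltn0Sn 0) (rpredX _ aZ) Z1 C1.
rewrite -exprM -expnD subnKC // => e.
exists (lmonom (h j * iter j sigma (p%:R ^+ (k - j) * l (k - j))) 0 * z).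
  apply: rpredM; last exact: zZ.
  apply: Zseries_monom; apply: rpredM; first exact: hZ.
  exact/iter_sigma_Zpoly/l_Z.
have -> : lmonom (h j * iter j sigma (p%:R ^+ (k - j) * l (k - j)%N)) 0 =
    p%:R ^+ (k - j) * c j (k - j)%N.
  have -> : p%:R ^+ (k - j) = lmonom (p%:R ^+ (k - j)) 0 :> laurent A.
    by rewrite -[in RHS]natrX lmonom_nat natrX.
  rewrite lmonomM add0r; congr lmonom.
  by rewrite iter_sigmaM iter_sigmaX iter_sigma_nat mulrCA.
by rewrite -mulrBr e exprD; ring.
Qed.

End Integrality.

(** * Integrality of [p](x), coefficient by coefficient *)

Section PSeriesIntegral.
Variables p n : nat.
Hypothesis p_prime : prime p.
Local Notation A := {mpoly rat[n]}.
Local Notation K := {fraction A}.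
Local Notation v := (@vpoly p n).
Local Notation Zpoly := (@Zpoly p n).
Local Notation Zseries := (@Zseries p n).
Local Notation phi := (@phi p n p_prime).
Local Notation X := (lmonom 1 1).

Let p_gt1 : (1 < p)%N := prime_gt1 p_prime.

(** Each formal sum adds logarithms. By injectivity of the logarithm these two properties
    characterize [p](x), and later arguments rely on them alone. *)
Lemma pseries_log :
  pointed (pseries p n) /\ fgl_log p (pseries p n) = p%:R * fgl_log p X.
Proof.
have X1 : pointed (X : laurent K).
  by move=> k k1; rewrite lcoef_monom lt_eqF.
have log_pointed (f : laurent K) : pointed (fgl_log p f).
  by move=> k k1; rewrite /= ifF //; lia.
suff: forall m, let P : laurent K := iter m (fgl_add p X) 0 in
    pointed P /\ fgl_log p P = m%:R * fgl_log p X by apply.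
elim=> [|m [IH1 IH2]] /=.
  split=> //; rewrite mul0r; apply: laurent_ext => j /=; case: ifP => // _.
  apply: big1 => k _; rewrite expr0n gtn_eqF ?mulr0 //.
  by rewrite expn_gt0 ltnW.
rewrite /fgl_add; set s := fgl_log _ _ + _.
have [|h1 h2] := fgl_expP p_gt1 (_ : pointed s).
  by apply: vanishesD; apply: log_pointed.
by split=> //; rewrite h2 /s IH2 mulrS mulrDl mul1r.
Qed.

Variable l : nat -> A.
Hypothesis l0 : l 0%N = 1.
Hypothesis l_frac : forall k, araki_log p n k = tofrac (l k).
Hypothesis l_rec :
  forall k, p%:R * l k = \sum_(0 <= i < k.+1) l i * v (k - i) ^+ (p ^ i).
Hypothesis l_Z : forall k, p%:R ^+ k * l k \in Zpoly.

Fact poly_log_subproof (f : laurent A) : exists N, vanishes_below N (fun j : int =>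
  if 0 < j then \sum_(0 <= k < (`|j|%N).+1) l k * (f ^+ (p ^ k)) j else 0).
Proof. by exists 0 => j j0; rewrite ltNge ltW. Qed.

Definition poly_log (f : laurent A) : laurent A := Laurent (poly_log_subproof f).

Lemma lmap_poly_log f : lmap (@tofrac A) (poly_log f) = fgl_log p (lmap (@tofrac A) f).
Proof.
apply: laurent_ext => j /=; rewrite [LHS]fun_if rmorph0; case: ifP => // _.
rewrite big_mkord rmorph_sum; apply: eq_bigr => k _.
by rewrite rmorphM l_frac -rmorphXn.
Qed.

(** The series f^(p^k) has order at least p^k > k, so the terms with k > N do not reach x^j. *)
Lemma poly_log_trunc (f : laurent A) N (j : int) : vanishes_below 1 f -> j <= N%:Z ->
  poly_log f j = log_trunc p l N f j.
Proof.
move=> f1 jN; rewrite /log_trunc lcoef_sum.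
under eq_bigr do rewrite lcoef_monomM subr0.
rewrite [LHS]/=.
have far k : j <= k%:Z -> (f ^+ (p ^ k)) j = 0.
  by move=> jk; apply: (lexp_below f1); have := ltn_expl k p_gt1; lia.
case: ltP => [j0|j0]; last first.
  by rewrite big1_seq // => k _; rewrite far ?mulr0 //; lia.
rewrite [RHS](@big_cat_nat _ _ _ (`|j|%N).+1) //=; last by lia.
rewrite [X in _ + X]big_nat_cond [X in _ + X]big1 ?addr0 // => k /andP[/andP[jk _] _].
by rewrite far ?mulr0 //; lia.
Qed.

Lemma iter_phi_eq0 j (f : laurent A) k :
  (forall i, i * (p ^ j)%N%:Z = k -> f i = 0) -> iter j phi f k = 0.
Proof.
elim: j k => [|j IHj] k hf; first by apply: hf; rewrite mulr1.
rewrite iterS; have [/dvdzP[i ki]|nk] := boolP (p %| k)%Z.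
  rewrite ki phi_lcoef IHj ?rmorph0 // => m mi; apply: hf.
  by rewrite ki -mi expnSr PoszM mulrA.
by rewrite [LHS]lsubst_ndvd.
Qed.

Lemma iter_phi_linear j c f g :
  iter j phi (c%:R * f - g) = c%:R * iter j phi f - iter j phi g.
Proof. by elim: j => // j; rewrite !iterS => ->; rewrite rmorphB rmorphM rmorph_nat. Qed.

Lemma X_Zseries : X \in Zseries.
Proof. by apply: Zseries_monom; apply: rpred1. Qed.

Lemma X_pointed : vanishes_below 1 (X : laurent A).
Proof. by move=> k k1; rewrite lcoef_monom lt_eqF. Qed.

(* All terms phi^j D, j >= 1, of the functional equation have order > J, so the
   coefficient of x^J in D is already integral. *)
Lemma poly_log_integral (a : laurent A) (J : nat) :
  a \in Zseries -> vanishes_below 1 a ->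
  let D := p%:R * poly_log X - poly_log a in
  (0 < J)%N -> vanishes_below J%:Z D -> D J%:Z \in Zpoly.
Proof.
move=> aZ a1 D J0 DJ.
have [h [hl hZ]] := functional_equation_coef p_prime l0 l_rec l_Z.
have [wX wXZ eX] := log_trunc_functional_equation p_prime l0 l_Z J hl hZ
  X_Zseries X_pointed.
have [wa waZ ea] := log_trunc_functional_equation p_prime l0 l_Z J hl hZ aZ a1.
pose F N := p%:R * log_trunc p l N X - log_trunc p l N a.
have DF N i : i <= N%:Z -> D i = F N i.
  move=> iN; rewrite /D /F !lcoefB !lcoef_natM.
  by rewrite !(@poly_log_trunc _ N) //; apply: X_pointed.
have e : p%:R * F J = p%:R * (p%:R * wX - wa) +
    \sum_(1 <= j < J.+1) lmonom (h j) 0 * iter j phi (F (J - j)%N).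
  under eq_bigr do rewrite iter_phi_linear mulrBr mulrCA.
  rewrite sumrB -mulr_sumr.
  move/eqP: eX; rewrite subr_eq => /eqP eX; move/eqP: ea; rewrite subr_eq => /eqP ea.
  by rewrite /F mulrBr eX ea; ring.
rewrite (DF J) //.
have -> : F J J%:Z = (p%:R * wX - wa) J%:Z.
  apply: (mulfI (pX_neq0 n p_prime 1)); rewrite expr1 -!lcoef_natM e lcoefD.
  rewrite lcoef_sum big_nat big1 ?addr0 // => j /andP[j1 jJ].
  rewrite lcoef_monomM subr0 iter_phi_eq0 ?mulr0 // => i iJ.
  have pj := ltn_expl j p_gt1.
  have iJj : i <= (J - j)%N%:Z by nia.
  by rewrite -DF // DJ //; nia.
have /ZseriesP : p%:R * wX - wa \in Zseries; last exact.
by apply: rpredB => //; apply: rpredM => //; apply: rpred_nat.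
Qed.

(** Strong induction on the exponent J. Let a be [p](x) cut off below x^J, integral by induction.
    The higher terms of the two logarithms agree through x^J, so the J-th coefficient of [p](x) is
    that of p log x - log a, to which [poly_log_integral] applies. *)
Lemma pseries_integral : exists e : laurent A,
  [/\ e \in Zseries, vanishes_below 1 e, lmap (@tofrac A) e = pseries p n &
      poly_log e = p%:R * poly_log X].
Proof.
have [P1 PE] := pseries_log; set P := pseries p n in P1 PE *.
have lmapX : lmap (@tofrac A) X = X.
  by apply: laurent_ext => k /=; case: eqP; rewrite ?rmorph1 ?rmorph0.
have PE' : p%:R * fgl_log p X = lmap (@tofrac A) (p%:R * poly_log X).
  by rewrite rmorphM rmorph_nat /= lmap_poly_log lmapX.
have coefZ (J : nat) : exists c, c \in Zpoly /\ P J%:Z = tofrac c.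
  elim/ltn_ind: J => J IHJ; have [->|J0] := posnP J.
    by exists 0; rewrite rpred0 rmorph0 P1.
  have /choice[c hc] i : exists c, c \in Zpoly /\ ((i < J)%N -> P i%:Z = tofrac c).
    have [/IHJ[c [cZ ec]]|Ji] := ltnP i J; first by exists c.
    by exists 0; rewrite rpred0.
  have a_sub : exists N, vanishes_below N
      (fun k : int => if 0 < k < J%:Z then c `|k|%N else 0).
    by exists 1 => k k1; rewrite ifF //; lia.
  pose a := Laurent a_sub.
  have aZ : a \in Zseries.
    apply/ZseriesP => k /=; case: ifP => _; last exact: rpred0.
    by have [] := hc `|k|%N.
  have a1 : vanishes_below 1 a by move=> k k1; rewrite /= ifF //; lia.
  have la1 : pointed (lmap (@tofrac A) a) by move=> k k1; rewrite -[LHS]/(tofrac (a k)) a1 // rmorph0.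
  have aP : vanishes_below J%:Z (P - lmap (@tofrac A) a).
    move=> k kJ; rewrite lcoefB; have [k0|k0] := lerP k 0.
      by rewrite P1 ?la1 ?subr0 //; lia.
    rewrite /= k0 kJ /=; have [_ <-] := hc `|k|%N; last by lia.
    by rewrite gez0_abs ?subrr // ltW.
  pose D := p%:R * poly_log X - poly_log a.
  have DE k : k < J%:Z + 1 -> tofrac (D k) = P k - tofrac (a k).
    move=> kJ; have : (fgl_log p P - P -
        (fgl_log p (lmap (@tofrac A) a) - lmap (@tofrac A) a)) k = 0.
      exact (logtailB p_gt1 P1 la1 aP kJ).
    rewrite PE PE' -lmap_poly_log.
    rewrite !lcoefB => /eqP; rewrite subr_eq0 => /eqP e.
    rewrite rmorphB.
    have gen (x y z t : K) : x - z = y - t -> x - y = z - t.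
      by move=> h; rewrite -[x](subrK z) h; ring.
    exact: gen e.
  have DJ : vanishes_below J%:Z D.
    move=> k kJ; apply: (@tofrac_inj A); rewrite DE ?rmorph0; last by lia.
    exact: aP.
  exists (D J%:Z); split; first exact: poly_log_integral.
  rewrite DE; last by lia.
  by rewrite [a _]/= ltxx andbF rmorph0 subr0.
have /choice[c hc] := coefZ.
have e_sub : exists N, vanishes_below N
    (fun k : int => if 0 < k then c `|k|%N else 0).
  by exists 1 => k k1; rewrite ifF //; lia.
pose e := Laurent e_sub.
have eP : lmap (@tofrac A) e = P.
  apply: laurent_ext => k /=; case: ifP => k0; last first.
    by rewrite rmorph0 P1 //; lia.
  by have [_ <-] := hc `|k|%N; rewrite gez0_abs // ltW.
exists e; split=> //.
- apply/ZseriesP => k /=; case: ifP => _; last exact: rpred0.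
  by have [] := hc `|k|%N.
- by move=> k k1; rewrite /= ifF //; lia.
- apply: (lmap_inj (@tofrac_inj A)).
  by rewrite lmap_poly_log eP PE PE'.
Qed.

End PSeriesIntegral.
(** * Low coefficients of the p-series *)

Section LowDegree.
Variables (n r : nat).

(* The degree in the first r variables, i.e. in v_1, ..., v_r. *)
Definition low_deg (m : 'X_{1..n}) : nat := (\sum_(i < n | (i < r)%N) m i)%N.

Lemma low_degD m1 m2 : low_deg (m1 + m2)%MM = (low_deg m1 + low_deg m2)%N.
Proof. by rewrite /low_deg -big_split; apply: eq_bigr => i _; rewrite mnmDE. Qed.

Lemma low_degU (i : 'I_n) : low_deg U_(i)%MM = (i < r)%N.
Proof.
rewrite /low_deg; case: ltnP => ir.
  rewrite (bigD1 i) //= mnm1E eqxx big1 // => j /andP[_ ji].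
  by rewrite mnm1E eq_sym (negbTE ji).
rewrite big1 // => j jr; rewrite mnm1E; case: eqP => // ij.
by move: jr; rewrite -ij ltnNge ir.
Qed.

(** The ideal (v_1, ..., v_r) over Q. With p invertible one can divide by p - p^(p^k); integrality
    is put back afterwards by [filtration_low]. *)
Definition low_ideal (f : {mpoly rat[n]}) : Prop :=
  forall m, low_deg m = 0%N -> f@_m = 0.

Lemma low_ideal0 : low_ideal 0.
Proof. by move=> m _; rewrite mcoeff0. Qed.

Lemma low_idealD f g : low_ideal f -> low_ideal g -> low_ideal (f + g).
Proof. by move=> hf hg m m0; rewrite mcoeffD hf ?hg ?addr0. Qed.

Lemma low_idealMl f g : low_ideal g -> low_ideal (f * g).
Proof.
move=> hg m m0; rewrite mcoeffM big1 // => -[k1 k2] /= /eqP e.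
have : low_deg (k1 + k2)%MM = 0%N by rewrite -e.
by rewrite low_degD => /eqP; rewrite addn_eq0 => /andP[_ /eqP /hg ->]; rewrite mulr0.
Qed.

Definition low_mideal : ideal {mpoly rat[n]} :=
  Ideal low_ideal0 low_idealD low_idealMl.

Lemma low_mideal_v p i : (0 < i <= r)%N -> low_mideal (@vpoly p n i).
Proof.
case: i => //= i ir m m0; case: insubP => [k _ ki|_] /=; last by rewrite mcoeff0.
rewrite mcoeffX; case: eqP => // km.
by move: m0; rewrite -km low_degU ki ir.
Qed.

Lemma low_mideal_scale (c : rat) f : c != 0 ->
  low_mideal (c%:MP * f) -> low_mideal f.
Proof.
move=> c0 h m m0; apply: (mulfI c0); rewrite mulr0 -mcoeffCM; exact: h.
Qed.

End LowDegree.

Section PSeriesCoefficients.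
Variables p n : nat.
Hypothesis p_prime : prime p.
Local Notation A := {mpoly rat[n]}.
Local Notation v := (@vpoly p n).
Local Notation X := (lmonom 1 1).

Let p_gt1 : (1 < p)%N := prime_gt1 p_prime.

Variable l : nat -> A.
Hypothesis l0 : l 0%N = 1.
Hypothesis l_rec :
  forall k, p%:R * l k = \sum_(0 <= i < k.+1) l i * v (k - i) ^+ (p ^ i).
Hypothesis l_homog : forall k, mpoly_homog p (vdeg p k)%:Z (l k).

Definition lhomog (d : int) (f : laurent A) : Prop :=
  forall k : int, mpoly_homog p (d + 2 * k) (f k).

Lemma mpoly_homogD d (f g : A) :
  mpoly_homog p d f -> mpoly_homog p d g -> mpoly_homog p d (f + g).
Proof.
move=> hf hg; rewrite -[g]opprK; apply: mpoly_homogB => //.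
by rewrite -[- g]add0r; apply: mpoly_homogB => //; apply: mpoly_homog0.
Qed.

Lemma lhomogM d e f g : lhomog d f -> lhomog e g -> lhomog (d + e) (f * g).
Proof.
move=> hf hg k; apply: (lcoefM_ind (P := mpoly_homog p (d + e + 2 * k))) => [|x y|i].
- exact: mpoly_homog0.
- exact: mpoly_homogD.
have -> : d + e + 2 * k = (d + 2 * i) + (e + 2 * (k - i)) by ring.
exact: mpoly_homogM.
Qed.

Lemma lhomogX d f m : lhomog d f -> lhomog (d * m%:Z) (f ^+ m).
Proof.
move=> hf; elim: m => [|m IHm].
  rewrite mulr0 expr0 -lmonom1 => k; rewrite lcoef_monom.
  by case: eqP => [->|_]; [apply: mpoly_homog1 | apply: mpoly_homog0].
rewrite exprS; have -> : d * m.+1%:Z = d + d * m%:Z by lia.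
exact: lhomogM.
Qed.

Lemma log_term_homog f k (j : int) : lhomog (-2) f ->
  mpoly_homog p (-2 + 2 * j) (l k * (f ^+ (p ^ k)) j).
Proof.
move=> hf; have := mpoly_homogM (@l_homog k) (@lhomogX _ _ (p ^ k) hf j).
congr (mpoly_homog p _ _); rewrite /vdeg.
have : (0 < p ^ k)%N by rewrite expn_gt0 prime_gt0.
by lia.
Qed.

Lemma poly_log_homog f : lhomog (-2) f -> lhomog (-2) (poly_log p l f).
Proof.
move=> hf k /=; case: ifP => _; last exact: mpoly_homog0.
elim/big_ind: _ => [|x y|i _]; [exact: mpoly_homog0|exact: mpoly_homogD|].
exact: log_term_homog.
Qed.

Lemma X_homog : lhomog (-2) X.
Proof.
move=> k; rewrite lcoef_monom.
by case: eqP => [->|_]; [apply: mpoly_homog1 | apply: mpoly_homog0].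
Qed.

Variable e : laurent A.
Hypothesis e1 : vanishes_below 1 e.
Hypothesis e_log : poly_log p l e = p%:R * poly_log p l X.

Lemma poly_log_recl (f : laurent A) (J : nat) : (0 < J)%N ->
  poly_log p l f J%:Z =
    f J%:Z + \sum_(1 <= k < J.+1) l k * (f ^+ (p ^ k)) J%:Z.
Proof.
by move=> J0; rewrite [LHS]/= ifT // big_ltn // l0 mul1r expn0 expr1.
Qed.

Lemma pseries_recl (J : nat) : (0 < J)%N -> e J%:Z =
  p%:R * poly_log p l X J%:Z - \sum_(1 <= k < J.+1) l k * (e ^+ (p ^ k)) J%:Z.
Proof.
by move=> J0; rewrite -lcoef_natM -e_log poly_log_recl // addrK.
Qed.

(** For k > 0 the coefficient of x^J in e^(p^k) involves only coefficients of e below J, so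
    [pseries_recl] is a genuine recursion, and it respects degrees. *)
Lemma pseries_homog : lhomog (-2) e.
Proof.
suff hJ (J : nat) : mpoly_homog p (-2 + 2 * J%:Z) (e J%:Z).
  move=> k; have [k0|k0] := lerP k 0.
    by rewrite e1 ?(le_lt_trans k0) //; apply: mpoly_homog0.
  by rewrite -(gez0_abs (ltW k0)).
elim/ltn_ind: J => J IHJ; have [->|J0] := posnP J.
  by rewrite e1 //; apply: mpoly_homog0.
pose t := ltrunc e J%:Z.
have t1 : vanishes_below 1 t by move=> i i1; rewrite /= e1 // if_same.
have et : vanishes_below J%:Z (e - t) by apply: ltrunc_below.
have ht : lhomog (-2) t.
  move=> k /=; case: ltP => kJ; last exact: mpoly_homog0.
  have [k0|k0] := lerP k 0.
    by rewrite e1 ?(le_lt_trans k0) //; apply: mpoly_homog0.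
  by rewrite -(gez0_abs (ltW k0)); apply: IHJ; lia.
have frac_inj : injective (@tofrac A) by exact: tofrac_inj.
have etX k : (0 < k)%N -> (e ^+ (p ^ k)) J%:Z = (t ^+ (p ^ k)) J%:Z.
  move=> k0; have pk : (1 < p ^ k)%N by rewrite -{1}(expn0 p) ltn_exp2l.
  have P1 (f : laurent A) : vanishes_below 1 f -> pointed (lmap (@tofrac A) f).
    by move=> f1; apply/vanishes_lmap.
  have et' : vanishes_below J%:Z (lmap (@tofrac A) e - lmap (@tofrac A) t).
    by rewrite -rmorphB; apply/vanishes_lmap.
  have := pointed_exprB p_gt1 pk (P1 _ e1) (P1 _ t1) et'.
  rewrite -!rmorphXn -rmorphB => /(vanishes_lmap _ _ frac_inj) /(_ J%:Z).
  by move=> h; apply/eqP; rewrite -subr_eq0 -lcoefB h //; lia.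
rewrite pseries_recl //; apply: mpoly_homogB.
  rewrite [p%:R * _]mulr_natl; suff hm m :
      mpoly_homog p (-2 + 2 * J%:Z) (poly_log p l X J%:Z *+ m) by exact: hm.
  elim: m => [|m IHm].
    exact: mpoly_homog0.
  rewrite [_ *+ m.+1]mulrS; apply: mpoly_homogD; last exact: IHm.
  by apply: poly_log_homog; apply: X_homog.
rewrite big_nat; elim/big_ind: _ => [|x y|k /andP[k0 _]].
- exact: mpoly_homog0.
- exact: mpoly_homogD.
by rewrite etX //; apply: log_term_homog.
Qed.

Variable r : nat.
Local Notation I := (low_mideal n r).

Lemma araki_coef_low k : (0 < k)%N ->
  exists2 c : rat, c != 0 & p%:R - p%:R ^+ (p ^ k) = c%:MP :> A.
Proof.
move=> k0; exists (p%:R - p%:R ^+ (p ^ k)); last first.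
  by rewrite rmorphB rmorphXn /= !rmorph_nat.
rewrite subr_eq0 -natrX eqr_nat neq_ltn -{1}[p]expn1 ltn_exp2l //.
by rewrite -{1}(expn0 p) ltn_exp2l // k0.
Qed.

(** In Araki's relation every term with 0 < i < k contains a positive power of v_(k-i), where k - i
    <= r; only i = 0 and i = k survive. *)
Lemma l_low_head k : (0 < k)%N -> (k <= r.+1)%N ->
  I ((p%:R - p%:R ^+ (p ^ k)) * l k - v k).
Proof.
move=> k0 kr.
have -> : (p%:R - p%:R ^+ (p ^ k)) * l k - v k =
    \sum_(1 <= i < k) l i * v (k - i) ^+ (p ^ i).
  rewrite mulrBl l_rec big_nat_recr //= big_ltn // subnn subn0 l0 mul1r expn0.
  by rewrite expr1 -[v 0]/(p%:R); ring.
rewrite big_nat; apply: ideal_sum => i /andP[i0 ik]; apply: idealMl.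
rewrite -(prednK (_ : 0 < p ^ i)%N) ?expn_gt0 ?prime_gt0 // exprSr.
apply/idealMl/low_mideal_v; lia.
Qed.

Lemma l_low k : (0 < k <= r)%N -> I (l k).
Proof.
move=> /andP[k0 kr]; have [c c0 ec] := araki_coef_low k0.
apply: (low_mideal_scale c0); rewrite -ec.
rewrite -[X in I X](subrK (v k)); apply: idealD.
  by apply: l_low_head => //; apply: leqW.
by apply: low_mideal_v; rewrite k0.
Qed.

(** Terms with k <= r vanish modulo the ideal because l_k does, and those with p^k > J because
    f^(p^k) has too high an order. The only possible survivor is k = r + 1 at J = p^(r+1). *)
Lemma log_tail_low (f : laurent A) (J : nat) : vanishes_below 1 f ->
  (0 < J <= p ^ r.+1)%N ->
  I (\sum_(1 <= k < J.+1) l k * (f ^+ (p ^ k)) J%:Z -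
     (if J == (p ^ r.+1)%N then l r.+1 * f 1 ^+ (p ^ r.+1) else 0)).
Proof.
move=> f1 /andP[J0 Jr].
have small k : (0 < k <= r)%N -> I (l k * (f ^+ (p ^ k)) J%:Z).
  by move=> kr; rewrite mulrC; apply/idealMl/l_low.
have big_eq0 k : (J < p ^ k)%N -> (f ^+ (p ^ k)) J%:Z = 0.
  by move=> Jk; apply: (lexp_below f1); rewrite ltz_nat.
have [eJ|nJ] := eqVneq J (p ^ r.+1)%N; last first.
  rewrite subr0 big_nat; apply: ideal_sum => k /andP[k0 _].
  have [kr|rk] := leqP k r; first by apply: small; rewrite k0.
  rewrite big_eq0 ?mulr0; first exact: ideal0.
  by rewrite (@leq_trans (p ^ r.+1)) ?leq_exp2l // ltn_neqAle nJ.
have rJ : (r.+1 < J.+1)%N by rewrite ltnS eJ ltnW // ltn_expl.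
rewrite (@big_cat_nat _ _ _ r.+1) //=; last exact: ltnW.
rewrite (big_ltn rJ) -addrA [X in _ + X]addrAC.
have -> : (f ^+ (p ^ r.+1)) J%:Z = f 1 ^+ (p ^ r.+1) by rewrite eJ lexp_lead.
rewrite subrr add0r; apply: (idealD (i := I)).
  by rewrite big_nat; apply: ideal_sum => k kr; apply: small.
rewrite big_nat; apply: ideal_sum => k /andP[rk _].
rewrite big_eq0 ?mulr0; first exact: ideal0.
by rewrite eJ ltn_exp2l.
Qed.

Lemma pseries_low (J : nat) : (0 < J <= p ^ r.+1)%N ->
  I (e J%:Z - (if J == 1 then p%:R else if J == (p ^ r.+1)%N then v r.+1 else 0)).
Proof.
elim/ltn_ind: J => J IHJ hJ; have /andP[J0 Jr] := hJ.
have pr1 : (1 < p ^ r.+1)%N by rewrite -{1}(expn0 p) ltn_exp2l.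
have hX := log_tail_low (@X_pointed n) hJ; have he := log_tail_low e1 hJ.
rewrite pseries_recl // poly_log_recl // lcoef_monom.
have [J1|J1] := eqVneq J 1%N.
  rewrite J1 eqxx in hX he *; rewrite !(ltn_eqF pr1) !subr0 in hX he *.
  set a := \sum_(_ <= _ < _) _ in hX; set b := \sum_(_ <= _ < _) _ in he.
  have -> : p%:R * (1 + a) - b - p%:R = p%:R * a - b by ring.
  by apply: idealB => //; apply: idealMl.
have -> : (J%:Z == 1) = false by apply/eqP => -[]; apply/eqP.
set a := \sum_(_ <= _ < _) _ in hX *; set b := \sum_(_ <= _ < _) _ in he *.
have [eJ|nJ] := eqVneq J (p ^ r.+1)%N; last first.
  rewrite (negbTE nJ) !subr0 in hX he; rewrite add0r subr0.
  by apply: idealB => //; apply: idealMl.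
rewrite eJ eqxx in hX he; rewrite lcoef_monom eqxx expr1n mulr1 in hX.
have e1p : I (e 1 - p%:R).
  have := IHJ 1%N; rewrite eJ => /(_ pr1); apply.
  exact: ltnW.
have e1pX m : I (e 1 ^+ m - p%:R ^+ m).
  by rewrite subrXX mulrC; apply: idealMl.
have := l_low_head (ltn0Sn r) (leqnn _).
set L := l r.+1 in hX he *; set q := (p ^ r.+1)%N in hX he *.
move=> hL.
(* Modulo the ideal the coefficient is p L - L p^q, which by [l_low_head] is v_(r+1) itself, with no
   unit factor. *)
have -> : p%:R * (0 + a) - b - v r.+1 = p%:R * (a - L) - (b - L * e 1 ^+ q)
    - L * (e 1 ^+ q - p%:R ^+ q) + ((p%:R - p%:R ^+ q) * L - v r.+1) by ring.
apply: idealD => //; apply: idealB; last exact: idealMl.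
by apply: idealB => //; apply: idealMl.
Qed.

End PSeriesCoefficients.

Lemma pseries_mpoly (p n : nat) : prime p -> exists e : laurent {mpoly rat[n]},
  [/\ lmap (@tofrac _) e = pseries p n, vanishes_below 1 e,
      forall k, e k \in @Zpoly p n,
      forall k, mpoly_homog p (-2 + 2 * k) (e k) &
      forall r J, (0 < J <= p ^ r.+1)%N -> low_mideal n r (e J%:Z -
        (if J == 1 then p%:R else
           if J == (p ^ r.+1)%N then @vpoly p n r.+1 else 0))].
Proof.
move=> p_prime; have [l [l0 lf lr lZ lh]] := araki_log_mpoly n p_prime.
have [e [/ZseriesP eZ e1 eP el]] := pseries_integral p_prime l0 lf lr lZ.
exists e; split=> // [k|r J].
  exact: (pseries_homog p_prime l0 lh e1 el).
exact: (pseries_low p_prime l0 lr e1 el).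
Qed.
(** * The filtration of E(m)_* by powers of (p, v_1, ..., v_r) *)

Fact laurent_nonzero (R : comNzRingType) : (1 : laurent R) != 0.
Proof.
apply/eqP => /(congr1 (fun f : laurent R => f 0)).
by rewrite -lmonom1 lcoef_monom eqxx => /eqP; rewrite oner_eq0.
Qed.
HB.instance Definition _ (R : comNzRingType) :=
  GRing.PzSemiRing_isNonZero.Build (laurent R) (laurent_nonzero R).

Definition lconst (R : comPzRingType) (c : R) : laurent R := lmonom c 0.

Section LConst.
Variable R : comPzRingType.
Fact lconst_is_zmod_morphism : zmod_morphism (@lconst R).
Proof. by move=> c d; apply: laurent_ext => k /=; case: eqP; rewrite ?subr0. Qed.
Fact lconst_is_monoid_morphism : monoid_morphism (@lconst R).
Proof. by split=> // c d; rewrite /lconst lmonomM. Qed.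
HB.instance Definition _ :=
  GRing.isZmodMorphism.Build R (laurent R) (@lconst R) lconst_is_zmod_morphism.
HB.instance Definition _ :=
  GRing.isMonoidMorphism.Build R (laurent R) (@lconst R) lconst_is_monoid_morphism.
End LConst.

Section Localization.
Variables (p m' N : nat).
Hypotheses (p_prime : prime p) (mN : (m' < N)%N).
Local Notation m := m'.+1.
Local Notation A := {mpoly rat[m]}.
Local Notation B := {mpoly rat[N]}.

(** The variable v_m becomes the Laurent variable, which accommodates its inverse. [N] is
    independent of m so that E(n)_* and E(n-1)_* can share one coefficient ring. *)
Definition emb_var (i : 'I_m) : laurent B :=
  if (i < m')%N then lmonom (@vpoly p N i.+1) 0 else lmonom 1 1.

(* Z_(p)[v_1, ..., v_m] inside Z_(p)[v_1, ..., v_(m-1)]((v_m)). *)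
Definition emb_poly : A -> laurent B := mmap (@lconst B \o @mpolyC N rat) emb_var.
HB.instance Definition _ := GRing.RMorphism.on emb_poly.

Definition emb_mnm (e : 'X_{1..m}) : 'X_{1..N} :=
  [multinom (if (i < m')%N then e (inord i) else 0)%N | i < N].

Lemma emb_mnmE e (i : 'I_N) :
  emb_mnm e i = if (i < m')%N then e (inord i) else 0%N.
Proof. by rewrite mnmE. Qed.

Lemma emb_poly_X i : emb_poly 'X_i = emb_var i.
Proof. by rewrite /emb_poly mmapX mmap1U. Qed.

Lemma emb_poly_monomial c (e : 'X_{1..m}) :
  emb_poly (c *: 'X_[e]) = lmonom (c *: 'X_[emb_mnm e]) (e ord_max)%:Z.
Proof.
rewrite /emb_poly mmapZ mmapX /= /mmap1 big_ord_recr /=.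
rewrite {2}/emb_var /= ltnn lmonomX expr1n mul1r /lconst mulrA.
suff -> : \prod_(i < m') emb_var (widen_ord (leqnSn m') i) ^+
    e (widen_ord (leqnSn m') i) = lmonom 'X_[emb_mnm e] 0.
  by rewrite lmonomM lmonomM mulr1 mul_mpolyC !add0r.
pose F i := @vpoly p N i.+1 ^+ e (inord i).
have -> : 'X_[emb_mnm e] = \prod_(i < m') F i.
  rewrite (big_ord_widen _ F (ltnW mN)) mpolyXE_id [RHS]big_mkcond.
  apply: eq_bigr => i _; rewrite emb_mnmE; case: ifP => // im.
  by rewrite /F /= insubT // => iN; congr ('X_ _ ^+ _); apply: val_inj.
rewrite -[RHS]/(lconst _) rmorph_prod; apply: eq_bigr => i _.
rewrite /emb_var /= ltn_ord /F rmorphXn /=; congr (_ ^+ e _).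
by apply: val_inj; rewrite /= inordK // ltnS ltnW.
Qed.

Lemma emb_polyE f :
  emb_poly f = \sum_(e <- msupp f) lmonom (f@_e *: 'X_[emb_mnm e]) (e ord_max)%:Z.
Proof.
rewrite {1}[f]mpolyE raddf_sum; apply: eq_bigr => e _.
exact: emb_poly_monomial.
Qed.

Lemma emb_poly_ind (P : int -> B -> Prop) f :
  (forall j, P j 0) -> (forall j x y, P j x -> P j y -> P j (x + y)) ->
  (forall e, e \in msupp f -> P (e ord_max)%:Z (f@_e *: 'X_[emb_mnm e])) ->
  forall j, P j (emb_poly f j).
Proof.
move=> P0 PD Pe j; rewrite emb_polyE lcoef_sum big_seq.
elim/big_ind: _ => [|x y|e ef]; [exact: P0 | exact: PD |].
rewrite lcoef_monom.
by case: eqP => [->|_]; [apply: Pe | apply: P0].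
Qed.

Lemma emb_mnm_inj (e e' : 'X_{1..m}) :
  e ord_max = e' ord_max -> emb_mnm e = emb_mnm e' -> e = e'.
Proof.
move=> e_last /mnmP e_mnm; apply/mnmP => i.
have [im|mi] := ltnP i m'; last first.
  suff -> : i = ord_max by [].
  by apply: val_inj => /=; have := ltn_ord i; lia.
have := e_mnm (Ordinal (ltn_trans im mN)); rewrite !emb_mnmE /= im.
suff -> : inord i = i :> 'I_m by [].
by apply: val_inj; rewrite /= inordK.
Qed.

Lemma emb_poly_coef f (e : 'X_{1..m}) :
  (emb_poly f (e ord_max)%:Z)@_(emb_mnm e) = f@_e.
Proof.
have term e' : (lmonom (f@_e' *: 'X_[emb_mnm e']) (e' ord_max)%:Z
    (e ord_max)%:Z)@_(emb_mnm e) = if e' == e then f@_e else 0.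
  rewrite lcoef_monom; have [->|ne] := eqVneq e' e.
    by rewrite eqxx mcoeffZ mcoeffX eqxx mulr1.
  case: eqP => [[e_last]|_]; last by rewrite mcoeff0.
  rewrite mcoeffZ mcoeffX; case: eqP => [e_mnm|_]; last by rewrite mulr0.
  by rewrite (emb_mnm_inj (esym e_last) e_mnm) eqxx in ne.
rewrite emb_polyE lcoef_sum raddf_sum /=; under eq_bigr do rewrite term.
have [ef|nef] := boolP (e \in msupp f).
  rewrite (bigD1_seq e) //= eqxx big1 ?addr0 // => e' /negbTE ->.
  by [].
rewrite (memN_msupp_eq0 nef) big1 // => e' _.
by rewrite if_same.
Qed.

Lemma vpoly_last : @vpoly p m m = 'X_ord_max.
Proof.
rewrite /=; case: insubP => [k _ km|] /=; last by rewrite ltnSn.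
by congr 'X_ _; apply: val_inj.
Qed.

Lemma vfrac_neq0 : vfrac p m m != 0.
Proof. by rewrite tofrac_eq0 vpoly_last -msupp_eq0 msuppX. Qed.

Lemma emb_poly_last : emb_poly (@vpoly p m m) = lmonom 1 1.
Proof. by rewrite vpoly_last emb_poly_X /emb_var /= ltnn. Qed.

Lemma emb_poly_v i : (i < m)%N -> emb_poly (@vpoly p m i) = lmonom (@vpoly p N i) 0.
Proof.
case: i => [_|i im]; first by rewrite /= -[RHS]/(lconst _) !rmorph_nat.
rewrite [@vpoly p m _]/=; case: (@insubP _ _ 'I_m) => [k _ ki|]; last first.
  by rewrite ltnS ltnW.
by rewrite [oapp _ _ _]/= emb_poly_X /emb_var ki ifT.
Qed.

Local Notation JW := (JW p m).

Lemma JW_rep (z : JW) : exists k, exists2 f : A,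
  f \in @Zpoly p m & val z * vfrac p m m ^+ k = tofrac f.
Proof. by have /asboolP := valP z. Qed.

Lemma emb_unique (z : {fraction A}) k f k' f' :
  z * vfrac p m m ^+ k = tofrac f -> z * vfrac p m m ^+ k' = tofrac f' ->
  emb_poly f * lmonom 1 (- k%:Z) = emb_poly f' * lmonom 1 (- k'%:Z).
Proof.
move=> ef ef'.
have e : f * @vpoly p m m ^+ k' = f' * @vpoly p m m ^+ k.
  apply: tofrac_inj; rewrite !rmorphM !rmorphXn /= -ef -ef'.
  by rewrite -/(vfrac p m m); ring.
move/(congr1 emb_poly): e; rewrite !rmorphM !rmorphXn /= emb_poly_last !lmonomX.
rewrite !expr1n !mul1r => e.
have -> : lmonom 1 (- k%:Z) = lmonom 1 k'%:Z * lmonom 1 (- k%:Z - k'%:Z) :> laurent B.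
  by rewrite lmonomM mulr1; congr lmonom; ring.
rewrite mulrA e -mulrA lmonomM mulr1; congr (_ * lmonom _ _); ring.
Qed.

(** An element has many representations f / v_m^k; the value is pinned down on all of them, so that
    [embE] applies to whichever is at hand. *)
Lemma emb_exists (z : JW) : exists g : laurent B, forall k f,
  val z * vfrac p m m ^+ k = tofrac f -> g = emb_poly f * lmonom 1 (- k%:Z).
Proof.
have [k [f _ ef]] := JW_rep z; exists (emb_poly f * lmonom 1 (- k%:Z)) => k' f'.
exact: emb_unique.
Qed.

Definition emb (z : JW) : laurent B := projT1 (cid (emb_exists z)).

Lemma embE (z : JW) k f : val z * vfrac p m m ^+ k = tofrac f ->
  emb z = emb_poly f * lmonom 1 (- k%:Z).
Proof. exact: (projT2 (cid (emb_exists z))). Qed.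

Fact emb_is_zmod_morphism : zmod_morphism emb.
Proof.
move=> z w; have [k [f fZ ef]] := JW_rep z; have [l [g gZ eg]] := JW_rep w.
rewrite (@embE _ (k + l) (f * @vpoly p m m ^+ l - g * @vpoly p m m ^+ k)); last first.
  rewrite [RHS]tofracB !tofracM !tofracXn -ef -eg -/(vfrac p m m) exprD.
  by rewrite rmorphB; ring.
rewrite (embE ef) (embE eg) rmorphB !rmorphM !rmorphXn /= emb_poly_last !lmonomX.
rewrite !expr1n !mul1r mulrBl -!mulrA !lmonomM mulr1.
by congr (_ * lmonom _ _ - _ * lmonom _ _); rewrite PoszD; ring.
Qed.

Fact emb_is_monoid_morphism : monoid_morphism emb.
Proof.
split=> [|z w].
  by rewrite (@embE 1 0 1) ?rmorph1 ?mul1r // expr0 mulr1 rmorph1.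
have [k [f fZ ef]] := JW_rep z; have [l [g gZ eg]] := JW_rep w.
rewrite (@embE _ (k + l) (f * g)); last first.
  by rewrite tofracM -ef -eg rmorphM exprD; ring.
rewrite (embE ef) (embE eg) rmorphM mulrACA lmonomM mulr1.
by congr (_ * lmonom _ _); rewrite PoszD; ring.
Qed.
HB.instance Definition _ :=
  GRing.isZmodMorphism.Build JW (laurent B) emb emb_is_zmod_morphism.
HB.instance Definition _ :=
  GRing.isMonoidMorphism.Build JW (laurent B) emb emb_is_monoid_morphism.

Lemma embE0 (z : JW) f : val z = tofrac f -> emb z = emb_poly f.
Proof.
move=> ef; by rewrite (@embE _ 0 f) ?expr0 ?mulr1.
Qed.

Lemma emb_v i : (i < m)%N -> emb (vJW p m i) = lmonom (@vpoly p N i) 0.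
Proof.
by move=> im; rewrite (@embE0 _ (@vpoly p m i)) // emb_poly_v.
Qed.

Fact vpow_subproof (b : int) : vfrac p m m ^ b \in JW_pred p (m := m).
Proof.
apply/asboolP; case: b => k.
  exists 0%N, (@vpoly p m m ^+ k); first by rewrite rpredX // mpolyOver_v.
  by rewrite expr0 mulr1 rmorphXn.
exists k.+1, 1; first exact: rpred1.
by rewrite NegzE -exprnN mulVf ?rmorph1 // expf_neq0 // vfrac_neq0.
Qed.

Definition vpow (b : int) : JW := JWSort (vpow_subproof b).

Lemma emb_vpow b : emb (vpow b) = lmonom 1 b.
Proof.
case: b => k.
  rewrite (@embE0 _ (@vpoly p m m ^+ k)); last by rewrite rmorphXn.
  by rewrite rmorphXn /= emb_poly_last lmonomX expr1n mul1r.
rewrite (@embE _ k.+1 1) ?rmorph1 ?mul1r ?NegzE //=.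
by rewrite -exprnN mulVf ?rmorph1 // expf_neq0 // vfrac_neq0.
Qed.

End Localization.

(** * Powers of (p, v_1, ..., v_r) read off from coefficients *)

Section PDivisible.
Variables (p r : nat).

Definition pdvd (j : nat) (q : rat) : Prop :=
  exists2 u, u \in Zloc_pred p & q = p%:R ^+ j * u.

Lemma pdvd_0 j : pdvd j 0.
Proof. by exists 0; rewrite ?rpred0 ?mulr0. Qed.

Lemma pdvdD j a b : pdvd j a -> pdvd j b -> pdvd j (a + b).
Proof.
by move=> [u uZ ->] [w wZ ->]; exists (u + w); rewrite ?rpredD ?mulrDr.
Qed.

Lemma pdvdN j a : pdvd j a -> pdvd j (- a).
Proof. by move=> [u uZ ->]; exists (- u); rewrite ?rpredN ?mulrN. Qed.

Lemma pdvdM i j a b : pdvd i a -> pdvd j b -> pdvd (i + j) (a * b).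
Proof.
move=> [u uZ ->] [w wZ ->]; exists (u * w); first exact: rpredM.
by rewrite exprD; ring.
Qed.

Lemma pdvdW i j a : (i <= j)%N -> pdvd j a -> pdvd i a.
Proof.
move=> ij [u uZ ->]; exists (p%:R ^+ (j - i) * u).
  by rewrite rpredM // rpredX // rpred_nat.
by rewrite mulrA -exprD subnKC.
Qed.

Section Polynomials.
Variable n : nat.
Implicit Types f g : {mpoly rat[n]}.

(* The K-th power of the ideal (p, v_1, ..., v_r) of Z_(p)[v_1, ..., v_n]. *)
Definition in_filtration (K : nat) f : Prop :=
  forall e, pdvd (K - low_deg r e) f@_e.

Lemma filtration0 K : in_filtration K 0.
Proof. by move=> e; rewrite mcoeff0; apply: pdvd_0. Qed.

Lemma filtrationD K f g :
  in_filtration K f -> in_filtration K g -> in_filtration K (f + g).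
Proof. by move=> hf hg e; rewrite mcoeffD; apply: pdvdD. Qed.

Lemma filtrationN K f : in_filtration K f -> in_filtration K (- f).
Proof. by move=> hf e; rewrite mcoeffN; apply: pdvdN. Qed.

Lemma filtrationW K L f : (L <= K)%N -> in_filtration K f -> in_filtration L f.
Proof. by move=> LK hf e; apply: pdvdW (hf e); apply: leq_sub2r. Qed.

Lemma filtrationM K L f g :
  in_filtration K f -> in_filtration L g -> in_filtration (K + L) (f * g).
Proof.
move=> hf hg e; rewrite mcoeffM; elim/big_ind: _ => [|a b|[k1 k2] /= /eqP ek].
- exact: pdvd_0.
- exact: pdvdD.
apply: pdvdW (pdvdM (hf k1) (hg k2)).
have -> : low_deg r e = low_deg r (k1 + k2)%MM by rewrite -ek.
by rewrite low_degD; lia.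
Qed.

Lemma filtration_monomial K c e : pdvd (K - low_deg r e) c ->
  in_filtration K (c *: 'X_[e]).
Proof.
move=> hc e'; rewrite mcoeffZ mcoeffX; case: eqP => [<-|_].
  by rewrite mulr1.
by rewrite mulr0; apply: pdvd_0.
Qed.

Lemma filtration_Zpoly f : f \in @Zpoly p n -> in_filtration 0 f.
Proof. by move=> /ZpolyP fZ e; exists f@_e; rewrite // sub0n mul1r. Qed.

Lemma filtration_v i : (i <= r)%N -> in_filtration 1 (@vpoly p n i).
Proof.
case: i => [_|i ir] /=.
  rewrite -mpolyC_nat -[_%:MP]mulr1 -mpolyX0 mul_mpolyC.
  apply: filtration_monomial; exists 1; first exact: rpred1.
  by rewrite /low_deg big1 ?subn0 ?expr1 ?mulr1 // => i _; rewrite mnm0E.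
case: insubP => [k _ ki|_] /=; last exact: filtration0.
rewrite -[X in in_filtration _ X]scale1r; apply: filtration_monomial.
by rewrite low_degU ki ir; exists 1; rewrite ?rpred1 ?mulr1.
Qed.

Lemma filtration_low f : f \in @Zpoly p n -> low_ideal r f -> in_filtration 1 f.
Proof.
move=> /ZpolyP fZ fl e; case: (posnP (low_deg r e)) => [/fl ->|e0].
  exact: pdvd_0.
have -> : (1 - low_deg r e = 0)%N by lia.
by exists f@_e; rewrite // expr0 mul1r.
Qed.

(* Multiplying by a variable outside v_1, ..., v_r does not change low_deg. *)
Lemma filtration_divX K f g (i : 'I_n) : (r <= i)%N ->
  (forall e : 'X_{1..n}, e i != 0%N -> f@_e = 0) ->
  in_filtration K (f - 'X_i * g) -> in_filtration K g.
Proof.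
move=> ri fi h e; have := h (U_(i) + e)%MM.
rewrite mcoeffB mulrC mcoeffMX fi; last by rewrite mnmDE mnm1E eqxx.
by rewrite sub0r low_degD low_degU ltnNge ri => /pdvdN; rewrite opprK.
Qed.

End Polynomials.
End PDivisible.

Section JWFiltration.
Variables (p r m' N : nat).
Hypotheses (p_prime : prime p) (mN : (m' < N)%N) (rm : (r <= m')%N).
Local Notation m := m'.+1.
Local Notation A := {mpoly rat[m]}.
Local Notation JW := (JW p m).
Local Notation emb := (@emb p m' N).
Local Notation emb_poly := (@emb_poly p m' N).
Local Notation emb_mnm := (@emb_mnm m' N).
Local Notation v := (vfrac p m m).

Lemma low_deg_emb (e : 'X_{1..m}) : low_deg r (emb_mnm e) = low_deg r e.
Proof.
pose F i := e (inord i); transitivity (\sum_(i < r) F i)%N; rewrite /low_deg.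
  rewrite (big_ord_widen N F); last by rewrite ltnW // (leq_ltn_trans rm).
  by apply: eq_bigr => i ir; rewrite emb_mnmE (leq_trans ir rm).
rewrite (big_ord_widen m F); last by rewrite leqW.
by apply: eq_bigr => i ir; rewrite /F inord_val.
Qed.

Lemma filtration_emb K f :
  in_filtration p r K f <-> forall j, in_filtration p r K (emb_poly f j).
Proof.
split=> [hf|hf e].
  apply: (@emb_poly_ind p m' N mN (fun=> in_filtration p r K)) => [j|j x y|e _].
  - exact: filtration0.
  - exact: filtrationD.
  by apply: filtration_monomial; rewrite low_deg_emb.
by rewrite -(emb_poly_coef p_prime mN) -low_deg_emb; apply: hf.
Qed.

Definition JW_filtration (K : nat) (z : JW) : Prop :=
  forall j, in_filtration p r K (emb z j).

(** Since r < m, the denominator v_m^k only shifts the Laurent variable, so any numerator can be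
    tested. *)
Lemma JW_filtration_rep K z k f : val z * v ^+ k = tofrac f ->
  JW_filtration K z <-> in_filtration p r K f.
Proof.
move=> ef; have ez j : emb z j = emb_poly f (j + k%:Z).
  by rewrite (embE N ef) mulrC lcoef_monomM mul1r opprK.
rewrite filtration_emb; split=> h j; last by rewrite ez.
by rewrite -[j](subrK k%:Z) -ez.
Qed.

Lemma JW_filtration0 K : JW_filtration K 0.
Proof. by move=> j; rewrite rmorph0; apply: filtration0. Qed.

Lemma JW_filtrationD K z w :
  JW_filtration K z -> JW_filtration K w -> JW_filtration K (z + w).
Proof. by move=> hz hw j; rewrite rmorphD; apply: filtrationD. Qed.

Lemma JW_filtrationN K z : JW_filtration K z -> JW_filtration K (- z).
Proof. by move=> hz j; rewrite rmorphN; apply: filtrationN. Qed.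

Lemma JW_filtrationM K L z w :
  JW_filtration K z -> JW_filtration L w -> JW_filtration (K + L) (z * w).
Proof.
move=> hz hw j; rewrite rmorphM.
apply: (lcoefM_ind (P := in_filtration p r (K + L))) => [|x y|i].
- exact: filtration0.
- exact: filtrationD.
- exact: filtrationM.
Qed.

Lemma JW_filtrationW K L z : (L <= K)%N -> JW_filtration K z -> JW_filtration L z.
Proof. by move=> LK hz j; apply: filtrationW (hz j). Qed.

Lemma JW_filtration_all z : JW_filtration 0 z.
Proof.
have [k [f fZ ef]] := JW_rep z.
by apply/(JW_filtration_rep _ ef); apply: filtration_Zpoly.
Qed.

Lemma JW_filtration_v i : (i <= r)%N -> JW_filtration 1 (vJW p m i).
Proof.
move=> ir; apply/(@JW_filtration_rep _ _ 0 (@vpoly p m i)).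
  by rewrite expr0 mulr1.
exact: filtration_v.
Qed.

(** For f with coefficients in Z_(p) the default 0 is never reached. *)
Definition JW_frac (k : nat) (f : A) : JW := insubd 0 (tofrac f / v ^+ k).

Lemma JW_fracE k f : f \in @Zpoly p m -> val (JW_frac k f) * v ^+ k = tofrac f.
Proof.
move=> fZ; have vk : v ^+ k != 0 by rewrite expf_neq0 // vfrac_neq0.
rewrite insubdK ?divfK //; apply/asboolP; exists k, f; first exact: fZ.
by rewrite divfK.
Qed.

Lemma JW_frac_unique k f z : f \in @Zpoly p m ->
  val z * v ^+ k = tofrac f -> z = JW_frac k f.
Proof.
move=> fZ ez; apply: val_inj; apply: (mulIf (expf_neq0 k (vfrac_neq0 p m'))).
by rewrite ez JW_fracE.
Qed.

Lemma JW_frac_sum k (I : eqType) (s : seq I) (F : I -> A) :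
  (forall i, i \in s -> F i \in @Zpoly p m) ->
  JW_frac k (\sum_(i <- s) F i) = \sum_(i <- s) JW_frac k (F i).
Proof.
move=> FZ; symmetry; apply: JW_frac_unique.
  by rewrite big_seq; apply: rpred_sum.
rewrite !rmorph_sum mulr_suml big_seq [RHS]big_seq; apply: eq_bigr => i /FZ hi.
exact: JW_fracE.
Qed.

Lemma JW_frac_v k i f : f \in @Zpoly p m ->
  JW_frac k (@vpoly p m i * f) = vJW p m i * JW_frac k f.
Proof.
move=> fZ; symmetry; apply: JW_frac_unique; first by rewrite rpredM // Zpoly_v.
by rewrite rmorphM /= -mulrA JW_fracE // rmorphM.
Qed.

Lemma JW_frac_homog k f d : f \in @Zpoly p m ->
  mpoly_homog p (d + (k * vdeg p m)%N%:Z) f -> JW_homog d (JW_frac k f).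
Proof. by move=> fZ hf; exists k, f; split=> //; apply: JW_fracE. Qed.

Lemma mpoly_homog_monomial (n : nat) d c (e : 'X_{1..n}) :
  (mnm_deg p e)%:Z = d -> mpoly_homog p d (c *: 'X_[e]).
Proof.
move=> ed e'; have [->|c0] := eqVneq c 0; first by rewrite scale0r msupp0.
by rewrite msuppMCX // inE => /eqP ->.
Qed.

Lemma mnm_deg_emb (e : 'X_{1..m}) :
  ((mnm_deg p (emb_mnm e)) + vdeg p m * e ord_max)%N = mnm_deg p e.
Proof.
rewrite /mnm_deg [RHS]big_ord_recr /=; congr (_ + _)%N.
pose F i := (vdeg p i.+1 * e (inord i))%N.
transitivity (\sum_(i < m') F i)%N.
  rewrite (big_ord_widen _ F (ltnW mN)) [RHS]big_mkcond.
  by apply: eq_bigr => i _; rewrite emb_mnmE /F; case: ifP; rewrite ?muln0.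
apply: eq_bigr => i _; congr (_ * e _)%N; apply: val_inj.
by rewrite /= inordK // ltnS ltnW.
Qed.

Lemma emb_homog d z : JW_homog d z ->
  forall j, mpoly_homog p (d - j * (vdeg p m)%:Z) (emb z j).
Proof.
move=> [k [f [fZ hf ef]]] j.
rewrite (embE N ef) [emb_poly f * _]mulrC lcoef_monomM mul1r opprK.
have h := @emb_poly_ind p m' N mN (fun i => mpoly_homog p
  (d + (k * vdeg p m)%N%:Z - i * (vdeg p m)%:Z)) f.
have := h _ _ _ (j + k%:Z).
have -> : d + (k * vdeg p m)%N%:Z - (j + k%:Z) * (vdeg p m)%:Z =
    d - j * (vdeg p m)%:Z by lia.
apply=> [i|i x y|e ef'].
- exact: mpoly_homog0.
- exact: mpoly_homogD.
apply: mpoly_homog_monomial; rewrite -(hf e ef') -mnm_deg_emb.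
by rewrite PoszD PoszM; ring.
Qed.

End JWFiltration.

(** * Combinations of the v_i with homogeneous coefficients *)

Section Combinations.
Variables (T : comPzRingType) (v : nat -> T) (L : nat) (G : nat -> T -> Prop).
Hypotheses (G0 : forall i, G i 0).
Hypothesis (GD : forall i x y, G i x -> G i y -> G i (x + y)).

(** [G] depends on the index so that the coefficient of v_i can be asked to have degree d - |v_i|.
    Membership in an ideal forgets this, while the iteration in [approx_exp] depends on it. *)
Definition combination (z : T) : Prop :=
  exists2 zs : nat -> T, forall i, G i (zs i) & z = \sum_(i < L) v i * zs i.

Lemma combination0 : combination 0.
Proof. by exists (fun=> 0) => //; rewrite big1 // => i _; rewrite mulr0. Qed.

Lemma combinationD z w : combination z -> combination w -> combination (z + w).
Proof.
move=> [zs hz ->] [ws hw ->]; exists (fun i => zs i + ws i) => [i|]; first exact: GD.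
by rewrite -big_split; apply: eq_bigr => i _; rewrite mulrDr.
Qed.

Lemma combination1 i w : (i < L)%N -> G i w -> combination (v i * w).
Proof.
move=> iL hw; exists (fun j => if j == i then w else 0) => [j|].
  by case: eqP => [->|].
rewrite (bigD1 (Ordinal iL)) //= eqxx big1 ?addr0 // => j ji.
by rewrite ifN ?mulr0.
Qed.

End Combinations.

Section Decompositions.
Variables (p r m' N : nat).
Hypotheses (p_prime : prime p) (mN : (m' < N)%N) (rm : (r <= m')%N).
Local Notation m := m'.+1.
Local Notation A := {mpoly rat[m]}.
Local Notation JW := (JW p m).
Local Notation v := (vfrac p m m).
Local Notation JWF := (@JW_filtration p r m' N).
Local Notation vpow := (@vpow p m').
Local Notation JWfrac := (@JW_frac p m').

Lemma JW_monomial_Zpoly (f : A) e : f \in @Zpoly p m ->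
  f@_e *: 'X_[e] \in @Zpoly p m.
Proof.
by move=> /ZpolyP fZ; apply: mpolyOverZ; [apply: fZ | apply: mpolyOverX].
Qed.

Lemma JW_homog_ind d (P : JW -> Prop) z : P 0 ->
  (forall x y, P x -> P y -> P (x + y)) ->
  JW_homog d z ->
  (forall k f, f \in @Zpoly p m -> val z * v ^+ k = tofrac f ->
    forall e, (mnm_deg p e)%:Z = d + (k * vdeg p m)%N%:Z ->
    P (JWfrac k (f@_e *: 'X_[e]))) ->
  P z.
Proof.
move=> P0 PD [k [f [fZ hf ef]]] Pe.
rewrite (JW_frac_unique fZ ef) [f in JWfrac k f]mpolyE JW_frac_sum; last first.
  by move=> e _; apply: JW_monomial_Zpoly.
rewrite big_seq; elim/big_ind: _ => // e ef'.
by apply: Pe => //; apply: hf.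
Qed.

Lemma JW_frac_monomial_v k d c (e : 'X_{1..m}) (i : 'I_m) :
  c \in Zloc_pred p -> e i != 0%N ->
  (mnm_deg p e)%:Z = d + (k * vdeg p m)%N%:Z ->
  exists2 e', e = (U_(i) + e')%MM &
    JWfrac k (c *: 'X_[e]) = vJW p m i.+1 * JWfrac k (c *: 'X_[e']) /\
    JW_homog (d - (vdeg p i.+1)%:Z) (JWfrac k (c *: 'X_[e'])).
Proof.
move=> cZ ei de; pose e' := (e - U_(i))%MM.
have ee : e = (U_(i) + e')%MM by rewrite addmC submK // lep1mP.
have cXZ (e1 : 'X_{1..m}) : c *: 'X_[e1] \in @Zpoly p m.
  by apply: mpolyOverZ => //; apply: mpolyOverX.
exists e' => //; split.
  rewrite -JW_frac_v // {1}ee mpolyXD -scalerAr; congr (JWfrac k (_ *: (_ * _))).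
  rewrite /=; case: insubP => [j _ ji|]; last by rewrite ltn_ord.
  by congr 'X_ _; apply: val_inj.
apply: JW_frac_homog => //; apply: mpoly_homog_monomial.
have : mnm_deg p e = (vdeg p i.+1 + mnm_deg p e')%N.
  rewrite {1}ee /mnm_deg.
  under eq_bigr do rewrite mnmDE mulnDr.
  rewrite big_split /= (bigD1 i) //= mnm1E eqxx muln1 big1 ?addn0 // => j ji.
  by rewrite mnm1E eq_sym (negbTE ji) muln0.
by move=> h; rewrite h in de; lia.
Qed.

Lemma JW_frac_p k (u : rat) (e : 'X_{1..m}) : u \in Zloc_pred p ->
  JWfrac k ((p%:R * u) *: 'X_[e]) = vJW p m 0 * JWfrac k (u *: 'X_[e]).
Proof.
move=> uZ; rewrite -JW_frac_v; last by apply: mpolyOverZ => //; apply: mpolyOverX.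
by rewrite /= -mpolyC_nat mul_mpolyC scalerA.
Qed.

Lemma JW_frac_monomial_homog k d c (e : 'X_{1..m}) : c \in Zloc_pred p ->
  (mnm_deg p e)%:Z = d + (k * vdeg p m)%N%:Z -> JW_homog d (JWfrac k (c *: 'X_[e])).
Proof.
move=> cZ de; apply: JW_frac_homog; last exact: mpoly_homog_monomial.
by apply: mpolyOverZ => //; apply: mpolyOverX.
Qed.

(** Monomial by monomial: a factor v_i with 1 <= i <= r is split off if there is one, which lowers
    [low_deg] by one. Otherwise [low_deg] is 0, the coefficient is divisible by p^(K+1), and v_0 = p
    is split off. *)
Lemma JW_decomposition K d z : JW_homog d z -> JWF K.+1 z ->
  combination (vJW p m) r.+1
    (fun i w => JW_homog (d - (vdeg p i)%:Z) w /\ JWF K w) z.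
Proof.
move=> hz Fz.
pose G (i : nat) (w : JW) := JW_homog (d - (vdeg p i)%:Z) w /\ JWF K w.
change (combination (vJW p m) r.+1 G z).
have G0 i : G i 0 by split; [apply: JW_homog0 | apply: JW_filtration0].
have GD i x y : G i x -> G i y -> G i (x + y).
  move=> [? ?] [? ?]; split; last exact: JW_filtrationD.
  exact: (homogD (H := JW_grading p m)).
apply: (@JW_homog_ind d (combination (vJW p m) r.+1 G) z) => //.
- exact: combination0.
- exact: combinationD.
move=> k f fZ ef e de.
have /(JW_filtration_rep p_prime mN rm _ ef) /(_ e) Ff := Fz.
have /ZpolyP fZ' := fZ.
have filt e1 c : pdvd p (K - low_deg r e1) c -> JWF K (JWfrac k (c *: 'X_[e1])).
  move=> hc; have cZ : c \in Zloc_pred p.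
    by case: hc => u uZ ->; rewrite rpredM // rpredX // rpred_nat.
  apply/(JW_filtration_rep p_prime mN rm); first apply: JW_fracE.
    by apply: mpolyOverZ => //; apply: mpolyOverX.
  exact: filtration_monomial.
have [/existsP[i /andP[ir ei]]|none] :=
    boolP [exists i : 'I_m, (i < r)%N && (e i != 0%N)].
  have [e' ee [-> he']] := JW_frac_monomial_v (fZ' e) ei de.
  apply: combination1 => //; split=> //; apply: filt.
  by move: Ff; rewrite {1}ee low_degD low_degU ir; apply: pdvdW; lia.
have e0 : low_deg r e = 0%N.
  rewrite /low_deg big1 // => i ir; apply/eqP; apply: contraNT none => ei.
  by apply/existsP; exists i; rewrite ir.
move: Ff; rewrite e0 subn0 => -[u uZ fe].
have fe' : f@_e = p%:R * (p%:R ^+ K * u) by rewrite fe exprS mulrA.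
have uZ' : p%:R ^+ K * u \in Zloc_pred p by rewrite rpredM // rpredX // rpred_nat.
rewrite fe' JW_frac_p //; apply: combination1 => //; split.
  by rewrite /vdeg expn0 subnn muln0 subr0; apply: JW_frac_monomial_homog.
by apply: filt; rewrite e0 subn0; exists u.
Qed.

(** Modulo p, v_1, ..., v_(m-1) the ring E(m)_* becomes F_p[v_m, v_m^-1], whose part of degree d is
    zero or spanned by one power of v_m; c is an integer lift of the residue. *)
Lemma JW_residue d z : JW_homog d z -> exists c : int,
  ((c != 0) -> (vdeg p m %| d)%Z) /\
  combination (vJW p m) m (fun i w => JW_homog (d - (vdeg p i)%:Z) w)
    (z - c%:~R * vpow (d %/ vdeg p m)%Z).
Proof.
move=> hz; pose G (i : nat) (w : JW) := JW_homog (d - (vdeg p i)%:Z) w.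
pose b := (d %/ vdeg p m)%Z.
have G0 i : G i 0 by apply: JW_homog0.
have GD i x y : G i x -> G i y -> G i (x + y).
  exact: (homogD (H := JW_grading p m)).
have deg_gt0 : (0 < vdeg p m)%N.
  have : (1 < p ^ m)%N by rewrite -{1}(expn0 p) ltn_exp2l // prime_gt1.
  by rewrite /vdeg; lia.
pose P w := exists c : int, ((c != 0) -> (vdeg p m %| d)%Z) /\
  combination (vJW p m) m G (w - c%:~R * vpow b).
apply: (@JW_homog_ind d P z) => // [|x y|k f /ZpolyP fZ ef e de].
- by exists 0; split=> //; rewrite mul0r subr0; apply: combination0.
- move=> [c [hc cx]] [c' [hc' cy]]; exists (c + c'); split.
    move=> cc; have [c0|] := eqVneq c 0; last exact: hc.
    by apply: hc'; rewrite c0 add0r in cc.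
  have -> : x + y - (c + c')%:~R * vpow b =
      (x - c%:~R * vpow b) + (y - c'%:~R * vpow b) by rewrite rmorphD; ring.
  exact: combinationD.
have [/existsP[i /andP[im ei]]|none] :=
    boolP [exists i : 'I_m, (i < m')%N && (e i != 0%N)].
  have [e' ee [-> he']] := JW_frac_monomial_v (fZ e) ei de.
  exists 0; split=> //; rewrite mul0r subr0.
  by apply: (@combination1 _ (vJW p m) m G G0 i.+1).
have eE : e = (U_(ord_max) *+ e ord_max)%MM.
  apply/mnmP => i; rewrite mulmnE mnm1E; case: eqP => [<-|/eqP ni].
    by rewrite mul1n.
  rewrite mul0n; apply/eqP; apply: contraNT none => ei; apply/existsP; exists i.
  rewrite ei andbT ltn_neqAle -ltnS ltn_ord andbT.
  by apply: contra ni => /eqP h; apply/eqP/val_inj.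
have [c [u uZ fe]] := Zloc_modp p_prime (fZ e).
have degE : (mnm_deg p e)%:Z = (vdeg p m)%:Z * (e ord_max)%:Z.
  rewrite /mnm_deg big_ord_recr /= big1 => [|i _]; first by rewrite add0n PoszM.
  rewrite {1}eE mulmnE mnm1E; case: eqP => [h|]; last by rewrite muln0.
  by have := ltn_ord i; move/(congr1 val): h => /= h; lia.
have dE : d = ((e ord_max)%:Z - k%:Z) * (vdeg p m)%:Z.
  by have := de; rewrite degE PoszM; lia.
have bE : b = (e ord_max)%:Z - k%:Z by rewrite /b dE mulzK // lt0n_neq0.
exists c; split; first by move=> _; rewrite dE dvdz_mull.
have -> : JWfrac k (f@_e *: 'X_[e]) =
    c%:~R * vpow b + vJW p m 0 * JWfrac k (u *: 'X_[e]).
  have uXZ : u *: 'X_[e] \in @Zpoly p m.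
    by apply: mpolyOverZ => //; apply: mpolyOverX.
  have cXZ : c%:~R *: 'X_[e] \in @Zpoly p m.
    by apply: mpolyOverZ; [apply: rpred_int | apply: mpolyOverX].
  rewrite -JW_frac_p //; symmetry; apply: JW_frac_unique.
    by apply: mpolyOverZ; [apply: fZ | apply: mpolyOverX].
  rewrite rmorphD mulrDl JW_fracE; last first.
    by apply: mpolyOverZ; [rewrite rpredM // rpred_nat | apply: mpolyOverX].
  have -> : f@_e = c%:~R + p%:R * u.
    by move/eqP: fe; rewrite subr_eq addrC expr1 => /eqP.
  rewrite scalerDl rmorphD; congr (_ + _).
  rewrite rmorphM rmorph_int /= -mulrA bE -[v ^+ k]/(v ^ k%:Z) -expfzDr ?vfrac_neq0 //.
  rewrite subrK -mul_mpolyC rmorphM [e in 'X_[e]]eE -mpolyXn -(vpoly_last p) rmorphXn.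
  by congr (_ * _); rewrite !rmorph_int.
rewrite addrAC subrr add0r; apply: combination1 => //.
by rewrite /G /vdeg expn0 subnn muln0 subr0; apply: JW_frac_monomial_homog.
Qed.

End Decompositions.
(** * The filtration of E(m)_*((x)) *)

Section LaurentFiltration.
Variables (p r m' N : nat).
Hypotheses (p_prime : prime p) (mN : (m' < N)%N) (rm : (r <= m')%N).
Local Notation m := m'.+1.
Local Notation JWL := (JW_laurent p m).
Local Notation JWF := (@JW_filtration p r m' N).
Implicit Types F G : JWL.

Definition series_of F : laurent (JW p m) := val F.

Lemma series_ofM F G : series_of (F * G) = series_of F * series_of G.
Proof. exact: rmorphM. Qed.
Lemma series_ofB F G : series_of (F - G) = series_of F - series_of G.
Proof. exact: rmorphB. Qed.
Lemma series_ofD F G : series_of (F + G) = series_of F + series_of G.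
Proof. exact: rmorphD. Qed.
Lemma series_of0 : series_of 0 = 0.
Proof. exact: rmorph0. Qed.

Lemma series_of_inj : injective series_of.
Proof. exact: val_inj. Qed.

Lemma series_of_sum (I : Type) (s : seq I) (P : pred I) (F : I -> JWL) :
  series_of (\sum_(i <- s | P i) F i) = \sum_(i <- s | P i) series_of (F i).
Proof. exact: rmorph_sum. Qed.

Lemma homog_series d (f : laurent (JW p m)) : laurent_homog d f ->
  exists2 F : JWL, series_of F = f & of_degree (gr JWL) d F.
Proof.
move=> hf; have fP : f \in gpart_pred (laurent_grading (JW p m)).
  by apply/asboolP; apply: (@homog_sum_homog _ (laurent_grading (JW p m)) d).
by exists (GpartSort fP).
Qed.

Lemma series_of_vM i F k :
  series_of (v_laurent p m i * F) k = vJW p m i * series_of F k.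
Proof. by rewrite series_ofM [X in X * _]/(lmonom _ 0) lcoef_monomM subr0. Qed.

Definition series_filtration (K : nat) F : Prop :=
  forall k, JWF K (series_of F k).

Lemma series_filtration0 K : series_filtration K 0.
Proof. by move=> k; rewrite series_of0; apply: JW_filtration0. Qed.

Lemma series_filtrationD K F G :
  series_filtration K F -> series_filtration K G -> series_filtration K (F + G).
Proof. by move=> hF hG k; rewrite series_ofD; apply: JW_filtrationD. Qed.

Lemma series_filtrationM K L F G : series_filtration K F ->
  series_filtration L G -> series_filtration (K + L) (F * G).
Proof.
move=> hF hG k; rewrite series_ofM.
apply: (lcoefM_ind (P := JWF (K + L))) => [|x y|i].
- exact: JW_filtration0.
- exact: JW_filtrationD.
- exact: JW_filtrationM.
Qed.

Lemma series_filtration_all F : series_filtration 0 F.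
Proof. by move=> k; apply: JW_filtration_all. Qed.

Lemma series_filtrationMl K F G :
  series_filtration K G -> series_filtration K (F * G).
Proof. exact: (series_filtrationM (series_filtration_all F)). Qed.

Definition series_ideal K : ideal JWL :=
  Ideal (series_filtration0 K) (@series_filtrationD K) (@series_filtrationMl K).

Lemma v_ideal_filtration K F :
  ideal_exp (v_ideal (v_laurent p m) r.+1) K F -> series_filtration K F.
Proof.
have v_filt G : v_ideal (v_laurent p m) r.+1 G -> series_filtration 1 G.
  apply: (ideal_gen_min (I := series_ideal 1)) => _ [i ir ->] k.
  rewrite -[v_laurent p m i]mulr1 series_of_vM -[1%N]addn0.
  apply: JW_filtrationM; last exact: JW_filtration_all.
  exact: JW_filtration_v.
elim: K F => [|K IHK] F; first by move=> _; apply: series_filtration_all.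
apply: (ideal_gen_min (I := series_ideal K.+1)) => _ [a [b [ha hb ->]]].
exact: (@series_filtrationM 1 K _ _ (v_filt _ ha) (IHK _ hb)).
Qed.

Lemma laurent_homog_sum d (I : Type) (s : seq I) (P : pred I) (F : I -> JWL) :
  (forall i, P i -> of_degree (gr JWL) d (F i)) ->
  of_degree (gr JWL) d (\sum_(i <- s | P i) F i).
Proof.
move=> hF; elim/big_ind: _ => //; first exact: homog0.
by move=> x y; apply: homogD.
Qed.

(** Combinations chosen separately for each power of x are assembled into series. Cutting them at
    the order of F keeps them Laurent, and homogeneity places them in the ring of finite sums of
    homogeneous series. *)
Lemma series_combination d F (L : nat) (G : nat -> int -> JW p m -> Prop) :
  (forall i k z, G i k z -> JW_homog (d - (vdeg p i)%:Z + 2 * k) z) ->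
  (forall i k, G i k 0) ->
  (forall k, combination (vJW p m) L (fun i => G i k) (series_of F k)) ->
  combination (v_laurent p m) L (fun i H =>
    of_degree (gr JWL) (d - (vdeg p i)%:Z) H /\ forall k, G i k (series_of H k)) F.
Proof.
move=> Ghomog G0 hF.
have /choice[zs hzs] k : exists zs : nat -> JW p m,
    (forall i, G i k (zs i)) /\ series_of F k = \sum_(i < L) vJW p m i * zs i.
  by have [zs h1 h2] := hF k; exists zs.
have [M hM] := laurentP (series_of F).
have fs_sub i : exists M', @vanishes_below (JW p m) M' (fun k => if k < M then 0 else zs k i).
  by exists M => k ->.
pose fs i := @Laurent (JW p m) (fun k => if k < M then 0 else zs k i) (fs_sub i).
have Gfs i k : G i k (fs i k).
  by rewrite /=; case: ifP => // _; have [] := hzs k.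
have /choice[Hs hHs] i : exists H : JWL,
    series_of H = fs i /\ of_degree (gr JWL) (d - (vdeg p i)%:Z) H.
  have [|H eH hH] := @homog_series (d - (vdeg p i)%:Z) (fs i); last by exists H.
  by move=> k; apply: Ghomog (Gfs i k).
exists Hs => [i|].
  by have [e h] := hHs i; split=> // k; rewrite e.
apply: series_of_inj; apply: laurent_ext => k.
rewrite series_of_sum lcoef_sum.
under eq_bigr => i _ do rewrite series_of_vM (hHs i).1.
rewrite /=; case: ltP => kM; last by have [] := hzs k.
by rewrite hM // big1 // => i _; rewrite mulr0.
Qed.

Lemma homog_filtration_ideal K d F : of_degree (gr JWL) d F ->
  series_filtration K F -> ideal_exp (v_ideal (v_laurent p m) r.+1) K F.
Proof.
elim: K d F => [|K IHK] d F hF FF; first exact: ideal_exp0.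
pose G (i : nat) (k : int) (z : JW p m) :=
  JW_homog (d - (vdeg p i)%:Z + 2 * k) z /\ JWF K z.
have [||k|Hs hHs ->] := @series_combination d F r.+1 G.
- by move=> i k z [].
- by move=> i k; split; [apply: JW_homog0 | apply: JW_filtration0].
- have [zs hz ez] := JW_decomposition p_prime mN rm (hF k) (FF k).
  exists zs => // i; have [h1 h2] := hz i; split=> //.
  by have -> : d - (vdeg p i)%:Z + 2 * k = d + 2 * k - (vdeg p i)%:Z by ring.
apply: ideal_sum => i _; apply: ideal_expM.
  by apply: mem_ideal_gen; exists i.
have [h1 h2] := hHs i; apply: IHK h1 _ => k.
by have [] := h2 k.
Qed.

(** Reduces to homogeneous series. A monomial in x and the v_i has one degree, so each coefficient
    of F comes from a single homogeneous component, and the components inherit the filtration. The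
    summands are grouped by degree first because a decomposition may repeat degrees. *)
Lemma filtration_v_ideal K F : series_filtration K F ->
  ideal_exp (v_ideal (v_laurent p m) r.+1) K F.
Proof.
move=> FF; have [s hs eF] := gspan F.
have /choice[dg hdg] y : exists d, y \in s -> of_degree (gr JWL) d y.
  by have [/hs[d hd]|_] := boolP (y \in s); [exists d | exists 0].
pose D := undup (map dg s); pose C d := \sum_(y <- s | (y \in s) && (dg y == d)) y.
have eC : F = \sum_(d <- D) C d.
  rewrite eF /C (exchange_big_dep (fun y => y \in s)) /= => [|d y _ /andP[] //].
  rewrite big_seq; apply: eq_bigr => y ys; rewrite -big_filter.
  have -> : [seq d <- D | (y \in s) && (dg y == d)] = [:: dg y].
    rewrite -(@filter_pred1_uniq _ D) ?undup_uniq ?mem_undup ?map_f //.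
    by apply: eq_filter => d /=; rewrite ys eq_sym.
  by rewrite big_seq1.
have hC d : of_degree (gr JWL) d (C d).
  by apply: laurent_homog_sum => y /andP[ys /eqP <-]; apply: hdg.
rewrite {1}eC big_seq; apply: ideal_sum => d0 d0D.
apply: homog_filtration_ideal (hC d0) _ => k j e.
pose c d := (emb N (series_of (C d) k) j)@_e.
have c0 d : (mnm_deg p e)%:Z != d + 2 * k - j * (vdeg p m)%:Z -> c d = 0.
  move=> /eqP ne; apply: memN_msupp_eq0; apply/negP => he; apply: ne.
  exact: (emb_homog p_prime mN rm (hC d k) he).
have [ed|] := eqVneq (mnm_deg p e)%:Z (d0 + 2 * k - j * (vdeg p m)%:Z); last first.
  by move=> /c0; rewrite /c => ->; apply: pdvd_0.
have := FF k j e; rewrite {1}eC series_of_sum lcoef_sum rmorph_sum lcoef_sum.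
rewrite raddf_sum /= (bigD1_seq d0) ?undup_uniq //= big1 ?addr0 // => d dd0.
by apply: c0; rewrite ed; apply: contra dd0 => /eqP h; apply/eqP; lia.
Qed.

End LaurentFiltration.
(** * Powers of ideals *)

Section IterateApproximation.
Variables (A B : gring) (I : ideal A) (rho : A -> B -> Prop).
Variables (v : nat -> A) (u : nat -> B) (L : nat) (dv : nat -> int).
Hypothesis rho1 : rho 1 1.
Hypothesis rhoB :
  forall a b a' b', rho a b -> rho a' b' -> rho (a - a') (b - b').
Hypothesis rhoM :
  forall a b a' b', rho a b -> rho a' b' -> rho (a * a') (b * b').
Hypothesis vI : forall i, (i < L)%N -> I (v i).
Hypothesis rho_vu : forall i, (i < L)%N -> rho (v i) (u i).
Hypothesis u_homog : forall i, (i < L)%N -> of_degree (gr B) (dv i) (u i).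
Hypothesis approx1 : forall d a, of_degree (gr A) d a -> exists a' b',
  [/\ rho a' b', of_degree (gr B) d b' &
      combination v L (fun i w => of_degree (gr A) (d - dv i) w) (a - a')].

(** One step leaves an error sum v_i z_i with z_i homogeneous. Approximating each z_i modulo I^k and
    multiplying by v_i in I gains one power. *)
Lemma approx_exp k d a : of_degree (gr A) d a -> exists a' b',
  [/\ rho a' b', of_degree (gr B) d b' & ideal_exp I k (a - a')].
Proof.
have rhoD x y x' y' : rho x y -> rho x' y' -> rho (x + x') (y + y').
  move=> h h'; rewrite -[x']opprK -[y']opprK; apply: rhoB => //.
  rewrite -[- x']sub0r -[- y']sub0r; apply: rhoB => //.
  by have := rhoB rho1 rho1; rewrite !subrr.
have rho0 : rho 0 0 by have := rhoB rho1 rho1; rewrite !subrr.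
elim: k d a => [|k IHk] d a ha; have [a0 [b0 [h0 hb0 [zs hz ez]]]] := approx1 ha.
  by exists a0, b0; split=> //; apply: ideal_exp0.
have /choice[w hw] i : exists w : A * B, [/\ rho w.1 w.2,
    of_degree (gr B) (d - dv i) w.2 & ideal_exp I k (zs i - w.1)].
  by have [a' [b' [? ? ?]]] := IHk _ _ (hz i); exists (a', b').
exists (a0 + \sum_(i < L) v i * (w i).1), (b0 + \sum_(i < L) u i * (w i).2); split.
- apply: (rhoD _ _ _ _ h0); apply: (big_ind2 rho) => // i _.
  by apply: rhoM; [apply: rho_vu | have [] := hw i].
- apply: homogD => //; elim/big_ind: _ => [|x y|i _]; [exact: homog0 | exact: homogD |].
  have -> : d = dv i + (d - dv i) by ring.
  by apply: homogM; [apply: u_homog | have [] := hw i].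
rewrite opprD addrA ez -sumrB; apply: ideal_sum => i _; rewrite -mulrBr.
by apply: ideal_expM; [apply: vI | have [] := hw i].
Qed.

End IterateApproximation.

Section IdealImage.
Variables (A B : comPzRingType) (f : {rmorphism A -> B}) (v : nat -> A) (k : nat).
Local Notation I := (v_ideal v k).
Local Notation J := (v_ideal (f \o v) k).

Lemma v_ideal_image x : I x -> J (f x).
Proof.
move=> [s hs ->]; rewrite rmorph_sum big_seq; apply: ideal_sum => u us.
rewrite rmorphM; apply: idealMl; apply: mem_ideal_gen.
by have [i ik ->] := hs u us; exists i.
Qed.

Lemma ideal_exp_image l x : ideal_exp I l x -> ideal_exp J l (f x).
Proof.
elim: l x => [|l IHl] x; first by move=> _; apply: ideal_exp0.
move=> [s hs ->]; rewrite rmorph_sum big_seq; apply: ideal_sum => u us.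
rewrite rmorphM; apply: idealMl; have [a [b [ha hb ->]]] := hs u us.
by rewrite rmorphM; apply: ideal_expM; [apply: v_ideal_image | apply: IHl].
Qed.

Hypothesis f_surj : forall y, exists x, y = f x.

Lemma v_ideal_lift y : J y -> exists2 x, I x & y = f x.
Proof.
move=> [s hs ->].
elim: s hs => [|u s IHs] hs.
  by exists 0; [apply: ideal0 | rewrite big_nil rmorph0].
have [|x Ix ex] := IHs; first by move=> w ws; apply: hs; rewrite inE ws orbT.
have [i ik eu] := hs u (mem_head _ _); have [c ec] := f_surj u.1.
exists (c * v i + x); last by rewrite big_cons rmorphD rmorphM ex ec eu.
by apply: idealD => //; apply/idealMl/mem_ideal_gen; exists i.
Qed.

(** Moves membership from the quotient by [p](x) up to E(n)_*((x)), where the filtration by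
    coefficients is available. *)
Lemma ideal_exp_lift l y : ideal_exp J l y -> exists2 x, ideal_exp I l x & y = f x.
Proof.
elim: l y => [|l IHl] y.
  by move=> _; have [x ->] := f_surj y; exists x => //; apply: ideal_exp0.
move=> [s hs ->].
elim: s hs => [|u s IHs] hs.
  by exists 0; [apply: ideal0 | rewrite big_nil rmorph0].
have [|x Ix ex] := IHs; first by move=> w ws; apply: hs; rewrite inE ws orbT.
have [a [b [/v_ideal_lift[a' Ia ea] /IHl[b' Ib eb] eu]]] := hs u (mem_head _ _).
have [c ec] := f_surj u.1.
exists (c * (a' * b') + x); last by rewrite big_cons !(rmorphD, rmorphM) ex ec eu ea eb.
by apply: idealD => //; apply: idealMl; apply: ideal_expM.
Qed.

End IdealImage.
(** * Exchanging v_n and v_(n-1) *)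

Lemma lsubst_mulE (R S : comPzRingType) (phi : {rmorphism R -> S}) (c : int -> S)
    (beta : nat) (beta_gt0 : (0 < beta)%N) (f : laurent R) (g : laurent S) k
    (s : seq int) : uniq s ->
  (forall i, i \notin s -> f i = 0 \/ g (k - i * beta%:Z) = 0) ->
  (lsubst phi c beta_gt0 f * g) k =
    \sum_(i <- s) phi (f i) * c i * g (k - i * beta%:Z).
Proof.
move=> us hs; have beta0 : beta%:Z != 0 by rewrite lt0n_neq0.
rewrite (@lcoefM_seq _ _ _ _ [seq i * beta%:Z | i <- s]).
- by rewrite big_map; apply: eq_bigr => i _; rewrite lsubstE.
- by rewrite map_inj_uniq // => i j; apply: mulIf.
move=> j; have [/dvdzP[i ->]|nj] := boolP (beta %| j)%Z; last first.
  by rewrite lsubst_ndvd ?mul0r.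
move=> nj; have /hs[|->] : i \notin s; last by rewrite mulr0.
  by apply: contra nj => /(map_f (fun i => i * beta%:Z)).
by move=> fi; rewrite lsubstE fi rmorph0 !mul0r.
Qed.

Section Twist.
Variables p r : nat.
Hypothesis p_prime : prime p.
Local Notation TA := (JW_laurent p r.+2).
Local Notation TB := (JW_laurent p r.+1).

Fact pred_pX_gt0 m' : (0 < p ^ m'.+1 - 1)%N.
Proof. by rewrite subn_gt0 -{1}(expn0 p) ltn_exp2l // prime_gt1. Qed.

(* Substitutes v_m x^(p^m - 1) for the variable. *)
Definition unit_subst m' : laurent int -> laurent (JW p m'.+1) :=
  lsubst (intmul 1 : {rmorphism int -> JW p m'.+1}) (vpow p m') (pred_pX_gt0 m').

Lemma unit_subst_mulE m' (f : laurent int) (g : laurent (JW p m'.+1)) k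
    (s : seq int) : uniq s ->
  (forall i, i \notin s -> f i = 0 \/ g (k - i * (p ^ m'.+1 - 1)%N%:Z) = 0) ->
  (unit_subst m' f * g) k =
    \sum_(i <- s) (f i)%:~R * vpow p m' i * g (k - i * (p ^ m'.+1 - 1)%N%:Z).
Proof. exact: lsubst_mulE. Qed.

Lemma emb_vpow_term m' N (z t j : int) (w : JW p m'.+1) :
  emb N (z%:~R * vpow p m' t * w) j = z%:~R * emb N w (j - t).
Proof.
have zE : z%:~R = lmonom z%:~R 0 :> laurent {mpoly rat[N]}.
  by rewrite -[RHS]/(lconst _) rmorph_int.
have -> : emb N (z%:~R * vpow p m' t * w) = z%:~R * lmonom 1 t * emb N w.
  by rewrite !rmorphM rmorph_int /= emb_vpow.
by rewrite zE lmonomM add0r mulr1 lcoef_monomM.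
Qed.

Lemma emb_v_term m' N i (j : int) (w : JW p m'.+1) : (i < m'.+1)%N ->
  emb N (vJW p m'.+1 i * w) j = @vpoly p N i * emb N w j.
Proof.
move=> im.
have -> : emb N (vJW p m'.+1 i * w) = lmonom (@vpoly p N i) 0 * emb N w.
  by rewrite rmorphM /= emb_v.
by rewrite lcoef_monomM subr0.
Qed.

Lemma emb_sub_term m' N (j : int) (z w : JW p m'.+1) :
  emb N (z - w) j = emb N z j - emb N w j.
Proof. by rewrite rmorphB lcoefB. Qed.

(** With n = r + 2, the subring of the product generated by the pairs (c(w_n), c(w_(n-1))), (v_i,
    v_i) and (x^k, x^k): the graph of the future isomorphism on the part where it is defined before
    completion. Integer coefficients suffice for c, as p is one of the generators of the ideal. *)
Inductive twist_rel : TA -> TB -> Prop :=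
| twist_unit c a b : series_of a = unit_subst r.+1 c ->
    series_of b = unit_subst r c -> twist_rel a b
| twist_v i : (i <= r)%N -> twist_rel (v_laurent p r.+2 i) (v_laurent p r.+1 i)
| twist_x k a b : series_of a = lmonom 1 k -> series_of b = lmonom 1 k ->
    twist_rel a b
| twist_sub a b a' b' : twist_rel a b -> twist_rel a' b' ->
    twist_rel (a - a') (b - b')
| twist_mul a b a' b' : twist_rel a b -> twist_rel a' b' ->
    twist_rel (a * a') (b * b').

Local Notation embA := (@emb p r.+1 r.+2).
Local Notation embB := (@emb p r r.+2).
Local Notation alpha := (p ^ r.+1 - 1)%N.
Local Notation beta := (p ^ r.+2 - 1)%N.

(* Equality of the coefficients of x^i w^j, where w = v_n x^beta on one side and
   w = v_(n-1) x^alpha on the other. *)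
Definition same_coefs (a : TA) (b : TB) : Prop := forall i j : int,
  embA (series_of a (i + j * beta%:Z)) j = embB (series_of b (i + j * alpha%:Z)) j.

(** Multiplying by w^t shifts j by t and leaves i alone on both sides, although the exponent of x
    moves by t beta on one side and by t alpha on the other. *)
Lemma same_coefs_unit c a b a' b' :
  series_of a = unit_subst r.+1 c -> series_of b = unit_subst r c ->
  same_coefs a' b' -> same_coefs (a * a') (b * b').
Proof.
move=> ea eb h i j; rewrite !series_ofM ea eb.
have [M hM] := laurentP c; have [MA hA] := laurentP (series_of a').
have [MB hB] := laurentP (series_of b').
(* A window common to both products: below it c vanishes, and beyond it t is so large that the other
   factor is evaluated below its order. *)
pose L := (`|(i + j * beta%:Z - MA)%R| + `|(i + j * alpha%:Z - MB)%R| + `|M| + 1)%N.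
pose s := [seq M + (t : nat)%:Z | t <- iota 0 L].
have us : uniq s by rewrite map_inj_uniq ?iota_uniq // => x y /addrI [].
have outside t : t \notin s -> (t < M) || (M + L%:Z <= t).
  move=> ts; have [//|Mt] := ltP t M; rewrite leNgt.
  apply: contra ts => tL; apply/mapP; exists `|(t - M)%R|%N; last by lia.
  by rewrite mem_iota; lia.
have far (w : nat) (t D : int) : (0 < w)%N -> 0 < t -> D < t -> D < t * w%:Z.
  by move=> w0 t0 Dt; nia.
rewrite !(@unit_subst_mulE _ _ _ _ s) // => [|t /outside|t /outside].
- rewrite (raddf_sum embA) (raddf_sum embB) !lcoef_sum.
  apply: eq_bigr => t _.
  transitivity ((c t)%:~R * embA (series_of a' (i + (j - t) * beta%:Z)) (j - t)).
    rewrite -emb_vpow_term; congr (embA (_ * series_of a' _) _); ring.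
  rewrite h -emb_vpow_term; congr (embB (_ * series_of b' _) _); ring.
- move=> /orP[/hM|h']; [by left | right; apply: hB].
  have := @far alpha t (i + j * alpha%:Z - MB) (pred_pX_gt0 r).
  by rewrite /L in h'; lia.
move=> /orP[/hM|h']; [by left | right; apply: hA].
have := @far beta t (i + j * beta%:Z - MA) (pred_pX_gt0 r.+1).
by rewrite /L in h'; lia.
Qed.

Lemma same_coefs_v i a' b' : (i <= r)%N -> same_coefs a' b' ->
  same_coefs (v_laurent p r.+2 i * a') (v_laurent p r.+1 i * b').
Proof.
by move=> ir h s j; rewrite !series_of_vM !emb_v_term ?h // ltnS leqW.
Qed.

Lemma same_coefs_x k a b a' b' :
  series_of a = lmonom 1 k -> series_of b = lmonom 1 k ->
  same_coefs a' b' -> same_coefs (a * a') (b * b').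
Proof.
move=> ea eb h i j; rewrite !series_ofM ea eb !lcoef_monomM !mul1r.
have -> : i + j * beta%:Z - k = (i - k) + j * beta%:Z by ring.
by rewrite h; congr (embB (series_of b' _) _); ring.
Qed.

(** Phrased through multiplication by a related pair, so that the product case of the induction is
    mere associativity and no product of two general series has to be expanded. *)
Lemma same_coefs_mul a b : twist_rel a b ->
  forall a' b', same_coefs a' b' -> same_coefs (a * a') (b * b').
Proof.
elim=> {a b}.
- by move=> c a b ea eb a' b'; apply: same_coefs_unit ea eb.
- by move=> i ir a' b'; apply: same_coefs_v.
- by move=> k a b ea eb a' b'; apply: same_coefs_x ea eb.
- move=> a b c d _ IH1 _ IH2 a' b' h i j; rewrite !mulrBl !series_ofB.
  rewrite (lcoefB (series_of (a * a'))) (lcoefB (series_of (b * b'))).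
  rewrite (emb_sub_term _ _ (series_of (a * a') _)).
  rewrite (emb_sub_term _ _ (series_of (b * b') _)).
  exact: (congr2 (fun x y => x - y) (IH1 a' b' h i j) (IH2 a' b' h i j)).
- by move=> a b c d _ IH1 _ IH2 a' b' h; rewrite -!mulrA; apply/IH1/IH2.
Qed.

Lemma twist_same_coefs a b : twist_rel a b -> same_coefs a b.
Proof.
move=> h; rewrite -[a]mulr1 -[b]mulr1; apply: (same_coefs_mul h) => i j.
have -> : series_of (1 : TA) = 1 by apply: rmorph1.
have -> : series_of (1 : TB) = 1 by apply: rmorph1.
rewrite -!lmonom1 !lcoef_monom.
have [->|j0] := eqVneq j 0.
  by rewrite !mul0r; case: eqP; rewrite ?rmorph1 ?rmorph0.
have one_j (R : comPzRingType) : (1 : laurent R) j = 0.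
  by rewrite -lmonom1 lcoef_monom (negbTE j0).
by case: eqP => _; case: eqP => _; rewrite ?rmorph1 ?rmorph0 ?one_j ?lcoef0.
Qed.

Lemma twist_rel1 : twist_rel 1 1.
Proof. by apply: (@twist_x 0); apply: rmorph1. Qed.

Lemma twist_filtration K a b : twist_rel a b ->
  series_filtration r r.+2 K a <-> series_filtration r r.+2 K b.
Proof.
move=> /twist_same_coefs h; split=> H k j.
  by rewrite -[k](subrK (j * alpha%:Z)) -h; apply: H.
by rewrite -[k](subrK (j * beta%:Z)) h; apply: H.
Qed.

(* v_(n-1) does not occur in the coefficients on the side of E(n). *)
Lemma twist_no_v a b : twist_rel a b -> forall k j (e : 'X_{1..r.+2}) (i : 'I_r.+2),
  (r <= i)%N -> e i != 0%N -> (embA (series_of a k) j)@_e = 0.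
Proof.
move=> /twist_same_coefs h k j e i ri ei.
rewrite -[k](subrK (j * beta%:Z)) h; move: (series_of b _) => z.
have [l [f fZ ef]] := JW_rep z.
rewrite (embE r.+2 ef) mulrC lcoef_monomM mul1r.
apply: (@emb_poly_ind p r r.+2 _ (fun _ g => g@_e = 0)) => // [s|s x y hx hy|e' _].
- by rewrite mcoeff0.
- by rewrite mcoeffD hx hy addr0.
rewrite mcoeffZ mcoeffX; case: eqP => [ee|]; last by rewrite mulr0.
by move: ei; rewrite -ee emb_mnmE ltnNge ri.
Qed.

End Twist.
(** * Weierstrass division by the p-series *)

Section DivisionByPSeries.
Variables p r : nat.
Hypothesis p_prime : prime p.
Local Notation TA := (JW_laurent p r.+2).
Local Notation JWF := (@JW_filtration p r r.+1 r.+2).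
Local Notation SF := (series_filtration r r.+2).
Local Notation q := ((p ^ r.+1)%N%:Z).

Let rN : (r.+1 < r.+2)%N := leqnn _.
Let rm : (r <= r.+1)%N := leqnSn _.

(* [p](x) = v_(n-1) x^(p^(n-1)) + higher terms, modulo I_(n-1). *)
Definition weierstrass_like (P : TA) : Prop :=
  [/\ of_degree (gr TA) (-2) P, vanishes_below 1 (series_of P),
      forall k, k < q -> JWF 1 (series_of P k) &
      JWF 1 (series_of P q - vJW p r.+2 r.+1)].

Lemma pseries_laurent : exists2 P : TA,
  JW_laurent_val P = pseries p r.+2 & weierstrass_like P.
Proof.
have [e [eP e1 eZ eh elow]] := pseries_mpoly r.+2 p_prime.
pose w k : JW p r.+2 := JW_frac p 0 (e k).
have wE k : val (w k) = tofrac (e k).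
  by rewrite -(JW_fracE 0 (eZ k)) expr0 mulr1.
have w1 : vanishes_below 1 w.
  by move=> k k1; apply: val_inj; rewrite wE e1 // !rmorph0.
have w_sub : exists M, vanishes_below M w by exists 1.
pose f : laurent (JW p r.+2) := Laurent w_sub.
have [|P eq_f hP] := @homog_series p r.+1 (-2) f.
  by move=> k; apply: JW_frac_homog => //; rewrite mul0n addr0; apply: eh.
have wF k : in_filtration p r 1 (e k) -> JWF 1 (w k).
  by move=> h; apply/(@JW_filtration_rep p r r.+1 r.+2 _ _ _ _ _ 0 (e k));
    rewrite ?expr0 ?mulr1.
have q1 : (1 < p ^ r.+1)%N by rewrite -{1}(expn0 p) ltn_exp2l // prime_gt1.
exists P.
  rewrite -eP; apply: laurent_ext => k.
  by rewrite -[LHS]/(val (series_of P k)) eq_f -[LHS]/(val (w k)) wE.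
rewrite /weierstrass_like eq_f; split=> // [k kq|].
  apply: wF; have [k0|k0] := lerP k 0.
    by rewrite e1 ?(le_lt_trans k0) //; apply: filtration0.
  have := elow r `|k|%N; rewrite gez0_abs ?ltW // => /(_ _).
  have -> : (`|k|%N == (p ^ r.+1)%N) = false by apply/eqP; lia.
  have -> : (0 < `|k|%N <= p ^ r.+1)%N by lia.
  move=> /(_ isT) h; rewrite -[e k](subrK (if `|k|%N == 1%N then p%:R else 0)).
  apply: filtrationD.
    apply: filtration_low => //; apply: rpredB; first exact: eZ.
    by case: ifP => _; [apply: rpred_nat | apply: rpred0].
  case: ifP => _; last exact: filtration0.
  exact: (@filtration_v p r r.+2 0).
have -> : f q - vJW p r.+2 r.+1 = JW_frac p 0 (e q - @vpoly p r.+2 r.+1).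
  apply: JW_frac_unique; first by rewrite rpredB ?Zpoly_v.
  by rewrite expr0 mulr1 !rmorphB; congr (_ - _); apply: wE.
apply/(@JW_filtration_rep p r r.+1 r.+2 _ _ _ _ _ 0 (e q - @vpoly p r.+2 r.+1)) => //.
  by rewrite JW_fracE // rpredB ?Zpoly_v.
apply: filtration_low; first by rewrite rpredB ?Zpoly_v.
have := elow r (p ^ r.+1)%N; rewrite eqxx (gtn_eqF q1); apply.
by rewrite leqnn andbT ltnW.
Qed.

(** Uniqueness of Weierstrass division, by induction on the filtration level j and then on the
    exponent k. If G has level j and its coefficients before k have level j + 1, then modulo level j
    + 1 the coefficient of x^(k+q) in G P is v_(n-1) G_k: lower coefficients of P gain a level,
    higher ones meet earlier coefficients of G. As v_(n-1) does not occur in a, G_k has level j +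
    1. *)
Lemma twist_division K P G a b : weierstrass_like P ->
  twist_rel p_prime a b ->
  SF K (a - G * P) -> SF K G.
Proof.
move=> [_ P1 Plow Pq] ab FK.
have filtM i j x y : JWF i x -> JWF j y -> JWF (i + j) (x * y).
  exact: JW_filtrationM.
suff h j : (j <= K)%N -> SF j G by apply: h.
elim: j => [|j IHj] jK; first by move=> k; apply: JW_filtration_all.
have {IHj} Gj := IHj (ltnW jK).
have [M hM] := laurentP (series_of G).
suff ht (t : nat) : JWF j.+1 (series_of G (M + t%:Z)).
  move=> k; have [kM|Mk] := ltP k M; first by rewrite hM //; apply: JW_filtration0.
  have -> : k = M + `|(k - M)%R|%N%:Z by lia.
  exact: ht.
elim/ltn_ind: t => t IHt; set k := M + t%:Z.
have early i : i < k -> JWF j.+1 (series_of G i).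
  move=> ik; have [iM|Mi] := ltP i M; first by rewrite hM //; apply: JW_filtration0.
  have -> : i = M + `|(i - M)%R|%N%:Z by lia.
  by apply: IHt; lia.
have prodE : JWF j.+1 (series_of (G * P) (k + q) - series_of P q * series_of G k).
  rewrite mulrC series_ofM; have [s us hs] := lmul_supp (series_of P) (series_of G) (k + q).
  pose s' := q :: rem q s.
  have us' : uniq s' by rewrite /s' /= mem_rem_uniqF // rem_uniq.
  rewrite (@lcoefM_seq _ _ _ _ s') // => [|i]; last first.
    rewrite inE negb_or mem_rem_uniq // inE => /andP[iq].
    by rewrite iq; apply: hs.
  rewrite big_cons addrK addrAC subrr add0r big_seq.
  apply: (big_ind (JWF j.+1)) => [|x y|i]; [exact: JW_filtration0 | exact: JW_filtrationD |].
  rewrite mem_rem_uniq // inE => /andP[iq _].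
  have [iltq|qi] := ltP i q.
    exact: (@filtM 1 j _ _ (Plow i iltq) (Gj _)).
  apply: (@filtM 0 j.+1 _ _ (JW_filtration_all p_prime rN rm _)); apply: early.
  by move/eqP: iq; lia.
have step : JWF j.+1 (series_of a (k + q) - vJW p r.+2 r.+1 * series_of G k).
  have -> : series_of a (k + q) - vJW p r.+2 r.+1 * series_of G k =
    series_of (a - G * P) (k + q) + (series_of (G * P) (k + q) -
      series_of P q * series_of G k) +
    (series_of P q - vJW p r.+2 r.+1) * series_of G k.
    by rewrite series_ofB lcoefB; ring.
  apply: JW_filtrationD; last exact: (@filtM 1 j _ _ Pq (Gj _)).
  by apply: JW_filtrationD => //; apply: JW_filtrationW (FK _).
move=> i; have := step i; rewrite emb_sub_term emb_v_term //.
pose l0 : 'I_r.+2 := Ordinal (leqW (ltnSn r)).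
have rl0 : (r <= l0)%N by exact: leqnn.
have -> : @vpoly p r.+2 r.+1 = 'X_l0.
  rewrite /=; case: insubP => [l _ lr|] /=; last by rewrite ltnS leqW.
  by congr 'X_ _; apply: val_inj.
apply: (filtration_divX rl0) => e el0.
exact (twist_no_v ab (k + q) i rl0 el0).
Qed.

End DivisionByPSeries.

(** * Density of the relation: existence of Weierstrass division *)

Section Approximation.
Variables p r : nat.
Hypothesis p_prime : prime p.
Local Notation TA := (JW_laurent p r.+2).
Local Notation TB := (JW_laurent p r.+1).
Local Notation rel := (@twist_rel p r p_prime).
Local Notation unit_subst := (@unit_subst p p_prime).
Local Notation wt m := (p ^ m - 1)%N.

Lemma JW_homog_int m' (c : int) : JW_homog (p := p) (m := m'.+1) 0 c%:~R.
Proof.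
have nat_case (k : nat) : JW_homog (p := p) (m := m'.+1) 0 k%:R.
  elim: k => [|k IHk]; first exact: JW_homog0.
  rewrite -[k.+1]add1n natrD.
  by apply: (homogD (H := JW_grading p m'.+1)); first exact: JW_homog1.
case: c => k; first exact: nat_case.
rewrite NegzE rmorphN; apply: (homogN (H := JW_grading p m'.+1)).
exact: nat_case.
Qed.

Lemma vpow_homog m' (b : int) : JW_homog (b * (vdeg p m'.+1)%:Z) (vpow p m' b).
Proof.
case: b => k.
  exists 0%N, (@vpoly p m'.+1 m'.+1 ^+ k); split.
  - by rewrite rpredX // mpolyOver_v.
  - by rewrite mul0n addr0 mulrC; apply/mpoly_homogX/mpoly_homog_v.
  by rewrite expr0 mulr1 rmorphXn.
exists k.+1, 1; split; first exact: rpred1.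
  have -> : Negz k * (vdeg p m'.+1)%:Z + (k.+1 * vdeg p m'.+1)%N%:Z = 0.
    by rewrite NegzE; lia.
  exact: mpoly_homog1.
by rewrite NegzE /= -exprnN mulVf ?rmorph1 // expf_neq0 // vfrac_neq0.
Qed.

Lemma unit_subst_homog m' c : laurent_homog (R := JW p m'.+1) 0 (unit_subst m' c).
Proof.
apply: (@lsubstP _ _ _ _ _ _ (fun k z => JW_homog (0 + 2 * k) z)) => [k|i].
  exact: JW_homog0.
have -> : 0 + 2 * (i * (wt m'.+1)%:Z) = 0 + i * (vdeg p m'.+1)%:Z.
  by rewrite /vdeg; lia.
by apply: JW_homogM; [apply: JW_homog_int | apply: vpow_homog].
Qed.

Lemma twist_series (delta : int) c : exists a b,
  [/\ rel a b, of_degree (gr TA) (2 * delta) a, of_degree (gr TB) (2 * delta) b,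
      forall k, series_of a k = unit_subst r.+1 c (k + delta) &
      forall k, series_of b k = unit_subst r c (k + delta)].
Proof.
have [a ea ha] := homog_series (@unit_subst_homog r.+1 c).
have [b eb hb] := homog_series (@unit_subst_homog r c).
have X_homog m' : laurent_homog (R := JW p m'.+1) (2 * delta) (lmonom 1 (- delta)).
  apply: laurent_homog_monom; first exact: homog1.
  by ring.
have [xa exa hxa] := homog_series (X_homog r.+1).
have [xb exb hxb] := homog_series (X_homog r).
exists (xa * a), (xb * b); split.
- by apply: twist_mul; [apply: twist_x exa exb | apply: twist_unit ea eb].
- by rewrite -[2 * delta]addr0; apply: homogM.
- by rewrite -[2 * delta]addr0; apply: homogM.
- by move=> k; rewrite series_ofM exa lcoef_monomM ea mul1r opprK.
- by move=> k; rewrite series_ofM exb lcoef_monomM eb mul1r opprK.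
Qed.

(** A power of v_m has degree d + 2k only if p^m - 1 divides k + delta, so these coefficients form
    x^(-delta) times a Laurent series in v_m x^(p^m - 1). *)
Lemma unit_subst_residue m' (d delta M : int) (gam : int -> int) :
  d = 2 * delta -> (forall k, k < M -> gam k = 0) ->
  (forall k, gam k != 0 -> ((vdeg p m'.+1)%:Z %| d + 2 * k)%Z) ->
  exists c, forall k, unit_subst m' c (k + delta) =
    (gam k)%:~R * vpow p m' ((d + 2 * k) %/ (vdeg p m'.+1)%:Z)%Z.
Proof.
move=> dE gM gdvd; have w0 := pred_pX_gt0 p_prime m'.
pose w := (wt m'.+1)%:Z.
have vE : (vdeg p m'.+1)%:Z = 2 * w by rewrite /vdeg /w; lia.
have c_sub : exists L, @vanishes_below int L (fun s => gam (s * w - delta)).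
  exists (- (`|M|%N%:Z + `|delta|%N%:Z)) => s hs; apply: gM.
  have : s * w <= s by rewrite /w; nia.
  by lia.
exists (Laurent c_sub) => k.
have [/dvdzP[s ks]|nk] := boolP (w %| k + delta)%Z.
  rewrite ks [LHS]lsubstE; congr (_ * _).
    by rewrite -[LHS]/((gam (s * w - delta))%:~R) -ks addrK.
  congr vpow; rewrite dE vE -mulrDr addrC ks divzMpl // mulzK //.
  by rewrite /w lt0n_neq0.
rewrite [LHS]lsubst_ndvd //; suff -> : gam k = 0 by rewrite mul0r.
apply/eqP; apply: contraNT nk => /gdvd; rewrite dE vE -mulrDr.
by rewrite dvdz_mul2l // addrC.
Qed.

Lemma twist_rel0 : rel 0 0.
Proof. by rewrite -(subrr 1) -[X in rel _ X](subrr 1); apply: twist_sub; apply: twist_rel1. Qed.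

(** As |v_m| is even, no power of v_m has odd degree; in odd degrees all residues vanish. *)
Lemma even_or_odd (d : int) : (exists delta, d = 2 * delta) \/
  forall k w : int, ~~ (2 * w %| d + 2 * k)%Z.
Proof.
have [/dvdzP[e ->]|nd] := boolP (2 %| d)%Z; first by left; exists e; rewrite mulrC.
right=> k w; apply: contra nd => /dvdzP[e h]; apply/dvdzP; exists (e * w - k).
by lia.
Qed.

Lemma twist_residueA (d M : int) (gam : int -> int) :
  (forall k, k < M -> gam k = 0) ->
  (forall k, gam k != 0 -> ((vdeg p r.+2)%:Z %| d + 2 * k)%Z) ->
  exists a b, [/\ rel a b, of_degree (gr TA) d a, of_degree (gr TB) d b &
    forall k, series_of a k =
      (gam k)%:~R * vpow p r.+1 ((d + 2 * k) %/ (vdeg p r.+2)%:Z)%Z].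
Proof.
move=> gM gdvd; have [[delta dE]|odd] := even_or_odd d.
  have [c ec] := unit_subst_residue dE gM gdvd.
  have [a [b [h ha hb ea eb]]] := twist_series delta c.
  by exists a, b; split; rewrite ?dE // => k; rewrite ea ec dE.
exists 0, 0; split; [exact: twist_rel0 | exact: homog0 | exact: homog0 | move=> k].
suff -> : gam k = 0 by rewrite mul0r series_of0.
apply/eqP; apply: contraT => /gdvd.
by rewrite /vdeg PoszM (negbTE (odd _ _)).
Qed.

Lemma twist_residueB (d M : int) (gam : int -> int) :
  (forall k, k < M -> gam k = 0) ->
  (forall k, gam k != 0 -> ((vdeg p r.+1)%:Z %| d + 2 * k)%Z) ->
  exists a b, [/\ rel a b, of_degree (gr TA) d a, of_degree (gr TB) d b &
    forall k, series_of b k =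
      (gam k)%:~R * vpow p r ((d + 2 * k) %/ (vdeg p r.+1)%:Z)%Z].
Proof.
move=> gM gdvd; have [[delta dE]|odd] := even_or_odd d.
  have [c ec] := unit_subst_residue dE gM gdvd.
  have [a [b [h ha hb ea eb]]] := twist_series delta c.
  by exists a, b; split; rewrite ?dE // => k; rewrite eb ec dE.
exists 0, 0; split; [exact: twist_rel0 | exact: homog0 | exact: homog0 | move=> k].
suff -> : gam k = 0 by rewrite mul0r series_of0.
apply/eqP; apply: contraT => /gdvd.
by rewrite /vdeg PoszM (negbTE (odd _ _)).
Qed.

(** Modulo p, v_1, ..., v_(n-2) the ring E(n-1)_* retains only powers of v_(n-1), so on this side
    taking residues of coefficients is enough and nothing is divided. *)
Lemma approxB d (b : TB) : of_degree (gr TB) d b -> exists a b',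
  [/\ rel a b', of_degree (gr TA) d a & combination (v_laurent p r.+1) r.+1
      (fun i w => of_degree (gr TB) (d - (vdeg p i)%:Z) w) (b - b')].
Proof.
move=> hb; have [M hM] := laurentP (series_of b).
have /choice[g hg] k := JW_residue p_prime (leqnn r.+1) (leqnn r) (hb k).
pose gam k := if k < M then 0 else g k.
have [|k|a [b' [h ha hb' eb']]] := @twist_residueB d M gam.
- by rewrite /gam => k ->.
- by rewrite /gam; case: ifP => [_|_]; [rewrite eqxx | have [] := hg k].
exists a, b'; split=> //.
pose G (i : nat) (k : int) (z : JW p r.+1) := JW_homog (d - (vdeg p i)%:Z + 2 * k) z.
have [||k|Hs hHs ->] := @series_combination p r d (b - b') r.+1 G.
- by [].
- by move=> i k; apply: JW_homog0.
- rewrite series_ofB lcoefB eb' /gam; case: ltP => kM.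
    rewrite hM // mul0r subr0; apply: combination0 => i; exact: JW_homog0.
  have [_ [zs hz ez]] := hg k; exists zs => // i.
  by have := hz i; rewrite /G addrAC.
by exists Hs => // i; have [] := hHs i.
Qed.

Section WeierstrassDivision.
Variable P : TA.
Hypothesis P_weier : weierstrass_like P.
Local Notation JWF := (@JW_filtration p r r.+1 r.+2).
Local Notation q := (p ^ r.+1)%N.

Let rN : (r.+1 < r.+2)%N := leqnn _.
Let rm : (r <= r.+1)%N := leqnSn _.

Lemma combination_filtration (G : nat -> JW p r.+2 -> Prop) z :
  combination (vJW p r.+2) r.+1 G z -> JWF 1 z.
Proof.
move=> [zs _ ->]; apply: (big_ind (JWF 1)) => [|x y|i _].
- exact: JW_filtration0.
- exact: JW_filtrationD.
apply: (@JW_filtrationM p r r.+1 r.+2 1 0); last exact: JW_filtration_all.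
by apply: JW_filtration_v; rewrite // -ltnS.
Qed.

(** The last term of the combination in [JW_residue] is kept apart: it is the multiple of v_(n-1)
    that division by P removes. [c] and [y] are total, with value 0 off the homogeneous elements, so
    that a recursion can call them. *)
Lemma JW_residue_v : exists c : int -> JW p r.+2 -> int,
  exists y : int -> JW p r.+2 -> JW p r.+2, forall D z, JW_homog D z ->
  [/\ c D z != 0 -> ((vdeg p r.+2)%:Z %| D)%Z,
      JW_homog (D - (vdeg p r.+1)%:Z) (y D z) &
      JWF 1 (z - (c D z)%:~R * vpow p r.+1 (D %/ (vdeg p r.+2)%:Z)%Z
               - vJW p r.+2 r.+1 * y D z)].
Proof.
have /choice[f hf] (u : int * JW p r.+2) : exists w : int * JW p r.+2,
    JW_homog u.1 u.2 ->
    [/\ w.1 != 0 -> ((vdeg p r.+2)%:Z %| u.1)%Z,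
      JW_homog (u.1 - (vdeg p r.+1)%:Z) w.2 &
      JWF 1 (u.2 - w.1%:~R * vpow p r.+1 (u.1 %/ (vdeg p r.+2)%:Z)%Z
               - vJW p r.+2 r.+1 * w.2)].
  case: u => D z /=; have [hz|] := pselect (JW_homog D z); last by exists (0, 0).
  have [c [hc [zs hzs ez]]] := JW_residue p_prime rN rm hz.
  exists (c, zs r.+1) => _; split=> //=.
  rewrite ez big_ord_recr /= addrK.
  by apply: (@combination_filtration (fun=> fun=> True)); exists (fun i => zs i).
exists (fun D z => (f (D, z)).1), (fun D z => (f (D, z)).2) => D z.
exact: (hf (D, z)).
Qed.

(* Division of h by P: the pairs f t = (c_t, y_t) are built by recursion on t; y_t is
   the coefficient of x^(M - p^(n-1) + t) in the quotient, and c_t, an integer times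
   a power of v_n, the coefficient of x^(M + t) in the remainder. *)
Lemma approxA d (h : TA) : of_degree (gr TA) d h -> exists a b g,
  [/\ rel a b, of_degree (gr TB) d b & combination (v_laurent p r.+2) r.+1
      (fun i w => of_degree (gr TA) (d - (vdeg p i)%:Z) w) (h - a - g * P)].
Proof.
move=> hh; have [M hM] := laurentP (series_of h).
have [hP P1 Plow Pq] := P_weier; have [c [y cy]] := JW_residue_v.
pose Pk k := series_of P k.
(* What is left of the coefficient of x^(M+t) after the earlier quotient coefficients. Only
   coefficients of P beyond q enter; those before q have filtration 1 and go into the error. *)
pose rest (s : nat -> int * JW p r.+2) t :=
  series_of h (M + t%:Z) - \sum_(0 <= l < t) (s l).2 * Pk (q%:Z + (t - l)%N%:Z).
pose deg t := d + 2 * (M + t%:Z).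
have [f ef] := strong_recursion (fun s : seq (int * JW p r.+2) =>
  let t := size s in let z := rest (nth (0, 0) s) t in
  (c (deg t) z, y (deg t) z)).
have {}ef t : f t = (c (deg t) (rest f t), y (deg t) (rest f t)).
  have restE : rest (nth (0, 0) (mkseq f t)) t = rest f t.
    rewrite /rest; congr (_ - _); apply: eq_big_nat => l /andP[_ lt].
    by rewrite nth_mkseq.
  by rewrite ef; cbv zeta; rewrite size_mkseq restE.
have q_gt0 : (0 < q)%N by rewrite expn_gt0 prime_gt0.
have restH t : JW_homog (deg t) (rest f t).
  elim/ltn_ind: t => t IHt.
  apply: (homogB (g := JW_grading p r.+2)); first exact: hh.
  rewrite big_nat; apply: (big_ind (fun z => JW_homog (deg t) z)) => [|u w|l /andP[_ lt]].
  - exact: JW_homog0.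
  - exact: (homogD (H := JW_grading p r.+2)).
  have -> : deg t = (deg l - (vdeg p r.+1)%:Z) + (-2 + 2 * (q%:Z + (t - l)%N%:Z)).
    by rewrite /deg /vdeg; lia.
  apply: JW_homogM; last exact: hP.
  by rewrite ef /=; have [] := cy _ _ (IHt l lt).
pose N := M - q%:Z.
have g_sub : exists L, @vanishes_below (JW p r.+2) L
    (fun k => if k < N then 0 else (f `|(k - N)%R|%N).2).
  by exists N => k ->.
have [|g eg hg] := @homog_series p r.+1 (d + 2) (@Laurent (JW p r.+2) _ g_sub).
  move=> k /=; case: ltP => kN; first exact: JW_homog0.
  have -> : d + 2 + 2 * k = deg `|(k - N)%R|%N - (vdeg p r.+1)%:Z.
    by rewrite /deg /vdeg /N in kN *; lia.
  by rewrite ef /=; have [] := cy _ _ (restH `|(k - N)%R|%N).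
have gN : vanishes_below N (series_of g) by rewrite eg => k /= ->.
have gE (l : nat) : series_of g (N + l%:Z) = (f l).2.
  rewrite eg /= ifF; last by lia.
  by have -> : `|(N + l%:Z - N)%R|%N = l by lia.
pose gam k := if k < M then 0 else (f `|(k - M)%R|%N).1.
have [|k|a [b [hab ha hb ea]]] := @twist_residueA d M gam.
- by rewrite /gam => k ->.
- rewrite /gam; case: ltP => [_|Mk]; first by rewrite eqxx.
  rewrite ef /=; have [h1 _ _] := cy _ _ (restH `|(k - M)%R|%N).
  by move=> /h1; rewrite /deg; have -> : M + `|(k - M)%R|%N%:Z = k by lia.
exists a, b, g; split=> //.
set z := h - a - g * P.
have hz : of_degree (gr TA) d z.
  apply: homogB; first exact: homogB.
  have -> : d = (d + 2) + (-2) by ring.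
  exact: homogM.
have P0 : vanishes_below 0 (series_of P) by apply: vanishes_belowW P1.
have gPE (j : nat) : series_of (g * P) (N + j%:Z) =
    \sum_(0 <= l < j.+1) (f l).2 * Pk (j - l)%N%:Z.
  rewrite series_ofM -[N]addr0 [LHS](@lmul_funE _ N 0 _ _ j gN P0) big_mkord.
  by apply: eq_bigr => l _; rewrite gE add0r.
have lowF (l j : nat) : (j - l < q)%N -> JWF 1 ((f l).2 * Pk (j - l)%N%:Z).
  move=> jl; rewrite mulrC; apply: (@JW_filtrationM p r r.+1 r.+2 1 0).
    by apply: Plow; rewrite ltz_nat.
  exact: JW_filtration_all.
have zF k : JWF 1 (series_of z k).
  rewrite /z !series_ofB !lcoefB ea /gam; case: ltP => [kM|Mk].
    rewrite hM // mul0r subr0 sub0r; apply: JW_filtrationN.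
    have [kN|Nk] := ltP k N.
      rewrite series_ofM (lmul_below gN P0) ?addr0 //; exact: JW_filtration0.
    have -> : k = N + `|(k - N)%R|%N%:Z by lia.
    rewrite gPE big_nat; apply: (big_ind (JWF 1)) => [|u w|l _].
    - exact: JW_filtration0.
    - exact: JW_filtrationD.
    by apply: lowF; rewrite /N in Nk *; lia.
  set t := `|(k - M)%R|%N; have kE : k = M + t%:Z by rewrite /t; lia.
  have kN : k = N + (q + t)%N%:Z by rewrite kE /N; lia.
  have [_ _] := cy _ _ (restH t); rewrite {2}/rest => zt.
  (* Split at l = t: smaller l give what [rest] has already subtracted, l = t meets the coefficient
     of P at q, and larger l meet P before q, hence only contribute error. *)
  rewrite [X in series_of (g * P) X]kN gPE (@big_cat_nat _ _ _ t) //=; last by lia.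
  rewrite (@big_ltn _ _ _ t) /=; last by lia.
  set S2 := \sum_(t.+1 <= l < _) _.
  have S2F : JWF 1 S2.
    rewrite /S2 big_nat; apply: (big_ind (JWF 1)) => [|u w|l /andP[tl _]].
    - exact: JW_filtration0.
    - exact: JW_filtrationD.
    by apply: lowF; lia.
  have S1E : \sum_(0 <= l < t) (f l).2 * Pk (q + t - l)%N%:Z =
      \sum_(0 <= l < t) (f l).2 * Pk (q%:Z + (t - l)%N%:Z).
    apply: eq_big_nat => l /andP[_ lt]; congr (_ * Pk _).
    by lia.
  rewrite S1E; have -> : (q + t - t = q)%N by rewrite addnK.
  have hkt : series_of h k = series_of h (M + t%:Z) by rewrite -kE.
  rewrite hkt; have -> : ((d + 2 * k) %/ (vdeg p r.+2)%:Z)%Z =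
      (deg t %/ (vdeg p r.+2)%:Z)%Z by rewrite /deg -kE.
  set S1 := \sum_(0 <= l < t) _ in zt *.
  set cv := _ * vpow _ _ _ in zt *.
  have ef1 : (f t).1 = c (deg t) (rest f t) by rewrite ef.
  have ef2 : (f t).2 = y (deg t) (rest f t) by rewrite ef.
  rewrite ef1 ef2; set yt := y _ _ in zt *.
  have -> : series_of h (M + t%:Z) - cv - (S1 + (yt * Pk q%:Z + S2)) =
    (series_of h (M + t%:Z) - S1 - cv - vJW p r.+2 r.+1 * yt)
    - (Pk q%:Z - vJW p r.+2 r.+1) * yt - S2 by ring.
  apply: JW_filtrationD; last exact: JW_filtrationN.
  apply: JW_filtrationD; first exact: zt.
  apply/JW_filtrationN/(@JW_filtrationM p r r.+1 r.+2 1 0) => //.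
  exact: JW_filtration_all.
pose G (i : nat) (k : int) (w : JW p r.+2) := JW_homog (d - (vdeg p i)%:Z + 2 * k) w.
have [||k|Hs hHs ->] := @series_combination p r.+1 d z r.+1 G.
- by [].
- by move=> i k; apply: JW_homog0.
- have [zs hzs ez] := JW_decomposition p_prime rN rm (hz k) (zF k).
  by exists zs => // i; have [h1 _] := hzs i; rewrite /G addrAC.
by exists Hs => // i; have [] := hHs i.
Qed.

End WeierstrassDivision.
End Approximation.
(** * The isomorphism *)

Section TateCompletion.
Variables p r : nat.
Hypothesis p_prime : prime p.
Local Notation TA := (JW_laurent p r.+2).
Local Notation TB := (JW_laurent p r.+1).
Local Notation rel := (@twist_rel p r p_prime).
Local Notation qc := (qclass (pseries_ideal p r.+2)).
Local Notation IA := (v_ideal (v_tE p r.+2) r.+1).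
Local Notation IB := (v_ideal (v_laurent p r.+1) r.+1).

Let rN : (r.+1 < r.+2)%N := leqnn _.
Let rm : (r <= r.+1)%N := leqnSn _.

Definition tate_rel (u : pi_tE p r.+2) (b : TB) : Prop :=
  exists2 a : TA, u = qc a & rel a b.

Lemma JW_laurent_val_inj : injective (@JW_laurent_val p r.+2).
Proof. by move=> f g /(lmap_inj val_inj) /val_inj. Qed.

Lemma pseries_idealP (P f : TA) : JW_laurent_val P = pseries p r.+2 ->
  pseries_ideal p r.+2 f -> exists g, f = g * P.
Proof.
move=> eP [g hg]; exists g; apply: JW_laurent_val_inj.
rewrite hg -eP /JW_laurent_val.
by rewrite (rmorphM val) rmorphM.
Qed.

Lemma pseries_ideal_mul (P g : TA) : JW_laurent_val P = pseries p r.+2 ->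
  pseries_ideal p r.+2 (g * P).
Proof. by move=> eP; exists g; rewrite -eP /JW_laurent_val (rmorphM val) rmorphM. Qed.

(** From left to right, a lift a0 of u in the k-th power differs from a by a multiple g P;
    [twist_division] gives filtration k to g, hence to a, hence to b. The converse is projection to
    the quotient. *)
Lemma tate_rel_exp (P : TA) k u b : JW_laurent_val P = pseries p r.+2 ->
  weierstrass_like P -> tate_rel u b -> ideal_exp IA k u <-> ideal_exp IB k b.
Proof.
move=> eP hP [a -> ab]; split=> h.
  have surj w : exists x, w = qc x by apply: qclass_repr.
  have [a0 a0I e] := ideal_exp_lift (f := qc) surj h.
  have [g eg] := pseries_idealP eP (proj1 (qclassE _ _ _) e).
  have a0F := v_ideal_filtration p_prime rN rm a0I.
  have gF : series_filtration r r.+2 k g.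
    by apply: (twist_division hP ab); rewrite -eg opprB addrCA subrr addr0.
  apply: (filtration_v_ideal p_prime (leqnSn _) (leqnn r)).
  apply/(twist_filtration k ab).
  rewrite -[a](subrK a0) eg; apply: series_filtrationD => //.
  by rewrite mulrC; apply: series_filtrationMl.
apply: (@ideal_exp_image _ _ qc (v_laurent p r.+2) r.+1).
apply: (filtration_v_ideal p_prime rN rm).
apply/(twist_filtration k ab).
exact: (v_ideal_filtration p_prime (leqnSn _) (leqnn r) h).
Qed.

Lemma tate_completion_iso : gring_iso (gcompletion IA) (gcompletion IB).
Proof.
have [P eP hP] := pseries_laurent r p_prime.
have rel1 : tate_rel 1 1 by exists 1; [rewrite rmorph1 | apply: twist_rel1].
have relB u b u' b' : tate_rel u b -> tate_rel u' b' -> tate_rel (u - u') (b - b').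
  move=> [a -> h] [a' -> h']; exists (a - a'); first by rewrite rmorphB.
  exact: twist_sub.
have relM u b u' b' : tate_rel u b -> tate_rel u' b' -> tate_rel (u * u') (b * b').
  move=> [a -> h] [a' -> h']; exists (a * a'); first by rewrite rmorphM.
  exact: twist_mul.
have vI (A : gring) (v : nat -> A) i : (i < r.+1)%N -> v_ideal v r.+1 (v i).
  by move=> ir; apply: mem_ideal_gen; exists i.
have relv i : (i < r.+1)%N -> tate_rel (v_tE p r.+2 i) (v_laurent p r.+1 i).
  by move=> ir; exists (v_laurent p r.+2 i); [| apply: twist_v].
have v_homog m' i : of_degree (gr (JW_laurent p m'.+1)) (vdeg p i)%:Z
    (v_laurent p m'.+1 i).
  apply: laurent_homog_monom; last by rewrite mulr0 addr0.
  exists 0%N, (@vpoly p m'.+1 i); split; first exact: mpolyOver_v.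
    by rewrite mul0n addr0; apply: mpoly_homog_v.
  by rewrite expr0 mulr1.
apply: (gcompletion_iso (rho := tate_rel)) => //.
- by move=> k u b; apply: tate_rel_exp eP hP.
- apply: (approx_exp (v := v_tE p r.+2) (u := v_laurent p r.+1) (L := r.+1)
    (dv := fun i => (vdeg p i)%:Z)) => // [i ir|d _ [h hh ->]].
    exact: vI.
  have [a [b [g [ab hb [zs hz ez]]]]] := approxA p_prime hP hh.
  exists (qc a), b; split=> //; first by exists a.
  exists (fun i => qc (zs i)) => [i|]; first by exists (zs i).
  (* The multiple of [p](x) dies in the quotient, which leaves the combination of the v_i. *)
  transitivity (qc (h - a - g * P)).
    rewrite -rmorphB; apply/qclassE.
    have -> : h - a - (h - a - g * P) = g * P by ring.
    exact: pseries_ideal_mul.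
  by rewrite ez rmorph_sum; apply: eq_bigr => i _; rewrite rmorphM.
move=> k d b hb.
have [||i ir|i ir|i _|e b1 hb1|b' [u [h hu hI]]] := @approx_exp TB (pi_tE p r.+2)
    IB (fun b u => tate_rel u b) (v_laurent p r.+1) (v_tE p r.+2) r.+1
    (fun i => (vdeg p i)%:Z) rel1 _ _ _ _ _ _ k d b hb.
- by move=> x y x' y' h h'; apply: relB.
- by move=> x y x' y' h h'; apply: relM.
- exact: vI.
- exact: relv.
- by exists (v_laurent p r.+2 i); [apply: v_homog|].
- have [a [b' [ab ha hab]]] := approxB p_prime hb1.
  exists b', (qc a); split=> //; first by exists a.
  by exists a.
by exists u, b'.
Qed.

End TateCompletion.

Theorem theorem1 (p n : nat) (p_prime : prime p) (n_ge2 : (2 <= n)%N) :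
  gring_iso
    (@gcompletion (pi_tE p n) (v_ideal (v_tE p n) (n - 1)))
    (@gcompletion (JW_laurent p (n - 1))
                  (v_ideal (v_laurent p (n - 1)) (n - 1))).
Proof.
case: n n_ge2 => [|[|r]] // _.
exact: tate_completion_iso.
Qed.
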